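(* Let $S$ be a set of $n$ i.i.d. samples $(x_i,y_i)$ from the linear model $y_i=x_i^T\beta^*+z_i$, where $\beta^*\in\mathbb{R}^p$, the covariates $x_i\in\mathbb{R}^p$ satisfy $\mathbb{E}x_i=0$, $\mathbb{E}x_ix_i^T=I$ and $(4,2)$-hypercontractivity with parameter $\sigma_{x,4}\le C$ for a known constant $C$, and the noise variables $z_i$ are i.i.d., independent of the covariates, with $\mathbb{E}z_i=0$ and $\mathbb{E}z_i^2=\sigma^2$. Let $\widehat\beta_1$ be any estimator which is independent of $S$ and satisfies $\|\widehat\beta_1-\beta^*\|_2=O(\sigma)$. Let $T$ be an $\epsilon$-corrupted version of $S$, where $T$ might depend on $\widehat\beta_1$. Define $$T_1:=\left\{\widehat\beta_1+(y_i'-x_i'^T\widehat\beta_1)x_i':(x_i',y_i')\in T\right\}.$$ Let $\tau\in(0,1)$ and suppose $\epsilon'=\Theta\left(\epsilon+\frac{\log(1/\tau)}{n}\right)=O(1)$. Then, given $\epsilon$, $T_1$ and $\tau$ as inputs, the filtered median-of-means algorithm (defined in the context) returns an output $\widehat\beta$ satisfying $$\|\widehat\beta-\beta^*\|_2\lesssim\sigma\left(\sqrt{\frac pn}+\sqrt\epsilon+\sqrt{\frac{\log(1/\tau)}{n}}\right)$$ with probability at least $1-\tau$.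
   Context: Hypercontractivity: a random vector $X\in\mathbb{R}^p$ satisfies $(4,2)$-hypercontractivity with parameter $\sigma_4$ if $(\mathbb{E}|v^TX|^4)^{1/4}\le\sigma_4(\mathbb{E}(v^TX)^2)^{1/2}$ for all unit vectors $v$. Corruption (strong contamination model): $T$ is an $\epsilon$-corrupted version of $S$ if $|T|=|S|$ and $|T\cap S|\ge(1-\epsilon)|S|$; $T$ may depend on $S$ arbitrarily. Stability: for $0<\epsilon<1/2$ and $\delta\ge\epsilon$, a finite multiset $S\subset\mathbb{R}^p$ is $(\epsilon,\delta)$-stable with respect to $\mu$ and $\sigma^2$ if for all $S'\subseteq S$ with $|S'|\ge(1-\epsilon)|S|$: $\left\|\frac1{|S'|}\sum_{x\in S'}x-\mu\right\|_2\le\sigma\delta$ and $\left\|\frac1{|S'|}\sum_{x\in S'}(x-\mu)(x-\mu)^T-\sigma^2I\right\|_2\le\frac{\sigma^2\delta^2}{\epsilon}$. Filter: the iterative filtering algorithm from robust mean estimation is a computationally efficient randomized algorithm which takes a finite multiset $T\subset\mathbb{R}^p$ and $\epsilon_0<1/2$ and outputs $T'\subseteq T$, with the following guarantee, for absolute constants $c_1,c_2,c_3>0$ and any large enough constant $C_0>1$: if $T$ is an $\epsilon_0$-corrupted version of a multiset $S$ of $N$ points containing $S'\subseteq S$ with $|S'|\ge(1-\epsilon_0)|S|$ that is $(C_0\epsilon_0,\delta)$-stable with respect to $\mu$ and $\sigma^2$, then with probability at least $1-O(\exp(-\Omega(N\epsilon_0)))$ over its internal randomness, $|T'|\ge(1-c_1\epsilon_0)|T|$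 and $T'$ is $(c_2C_0\epsilon_0,c_3\delta)$-stable with respect to $\mu$ and $\sigma^2$. Filtered median-of-means algorithm, input $\epsilon$, a multiset of $n$ points in $\mathbb{R}^p$, and $\tau$: set $\epsilon'=\Theta(\epsilon+\log(1/\tau)/n)$ (less than a small constant) and $k=\lceil\epsilon'n\rceil$; randomly partition the points into $k$ disjoint buckets of equal size (removing some points if $k\nmid n$) and let $w_1,\dots,w_k$ be the bucket means; run the filter on $\{w_1,\dots,w_k\}$ with filter parameter equal to a suitable constant; return the empirical mean of the filter's output. Constants: implied constants are positive and may depend only on $C$ and the constant in $\|\widehat\beta_1-\beta^*\|_2=O(\sigma)$. $\epsilon'=O(1)$ means that $\epsilon'$ is less than a sufficiently small constant; $\Theta(B)$ in parameter choices means a suitable (sufficiently large) constant multiple of $B$.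
   Formalization: For τ>1/2, ε' is taken as Θ(ε+log(2)/n) instead of Θ(ε+log(1/τ)/n): as τ→1 with ε=0 the latter gives one bucket, where the filter's guarantee can be void and the claim fails. The error bound keeps log(1/τ). *)

(* Defs.v *)
From HB Require Import structures.
From mathcomp Require Import all_boot all_order all_algebra all_fingroup.
From mathcomp Require Import all_classical all_reals all_analysis.

Set Implicit Arguments.
Unset Strict Implicit.
Unset Printing Implicit Defensive.
Import Order.TTheory GRing.Theory Num.Theory.
Import numFieldNormedType.Exports.
Local Open Scope classical_set_scope.
Local Open Scope ring_scope.

(* The sigma-algebra on matrices generated by the entries; on 'rV[R]_p over a
   realType this is the Borel sigma-algebra of R^p. *)
Definition mx_entries_preimages d (T : measurableType d) (m n : nat) :
    set (set 'M[T]_(m, n)) :=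
  [set X | exists i j (B : set T),
    measurable B /\ X = [set M : 'M[T]_(m, n) | B (M i j)]].

Section measurable_matrix.
Context d (T : measurableType d) (m n : nat).

Let mx_measurable : set (set 'M[T]_(m, n)) :=
  <<s @mx_entries_preimages d T m n >>.

Let mx_set0 : mx_measurable set0.
Proof. exact: sigma_algebra0. Qed.

Let mx_setC A : mx_measurable A -> mx_measurable (~` A).
Proof. exact: sigma_algebraC. Qed.

Let mx_bigcup (F : (set 'M[T]_(m, n))^nat) :
  (forall i, mx_measurable (F i)) -> mx_measurable (\bigcup_i (F i)).
Proof. exact: sigma_algebra_bigcup. Qed.

HB.instance Definition _ := @isMeasurable.Build d 'M[T]_(m, n) mx_measurable
  mx_set0 mx_setC mx_bigcup.

End measurable_matrix.

(* Elements of R^p are row vectors. The library norm on matrices is the sup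
   norm, hence the explicit Euclidean and spectral norms. *)
Definition dot (R : realType) (p : nat) (u v : 'rV[R]_p) : R :=
  \sum_(a < p) u 0 a * v 0 a.

Definition l2norm (R : realType) (p : nat) (v : 'rV[R]_p) : R :=
  Num.sqrt (\sum_(a < p) v 0 a ^+ 2).

(* The unit ball rather than the unit sphere, so that the set is nonempty when
   p = 0; for p > 0 the two suprema agree. *)
Definition opnorm (R : realType) (p : nat) (M : 'M[R]_p) : R :=
  sup [set l2norm (v *m M) | v in [set v : 'rV[R]_p | l2norm v <= 1]].

Definition independent d (Omega : measurableType d) (R : realType)
    (P : probability Omega R) d1 (V : measurableType d1) d2
    (W : measurableType d2) (X : Omega -> V) (Y : Omega -> W) : Prop :=
  forall A B, measurable A -> measurable B ->
    P (X @^-1` A `&` Y @^-1` B) = (P (X @^-1` A) * P (Y @^-1` B))%E.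

Definition mutually_independent d (Omega : measurableType d) (R : realType)
    (P : probability Omega R) d1 (V : measurableType d1) (n : nat)
    (X : 'I_n -> Omega -> V) : Prop :=
  forall (J : {set 'I_n}) (B : 'I_n -> set V), (forall i, measurable (B i)) ->
    P (\bigcap_(i in [set` J]) (X i @^-1` B i)) =
    (\prod_(i in J) fine (P (X i @^-1` B i)))%:E.

Definition identically_distributed d (Omega : measurableType d) (R : realType)
    (P : probability Omega R) d1 (V : measurableType d1) (n : nat)
    (X : 'I_n -> Omega -> V) : Prop :=
  forall i j (B : set V), measurable B -> P (X i @^-1` B) = P (X j @^-1` B).

(* E X = 0 and E X X^T = I, entrywise. *)
Definition isotropic d (Omega : measurableType d) (R : realType)
    (P : probability Omega R) (p : nat) (X : Omega -> 'rV[R]_p) : Prop :=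
  (forall a, 'E_P[fun w => X w 0%R a] = 0)%E /\
  (forall a b, 'E_P[fun w => (X w 0 a * X w 0 b)%R] = ((a == b)%:R)%:E)%E.

(* Both expectations are extended-valued, so the inequality also asserts that
   the fourth moments are finite whenever the second moments are. *)
Definition hypercontractive42 d (Omega : measurableType d) (R : realType)
    (P : probability Omega R) (p : nat) (X : Omega -> 'rV[R]_p) (s4 : R)
    : Prop :=
  forall v : 'rV[R]_p, l2norm v = 1 ->
    ('E_P[fun w => (`|dot v (X w)| ^+ 4)%R] `^ 4^-1 <=
     s4%:E * 'E_P[fun w => (dot v (X w) ^+ 2)%R] `^ 2^-1)%E.

(* A finite multiset of size n is an n.-tuple, and a sub-multiset of it is a
   set of positions. *)

Definition mset_cap_size (V : eqType) (s t : seq V) : nat :=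
  (\sum_(v <- undup s) minn (count_mem v s) (count_mem v t))%N.

Definition corrupted (R : realType) (V : eqType) (n : nat) (eps : R)
    (S T : n.-tuple V) : Prop :=
  (1 - eps) * n%:R <= (mset_cap_size S T)%:R.

Definition emp_mean (R : realType) (p N : nat) (t : N.-tuple 'rV[R]_p)
    (A : {set 'I_N}) : 'rV[R]_p :=
  #|A|%:R^-1 *: \sum_(i in A) tnth t i.

Definition emp_cov (R : realType) (p N : nat) (t : N.-tuple 'rV[R]_p)
    (A : {set 'I_N}) (mu : 'rV[R]_p) : 'M[R]_p :=
  #|A|%:R^-1 *: \sum_(i in A) (tnth t i - mu)^T *m (tnth t i - mu).

(* The sub-multiset of t at the positions in A is (eps, delta)-stable with
   respect to mu and sigma ^+ 2; the notion includes its standing conditions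
   0 < eps < 1/2 and delta >= eps. *)
Definition stable (R : realType) (p N : nat) (t : N.-tuple 'rV[R]_p)
    (A : {set 'I_N}) (eps delta : R) (mu : 'rV[R]_p) (sigma : R) : Prop :=
  [/\ 0 < eps, eps < 2^-1, eps <= delta &
    forall B : {set 'I_N}, B \subset A ->
      (1 - eps) * #|A|%:R <= #|B|%:R ->
      l2norm (emp_mean t B - mu) <= sigma * delta /\
      opnorm (emp_cov t B mu - (sigma ^+ 2)%:M) <= sigma ^+ 2 * delta ^+ 2 / eps].

(* A randomized algorithm is a function of its input and of a random seed in
   Theta; the output is the set of positions of the points that are kept. *)
Definition rfilter (R : realType) (Theta : Type) :=
  forall p N : nat, N.-tuple 'rV[R]_p -> R -> Theta -> {set 'I_N}.

Definition rfilter_measurable (R : realType) d (Theta : measurableType d)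
    (filter : rfilter R Theta) : Prop :=
  forall (p N : nat) (eps0 : R) (A : {set 'I_N}),
    measurable [set u : N.-tuple 'rV[R]_p * Theta |
                 filter p N u.1 eps0 u.2 = A].

(* a and b are the implied constants of the success probability
   1 - O(exp(- Omega(N eps0))); Cmin is the threshold above which C0 counts as
   large enough. *)
Definition rfilter_guarantee (R : realType) d (Theta : measurableType d)
    (Q : probability Theta R) (filter : rfilter R Theta)
    (c1 c2 c3 a b Cmin : R) : Prop :=
  forall (p N : nat) (S T : N.-tuple 'rV[R]_p) (S' : {set 'I_N})
    (eps0 C0 delta : R) (mu : 'rV[R]_p) (sigma : R),
    0 < eps0 < 2^-1 -> Cmin <= C0 -> 0 <= sigma ->
    corrupted eps0 S T ->
    (1 - eps0) * N%:R <= #|S'|%:R ->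
    stable S S' (C0 * eps0) delta mu sigma ->
    ((1 - a * expR (- (b * (N%:R * eps0))))%:E <=
     Q [set theta |
         ((1 - c1 * eps0) * N%:R <= #|filter p N T eps0 theta|%:R)%R /\
         stable T (filter p N T eps0 theta) (c2 * C0 * eps0)%R (c3 * delta)%R
           mu sigma])%E.

(* With kappa the hidden constant of Theta(eps + log(1/tau)/n). For
   tau > 1/2 the failure probability is taken to be 1/2: otherwise the number
   of buckets could stay bounded as tau -> 1, where the guarantee of the
   filter is void. *)
Definition eps_prime (R : realType) (kappa eps tau : R) (n : nat) : R :=
  kappa * (eps + ln (Num.min tau 2^-1)^-1 / n%:R).

(* The buckets are the first k consecutive blocks of n %/ k positions after
   the permutation s; for a uniform s they form a uniformly random family of
   k disjoint buckets of equal size. *)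
Definition bucket_means (R : realType) (p n k : nat) (s : 'S_n)
    (t : n.-tuple 'rV[R]_p) : k.-tuple 'rV[R]_p :=
  [tuple (n %/ k)%:R^-1 *:
           \sum_(i < n | (i %/ (n %/ k) == j)%N) tnth t (s i) | j < k].

Definition filtered_mom (R : realType) (Theta : Type)
    (filter : rfilter R Theta) (eps0 eps' : R) (p n : nat)
    (t : n.-tuple 'rV[R]_p) (s : 'S_n) (theta : Theta) : 'rV[R]_p :=
  let k := `|Num.ceil (eps' * n%:R)|%N in
  let w := bucket_means k s t in
  emp_mean w (filter p k w eps0 theta).

Definition linear_sample (R : realType) (p n : nat) (beta : 'rV[R]_p)
    (Omega : Type) (x : 'I_n -> Omega -> 'rV[R]_p) (z : 'I_n -> Omega -> R)
    (w : Omega) : n.-tuple ('rV[R]_p * R) :=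
  [tuple (x i w, dot (x i w) beta + z i w) | i < n].

Definition debias (R : realType) (p n : nat) (beta1 : 'rV[R]_p)
    (T : n.-tuple ('rV[R]_p * R)) : n.-tuple 'rV[R]_p :=
  map_tuple (fun xy => beta1 + (xy.2 - dot xy.1 beta1) *: xy.1) T.

(* Main.v *)
(* Given betahat_1 = b, the points b + (y_i - x_i^T b) x_i of the clean sample
   are i.i.d. with mean beta* and covariance O(sigma^2) I, so a bucket mean
   deviates from beta* by a vector g_j of covariance at most nu^2 I with
   nu^2 = O(sigma^2 k / n). Everything rests on the claim that, outside an event
   of probability exp(-k/2), a small fraction of the g_j can be removed so that
   the remaining ones satisfy sum_j (v^T g_j)^2 = O(k nu^2 (1 + p/k)) |v|^2 for
   all v: then the remaining bucket means are stable with delta = 1 and squared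
   scale O(nu^2 (1 + p/k)) = O(sigma^2 (p + k) / n), and the guarantee of the
   filter yields the error bound.

   Write Q^2 for a large multiple of nu^2 (1 + p/k). A PAC-Bayes argument bounds
   the number of j with |v^T g_j| > Q simultaneously for all v in a ball. Its
   prior is the law of k^-1 times a p x k array of random signs, summed over
   columns; tilting the signs moves the mean to v at the cost k |v|^2 in
   relative entropy, while the noise along g_j has variance at most |g_j|^2 / k.
   Independence enters only through the product rule for events, after expanding
   the exponential moment over sets of buckets. Random signs then extend the
   count from directions v to quadratic forms B B^T, and a minimax argument turns
   removal sets depending on B into a single one.

   A uniform permutation of T is a uniform permutation of S up to the positions
   where T differs from a fixed rearrangement of S, and these positions spoil at
   most eps n <= eps0 k buckets. *)
Require Import Defs.
From HB Require Import structures.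
From mathcomp Require Import all_boot all_order all_algebra all_fingroup.
From mathcomp Require Import all_classical all_reals all_analysis.
From mathcomp Require Import measurable_realfun ring lra.

Set Implicit Arguments.
Unset Strict Implicit.
Unset Printing Implicit Defensive.
Import Order.TTheory GRing.Theory Num.Theory.
Import numFieldNormedType.Exports.
Local Open Scope classical_set_scope.
Local Open Scope ring_scope.

(** * Quadratic forms *)

(** A bucket mean has only a second moment to rely on, so neither its norm nor the empirical
    covariance of the buckets need concentrate. The number of buckets with a large component does,
    which is why the argument counts and removes. The scale in the filter's guarantee is a free
    parameter, so stability with delta = 1 asks for no more than a second moment bound on the kept
    buckets.

    Signs replace a Gaussian prior because their expectations are finite sums and the tilted density
    is a product of factors 1 + m_i e_i, whose entropy is bounded by hand; the price is that the
    means must stay in [-1, 1], hence a small ball of directions.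

    The constants are fixed in this order. eps0 = 1/(4 Cmin) makes C0 eps0 = 1/4 at C0 = Cmin; lam =
    80/eps0 makes the removed fraction at most eps0; c = 4 e^lam makes a bucket heavy with
    probability at most 2/c, so that the exponential moment at lam stays below e^(k/2); finally
    kappa makes k so large that the corrupted buckets are few and that the bad samples and the
    filter each fail with probability at most tau/2. *)

Lemma dotE (R : realType) p (u v : 'rV[R]_p) : dot u v = (u *m v^T) 0 0.
Proof. by rewrite mxE; apply: eq_bigr => a _; rewrite mxE. Qed.

Lemma dotC (R : realType) p (u v : 'rV[R]_p) : dot u v = dot v u.
Proof. by apply: eq_bigr => a _; rewrite mulrC. Qed.

Lemma dotDl (R : realType) p (u v w : 'rV[R]_p) :
  dot (u + v) w = dot u w + dot v w.
Proof. by rewrite !dotE mulmxDl mxE. Qed.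

Lemma dotDr (R : realType) p (u v w : 'rV[R]_p) :
  dot w (u + v) = dot w u + dot w v.
Proof. by rewrite dotC dotDl !(dotC w). Qed.

Lemma dotZl (R : realType) p (c : R) (u v : 'rV[R]_p) :
  dot (c *: u) v = c * dot u v.
Proof. by rewrite !dotE -scalemxAl mxE. Qed.

Lemma dotZr (R : realType) p (c : R) (u v : 'rV[R]_p) :
  dot u (c *: v) = c * dot u v.
Proof. by rewrite dotC dotZl dotC. Qed.

Lemma dotNr (R : realType) p (u v : 'rV[R]_p) : dot u (- v) = - dot u v.
Proof. by rewrite -scaleN1r dotZr mulN1r. Qed.

Lemma dotNl (R : realType) p (u v : 'rV[R]_p) : dot (- u) v = - dot u v.
Proof. by rewrite dotC dotNr dotC. Qed.

Lemma dot0l (R : realType) p (v : 'rV[R]_p) : dot 0 v = 0.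
Proof. by rewrite dotE mul0mx mxE. Qed.

Lemma dot_sumr (R : realType) p I (r : seq I) (P : pred I)
    (F : I -> 'rV[R]_p) u :
  dot u (\sum_(i <- r | P i) F i) = \sum_(i <- r | P i) dot u (F i).
Proof.
by elim/big_rec2: _ => [|i y x _ <-]; rewrite ?dotDr // dotC dot0l.
Qed.

Lemma dot_ge0 (R : realType) p (u : 'rV[R]_p) : 0 <= dot u u.
Proof. by apply: sumr_ge0 => a _; rewrite -expr2 sqr_ge0. Qed.

Lemma l2normE (R : realType) p (v : 'rV[R]_p) : l2norm v = Num.sqrt (dot v v).
Proof. by congr (Num.sqrt _); apply: eq_bigr => a _; rewrite expr2. Qed.

Lemma dot_mulmx (R : realType) p (u v : 'rV[R]_p) (M : 'M[R]_p) :
  dot (u *m M) v = dot u (v *m M^T).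
Proof. by rewrite !dotE trmx_mul trmxK mulmxA. Qed.

(** The leading coefficient may vanish; then [b] vanishes as well, since otherwise some [x] would
    give the value -1. Covering this case here spares the later uses a case distinction. *)
Lemma ge0_discr (R : realType) (a b c : R) :
  (forall x, 0 <= a - 2 * x * b + x ^+ 2 * c) -> 0 <= c -> b ^+ 2 <= c * a.
Proof.
move=> h; rewrite le_eqVlt => /predU1P[c0|c0].
  have b0 : b = 0.
    apply/eqP; apply: contraT => b0.
    have := h ((a + 1) / (2 * b)); rewrite -c0 mulr0 addr0.
    suff -> : a - 2 * ((a + 1) / (2 * b)) * b = -1 by rewrite ler0N1.
    by field.
  by rewrite -c0 b0 expr0n /= mul0r.
have := h (b / c).
have -> : a - 2 * (b / c) * b + (b / c) ^+ 2 * c = (c * a - b ^+ 2) / c.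
  by field; rewrite gt_eqF.
by rewrite pmulr_lge0 ?invr_gt0 // subr_ge0.
Qed.

Lemma dot_CS (R : realType) p (u v : 'rV[R]_p) :
  dot u v ^+ 2 <= dot u u * dot v v.
Proof.
rewrite mulrC; rewrite [leRHS]mulrC; apply: ge0_discr (dot_ge0 u) => x.
have := dot_ge0 (v + (- x) *: u).
by rewrite !(dotDl, dotDr, dotZl, dotZr) (dotC v u); lra.
Qed.

Section logconvex.
Context (R : realType) (m : nat -> R).
Hypothesis m_ge0 : forall i, 0 <= m i.
Hypothesis m_lc : forall i, m i.+1 ^+ 2 <= m i * m i.+2.

(** Ratios of consecutive terms increase; the cross-multiplied form makes sense when terms
    vanish. *)
Lemma logconvex_ratio i : m 1%N * m i <= m 0%N * m i.+1.
Proof.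
elim: i => [|i ih]; first by rewrite mulrC.
have [h|h] := eqVneq (m i.+1) 0.
  by rewrite h mulr0 mulr_ge0.
rewrite -(ler_pM2r (_ : 0 < m i.+1)); last by rewrite lt_def h m_ge0.
apply: (@le_trans _ _ (m 1%N * (m i * m i.+2))).
  by rewrite -mulrA -expr2 ler_wpM2l.
by rewrite mulrA [leRHS]mulrAC ler_wpM2r.
Qed.

(** Jensen's inequality for moments: the product of the first i + 1 ratios is at least the
    corresponding power of the first ratio. *)
Lemma logconvex_pow i : m 1%N ^+ i.+1 <= m i.+1 * m 0%N ^+ i.
Proof.
elim: i => [|i ih]; first by rewrite expr0 mulr1.
rewrite exprS; apply: (le_trans (ler_wpM2l (m_ge0 _) ih)).
by rewrite mulrA exprS mulrA ler_wpM2r ?exprn_ge0 // (mulrC (m _.+2)) logconvex_ratio.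
Qed.

(** Ratios increase, so a bound on the last one bounds them all, and their product telescopes. *)
Lemma logconvex_geom (C : R) q : 0 <= C -> m q.+1 <= C * m q ->
  m q.+1 <= C ^+ q.+1 * m 0%N.
Proof.
move=> C0; elim: q => [|q ih] h; first by rewrite expr1.
have hq : m q.+1 <= C * m q.
  have [->|h0] := eqVneq (m q.+1) 0; first by rewrite mulr_ge0.
  rewrite -(ler_pM2r (_ : 0 < m q.+1)); last by rewrite lt_def h0 m_ge0.
  apply: (le_trans (m_lc q)).
  by rewrite -mulrA mulrCA ler_wpM2l.
by rewrite (le_trans h)// exprS -mulrA ler_wpM2l// ih.
Qed.

End logconvex.

Lemma mxexpS (R : realType) p (A : 'M[R]_p) n : A ^+ n.+1 = A *m A ^+ n.
Proof. exact: exprS. Qed.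

Lemma mxexpSr (R : realType) p (A : 'M[R]_p) n : A ^+ n.+1 = A ^+ n *m A.
Proof. exact: exprSr. Qed.

Lemma mxexpD (R : realType) p (A : 'M[R]_p) m n :
  A ^+ (m + n) = A ^+ m *m A ^+ n.
Proof. exact: exprD. Qed.

(** The weights are the relaxed indicator of a set of kept indices, hence no normalisation: the
    matrix is affine in [w]. *)
Definition wcov (R : realType) p k (g : 'I_k -> 'rV[R]_p) (w : 'rV[R]_k) :
  'M[R]_p := \sum_j w 0 j *: ((g j)^T *m g j).

Lemma wcovT (R : realType) p k (g : 'I_k -> 'rV[R]_p) w :
  (wcov g w)^T = wcov g w.
Proof.
rewrite /wcov linear_sum /=; apply: eq_bigr => j _.
by rewrite linearZ /= trmx_mul trmxK.
Qed.

Lemma trmx_exp (R : realType) p (A : 'M[R]_p) n : A^T = A ->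
  (A ^+ n)^T = A ^+ n.
Proof.
move=> hA; elim: n => [|n ih]; first by rewrite !expr0 trmx1.
by rewrite {1}mxexpS trmx_mul ih hA -mxexpSr.
Qed.

Lemma dot_wcov (R : realType) p k (g : 'I_k -> 'rV[R]_p) w u v :
  dot (u *m wcov g w) v = \sum_j w 0 j * (dot u (g j) * dot v (g j)).
Proof.
rewrite /wcov mulmx_sumr dotC dot_sumr; apply: eq_bigr => j _.
rewrite -scalemxAr dotZr mulmxA; congr (_ * _).
rewrite (_ : u *m (g j)^T = (dot u (g j))%:M).
  by rewrite mul_scalar_mx dotZr.
by apply/rowP => a; rewrite !mxE !ord1 eqxx mulr1n; apply: eq_bigr => b _; rewrite mxE.
Qed.

Lemma mxtrace_dot (R : realType) p (A : 'M[R]_p) :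
  \tr A = \sum_a dot (delta_mx 0 a *m A) (delta_mx 0 a).
Proof.
apply: eq_bigr => a _; rewrite -rowE /dot (bigD1 a) //= big1 => [|b hb].
  by rewrite addr0 !mxE !eqxx mulr1.
by rewrite !mxE eqxx (negbTE hb) mulr0.
Qed.

Lemma tr_mul_wcov (R : realType) p k (g : 'I_k -> 'rV[R]_p) w (B : 'M[R]_p) :
  \tr (B *m wcov g w) = \sum_j w 0 j * dot (g j *m B) (g j).
Proof.
rewrite /wcov mulmx_sumr [LHS]raddf_sum /=; apply: eq_bigr => j _.
rewrite -scalemxAr mxtraceZ; congr (_ * _).
rewrite mulmxA -mxtrace_mulC mulmxA dotE.
by rewrite /mxtrace big_ord1.
Qed.

Section psd_power.
Context (R : realType) (p : nat) (A : 'M[R]_p).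
Hypothesis A_sym : A^T = A.
Hypothesis A_psd : forall u, 0 <= dot (u *m A) u.

(** Moving half of the exponent to each argument leaves the identity or [A] in the middle, according
    to parity. *)
Lemma psd_exp n u : 0 <= dot (u *m A ^+ n) u.
Proof.
have hs : n = (odd n + n./2 + n./2)%N by rewrite -addnA addnn odd_double_half.
have hT := trmx_exp n./2 A_sym.
rewrite hs mxexpD mulmxA dot_mulmx hT; case: (odd n); last exact: dot_ge0.
by rewrite add1n mxexpSr mulmxA; exact: A_psd.
Qed.

(** The form of A^n at u A - x u. It is kept linear in the three forms so that it can be summed over
    a basis, which yields log-convexity of the traces as well as of a single direction. *)
Lemma psd_exp_discr n u x :
  0 <= dot (u *m A ^+ n.+2) u - 2 * x * dot (u *m A ^+ n.+1) u
       + x ^+ 2 * dot (u *m A ^+ n) u.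
Proof.
have := psd_exp n (u *m A + (- x) *: u).
rewrite mulmxDl -scalemxAl !(dotDl, dotDr, dotZl, dotZr) -!mulmxA.
have e1 : A *m A ^+ n = A ^+ n.+1 by rewrite mxexpS.
have e2 u' : dot u' (u *m A) = dot (u' *m A) u by rewrite dot_mulmx A_sym.
rewrite !e1 !e2 -!mulmxA.
have -> : A ^+ n.+1 *m A = A ^+ n.+2 by rewrite -mxexpSr.
have -> : A ^+ n *m A = A ^+ n.+1 by rewrite -mxexpSr.
by move=> h; rewrite (le_trans h)// le_eqVlt; apply/orP; left; apply/eqP; ring.
Qed.

Lemma psd_exp_logconvex u n :
  dot (u *m A ^+ n.+1) u ^+ 2 <= dot (u *m A ^+ n) u * dot (u *m A ^+ n.+2) u.
Proof. by apply: ge0_discr (psd_exp n u) => x; exact: psd_exp_discr. Qed.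

Lemma tr_psd_exp n : 0 <= \tr (A ^+ n).
Proof. by rewrite mxtrace_dot sumr_ge0 // => a _; exact: psd_exp. Qed.

Lemma tr_psd_exp_logconvex n :
  \tr (A ^+ n.+1) ^+ 2 <= \tr (A ^+ n) * \tr (A ^+ n.+2).
Proof.
apply: ge0_discr (tr_psd_exp n) => x.
rewrite !mxtrace_dot !mulr_sumr -sumrB -big_split /=.
by apply: sumr_ge0 => a _; exact: psd_exp_discr.
Qed.

End psd_power.

Lemma wcov_psd (R : realType) p k (g : 'I_k -> 'rV[R]_p) (w : 'rV[R]_k) :
  (forall j, 0 <= w 0 j) -> forall u, 0 <= dot (u *m wcov g w) u.
Proof.
move=> w0 u; rewrite dot_wcov; apply: sumr_ge0 => j _.
by rewrite mulr_ge0 // -expr2 sqr_ge0.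
Qed.

(* If tr(A^(q+1)) <= L tr(A^q) then tr(A^(q+1)) <= L^(q+1) p, and p <= 2^(q+1)
   turns the Schatten norm into a spectral bound. *)
Lemma wcov_schatten (R : realType) p k (g : 'I_k -> 'rV[R]_p) (w : 'rV[R]_k) (L : R) n :
  (forall j, 0 <= w 0 j) -> 0 <= L -> (p <= n)%N ->
  \tr (wcov g w ^+ n.*2.+1) <= L * \tr (wcov g w ^+ n.*2) ->
  forall v, dot (v *m wcov g w) v <= 2 * L * dot v v.
Proof.
move=> w0 L0 pn htr v; set A := wcov g w in htr *.
have As : A^T = A := wcovT g w.
have Ap : forall u, 0 <= dot (u *m A) u := wcov_psd g w0.
have h1 : \tr (A ^+ n.*2.+1) <= L ^+ n.*2.+1 * p%:R.
  rewrite -(mxtrace1 R p) -[1%:M](expr0 A).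
  by apply: (logconvex_geom (m := fun i => \tr (A ^+ i)));
    [exact: tr_psd_exp | exact: tr_psd_exp_logconvex | |].
(* With A^(2n+1) = A^n A A^n and A expanded as the sum of the w_j g_j^T g_j, the trace dominates
   every direction by Cauchy-Schwarz term by term. *)
have h2 : dot (v *m A ^+ n.*2.+1) v <= dot v v * \tr (A ^+ n.*2.+1).
  have hT := trmx_exp n As.
  have eq : A ^+ n.*2.+1 = A ^+ n *m A *m A ^+ n.
    by rewrite -addnn -addSn mxexpD mxexpSr.
  rewrite eq mulmxA dot_mulmx hT mulmxA dot_wcov.
  rewrite -mxtrace_mulC mulmxA tr_mul_wcov mulr_sumr ler_sum // => j _.
  rewrite [leRHS]mulrCA ler_wpM2l // mulmxA (dot_mulmx (g j *m _)) hT.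
  by rewrite -expr2 dot_mulmx hT dot_CS.
have h3 : dot (v *m A) v ^+ n.*2.+1 <=
    dot (v *m A ^+ n.*2.+1) v * dot v v ^+ n.*2.
  have := @logconvex_pow R (fun i => dot (v *m A ^+ i) v)
    (fun i => psd_exp As Ap i v) (psd_exp_logconvex As Ap v) n.*2.
  by rewrite /= expr1 expr0 mulmx1.
have h4 : dot (v *m A) v ^+ n.*2.+1 <= (2 * L * dot v v) ^+ n.*2.+1.
  apply: (le_trans h3); apply: (le_trans (ler_wpM2r _ h2)).
    by rewrite exprn_ge0 // dot_ge0.
  rewrite mulrAC -exprS !exprMn [leRHS]mulrC ler_wpM2l ?exprn_ge0 ?dot_ge0 //.
  rewrite (le_trans h1) // mulrC ler_wpM2r ?exprn_ge0 // -natrX ler_nat.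
  rewrite (leq_trans pn) // (leq_trans (ltnW (ltn_expl n (ltnSn 1)))) //.
  by rewrite leq_exp2l // -addnn -addnS leq_addr.
move: h4; rewrite ler_pXn2r // nnegrE ?Ap //.
by rewrite !mulr_ge0 ?dot_ge0.
Qed.

(** * A removal set common to all directions *)

Definition entry_continuous (T : topologicalType) (R : realType) m n
    (F : T -> 'M[R]_(m, n)) : Prop :=
  forall a b, continuous (fun t => F t a b).

Lemma continuous_sum (T : topologicalType) (R : realType) I (r : seq I)
    (P : pred I) (F : I -> T -> R) :
  (forall i, P i -> continuous (F i)) ->
  continuous (fun t => \sum_(i <- r | P i) F i t).
Proof.
move=> hF; elim: r => [|i r ih].
  rewrite (_ : (fun t => _) = cst 0); last by apply/funext => t; rewrite big_nil.
  by move=> t; exact: cvg_cst.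
rewrite (_ : (fun t => _) = fun t => (if P i then F i t else 0)
    + \sum_(j <- r | P j) F j t); last first.
  by apply/funext => t; rewrite big_cons; case: (P i); rewrite ?add0r.
move=> t; apply: cvgD; last exact: ih.
by case: (boolP (P i)) => [/hF|_]; [exact | exact: cvg_cst].
Qed.

Lemma entry_continuous_mulmx (T : topologicalType) (R : realType) m n q
    (F : T -> 'M[R]_(m, n)) (G : T -> 'M[R]_(n, q)) :
  entry_continuous F -> entry_continuous G ->
  entry_continuous (fun t => F t *m G t).
Proof.
move=> hF hG a b.
rewrite (_ : (fun t => _) = fun t => \sum_c F t a c * G t c b); last first.
  by apply/funext => t; rewrite mxE.
by apply: continuous_sum => c _ t; apply: cvgM; [exact: hF | exact: hG].
Qed.

Lemma entry_continuous_exp (T : topologicalType) (R : realType) p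
    (F : T -> 'M[R]_p) n :
  entry_continuous F -> entry_continuous (fun t => F t ^+ n).
Proof.
move=> hF; elim: n => [|n ih] a b.
  rewrite (_ : (fun t => _) = cst ((1 : 'M[R]_p) a b)); last by apply/funext.
  by move=> t; exact: cvg_cst.
rewrite (_ : (fun t => _) = fun t => (F t *m F t ^+ n) a b).
  exact: (entry_continuous_mulmx hF ih).
by apply/funext => t; rewrite mxexpS.
Qed.

Lemma entry_continuous_trace (T : topologicalType) (R : realType) p
    (F : T -> 'M[R]_p) :
  entry_continuous F -> continuous (fun t => \tr (F t)).
Proof. by move=> hF; apply: continuous_sum => a _; exact: hF. Qed.

(** The telescoping sum of B^i H A^(n-1-i) over i < n; for B = A + t H it is the difference quotient
    of the n-th power, valid without commutativity. *)
Fixpoint diffquo (R : realType) p (B H A : 'M[R]_p) n : 'M[R]_p :=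
  if n is n'.+1 then B *m diffquo B H A n' + H *m A ^+ n' else 0.

Lemma diffquoE (R : realType) p (A H : 'M[R]_p) t n :
  (A + t *: H) ^+ n = A ^+ n + t *: diffquo (A + t *: H) H A n.
Proof.
elim: n => [|n ih]; first by rewrite /= scaler0 addr0 !expr0.
rewrite /= mxexpS [in LHS]ih mulmxDr [LHS]addrC.
rewrite [X in _ + X]mulmxDl -mxexpS scalerDr -scalemxAl -!scalemxAr.
by rewrite addrCA addrA.
Qed.

(** At B = A, cyclicity of the trace makes all n + 1 terms equal. The prefix A^m absorbs the factor
    that the recursion puts on the left. *)
Lemma tr_diffquo_diag (R : realType) p (A H : 'M[R]_p) m n :
  \tr (A ^+ m *m diffquo A H A n.+1) = n.+1%:R * \tr (A ^+ (m + n) *m H).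
Proof.
elim: n m => [|n ih] m; rewrite [diffquo _ _ _ _]/= mulmxDr mxtraceD.
  by rewrite !mulmx0 mxtrace0 add0r addn0 mul1r expr0 mulmx1.
rewrite mulmxA -mxexpSr ih addSnnS -[in RHS]natr1 mulrDl mul1r; congr (_ + _).
by rewrite mulmxA mxtrace_mulC mulmxA -mxexpD addnC.
Qed.

Lemma diffquo_continuous (R : realType) p (A H : 'M[R]_p) n :
  entry_continuous (fun t : R => diffquo (A + t *: H) H A n).
Proof.
have hB : entry_continuous (fun t : R => A + t *: H).
  move=> a b; rewrite (_ : (fun t => _) = (fun t => A a b + t * H a b)).
    by move=> t; apply: cvgD; [exact: cvg_cst | apply: cvgM; [exact: cvg_id | exact: cvg_cst]].
  by apply/funext => t; rewrite !mxE.
elim: n => [|n ih] a b /=.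
  rewrite (_ : (fun t => _) = cst 0); last by apply/funext => t; rewrite mxE.
  by move=> t; exact: cvg_cst.
rewrite (_ : (fun t => _) = (fun t => ((A + t *: H) *m diffquo (A + t *: H) H A n) a b
   + (H *m A ^+ n) a b)); last by apply/funext => t; rewrite mxE.
move=> t; apply: cvgD; last exact: cvg_cst.
exact: (entry_continuous_mulmx hB ih).
Qed.

(** The difference quotient of the trace is nonnegative for 0 < t <= 1 and continuous in t, hence
    nonnegative at t = 0, where it is n + 1 times the trace in the conclusion. *)
Lemma tr_exp_first_order (R : realType) p (A H : 'M[R]_p) n :
  (forall t, 0 < t -> t <= 1 -> \tr (A ^+ n.+1) <= \tr ((A + t *: H) ^+ n.+1)) ->
  0 <= \tr (A ^+ n *m H).
Proof.
move=> hmin.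
pose phi (t : R) := \tr (diffquo (A + t *: H) H A n.+1).
have phi_cont : continuous phi.
  by apply: entry_continuous_trace; exact: diffquo_continuous.
have phi_ge0 t : 0 < t -> t <= 1 -> 0 <= phi t.
  move=> t0 t1; have := hmin t t0 t1.
  by rewrite diffquoE mxtraceD mxtraceZ lerDl pmulr_rge0.
have phi0 : phi 0 = n.+1%:R * \tr (A ^+ n *m H).
  rewrite /phi scale0r addr0 -(tr_diffquo_diag A H 0 n).
  by rewrite expr0 mul1mx.
suff : 0 <= phi 0 by rewrite phi0 pmulr_rge0 // ltr0n.
rewrite leNgt; apply/negP => phi_lt0.
have /nbhs_ballP[e /= e0 he] : \forall t \near (0 : R), phi t < 0.
  exact: (cvgr_lt (phi 0) (phi_cont 0) 0 phi_lt0).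
have t0 : 0 < Num.min (e / 2) 1 by rewrite lt_min divr_gt0 //= ltr01.
have t1 : Num.min (e / 2) 1 <= 1 by rewrite ge_min lexx orbT.
have := phi_ge0 _ t0 t1.
rewrite leNgt he // /ball /= sub0r normrN gtr0_norm //.
by rewrite gt_min ltr_pdivrMr // mulr_natr mulr2n ltrDl e0.
Qed.

Lemma wcov_line (R : realType) p k (g : 'I_k -> 'rV[R]_p) w w' t :
  wcov g (w + t *: (w' - w)) = wcov g w + t *: (wcov g w' - wcov g w).
Proof.
rewrite /wcov -sumrB scaler_sumr -big_split; apply: eq_bigr => j _ /=.
by rewrite !mxE scalerDl -scalerA scalerBl.
Qed.

(* Existence of one removal set that works for every direction follows from
   the existence of a removal set for each quadratic form B B^T: a minimiser
   of the Schatten norm tr(A(w)^(2p+1)) over the relaxed removal weights w is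
   compared with the removal set for its own gradient A(w)^(2p). *)
Lemma removal_minimax (R : realType) p k (g : 'I_k -> 'rV[R]_p) (Lam r : R) :
  0 <= Lam -> 0 <= r ->
  (forall B : 'M[R]_p,
    #|[set j | Lam * \tr (B *m B^T) < dot (g j *m B) (g j *m B)]%SET|%:R <= r) ->
  exists2 S : {set 'I_k}, k%:R - #|S|%:R <= 2 * r &
    forall v, \sum_(j in S) dot v (g j) ^+ 2 <= 4 * Lam * k%:R * dot v v.
Proof.
move=> Lam0 r0 hB.
(* Weights removing a total mass of at most r: compact, so a minimiser exists, and convex, so the
   segment to any competitor stays inside. *)
pose W := [set w : 'rV[R]_k | (forall j, 0 <= w 0 j <= 1) /\
            k%:R - r <= \sum_j w 0 j].
have W0 : W !=set0.
  exists (const_mx 1); split=> [j|] /=; first by rewrite mxE ler01 lexx.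
  under eq_bigr do rewrite mxE.
  by rewrite sumr_const card_ord gerBl.
have Wc : compact W.
  rewrite (_ : W = [set w : 'rV[R]_k | forall j, `[0, 1]%classic (w ord0 j)] `&`
     [set w : 'rV[R]_k | k%:R - r <= \sum_j w 0 j]); last first.
    by apply/seteqP; split=> w [h1 h2]; split=> // j; have := h1 j;
      rewrite /= in_itv.
  apply: compact_closedI.
    exact: (@rV_compact R k (fun=> `[0, 1]%classic) (fun=> @segment_compact R 0 1)).
  apply: (@preimage_closed _ _ (fun w : 'rV[R]_k => \sum_j w 0 j)
     [set x | k%:R - r <= x]); last exact: closed_ge.
  move=> w _; apply: continuous_sum => j _; exact: coord_continuous.
have wcov_cont : entry_continuous (wcov g).
  move=> a b; rewrite (_ : (fun w => _) =
     fun w : 'rV[R]_k => \sum_j w 0 j * ((g j)^T *m g j) a b).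
    apply: continuous_sum => j _ w.
    apply: (@cvgM R 'rV[R]_k (nbhs w) _ (fun w => w 0 j) (cst _)); last exact: cvg_cst.
    exact: coord_continuous.
  by apply/funext => w; rewrite /wcov summxE; apply: eq_bigr => j _; rewrite mxE.
have [w /set_mem [/= w01 wr] wmin] : exists2 w, w \in W &
    forall w', w' \in W -> \tr (wcov g w ^+ p.*2.+1) <= \tr (wcov g w' ^+ p.*2.+1).
  apply: EVT_min_rV => //; apply: continuous_subspaceT.
  by apply: entry_continuous_trace; exact: entry_continuous_exp.
have w_ge0 j : 0 <= w 0 j by have /andP[] := w01 j.
have w_le1 j : w 0 j <= 1 by have /andP[] := w01 j.
have k0 : 0 <= k%:R :> R by [].
have Wconv v t : W v -> 0 <= t -> t <= 1 -> W (w + t *: (v - w)).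
  move=> [v01 vr] t0 t1; split=> [j|] /=.
    have := v01 j; have := w01 j; rewrite !mxE => /andP[? ?] /andP[? ?].
    by apply/andP; split; nra.
  under eq_bigr do rewrite !mxE.
  rewrite big_split /= -mulr_sumr sumrB.
  by move: (\sum_j w 0 j) (\sum_j v 0 j) wr vr => x y; nra.
pose A := wcov g w.
have hAT := trmx_exp p (wcovT g w).
(* The gradient of tr A^(2p+1) is a multiple of A^(2p) = A^p (A^p)^T, so the hypothesis is used at B
   = A^p and its removal set becomes the competitor. *)
pose good := [set j | dot (g j *m A ^+ p) (g j *m A ^+ p)
                      <= Lam * \tr (A ^+ p *m (A ^+ p)^T)]%SET.
pose w' : 'rV[R]_k := \row_j (j \in good)%:R.
have w'W : W w'.
  split=> [j|] /=; first by rewrite mxE; case: (j \in good); rewrite /= ?ler01 ?lexx.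
  under eq_bigr do rewrite mxE.
  rewrite (eq_bigr (fun j => if j \in good then 1 else 0)) => [|j _]; last first.
    by case: (j \in good).
  rewrite -big_mkcond sumr_const.
  have := hB (A ^+ p).
  have -> : [set j | Lam * \tr (A ^+ p *m (A ^+ p)^T) <
      dot (g j *m A ^+ p) (g j *m A ^+ p)]%SET = ~: good.
    by apply/setP => j; rewrite !inE ltNge.
  have := cardsC good; rewrite card_ord => /(congr1 (fun n => n%:R : R)).
  by rewrite natrD; lra.
have grad : 0 <= \tr (A ^+ p.*2 *m (wcov g w' - A)).
  apply: tr_exp_first_order => t t0 t1; rewrite -wcov_line; apply: wmin.
  by apply/mem_set/Wconv => //; exact: ltW.
(* Optimality gives tr A^(2p+1) <= tr (A^(2p) A(w')), and each index kept by w' contributes at most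
   Lam tr A^(2p). *)
have htr : \tr (A ^+ p.*2.+1) <= Lam * k%:R * \tr (A ^+ p.*2).
  have := grad; rewrite mulmxBr raddfB /= subr_ge0 -mxexpSr => /le_trans; apply.
  rewrite tr_mul_wcov.
  have -> : Lam * k%:R * \tr (A ^+ p.*2) = \sum_(j < k) Lam * \tr (A ^+ p.*2).
    by rewrite sumr_const card_ord -[RHS]mulr_natr mulrAC.
  apply: ler_sum => j _; rewrite mxE.
  have hn : 0 <= \tr (A ^+ p.*2) by apply: tr_psd_exp; [exact: wcovT | exact: wcov_psd].
  case: (boolP (j \in good)); last by rewrite mul0r mulr_ge0.
  rewrite inE mul1r -addnn mxexpD hAT mulmxA => h.
  by rewrite dot_mulmx hAT.
have hspec := wcov_schatten w_ge0 (mulr_ge0 Lam0 k0) (leqnn p) htr.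
(* Rounding at 1/2 doubles the number of removed indices, by Markov's inequality for 1 - w, and
   doubles the quadratic form; the other factor 2 in the bound comes from [wcov_schatten]. *)
exists [set j | 2^-1 <= w 0 j]%SET.
  set S := [set j | _]%SET.
  have := cardsC S; rewrite card_ord => /(congr1 (fun n => n%:R : R)).
  rewrite natrD => hS.
  have h1 : #|~: S|%:R * 2^-1 <= \sum_(j in ~: S) (1 - w 0 j).
    rewrite mulr_natl -sumr_const; apply: ler_sum => j.
    by rewrite !inE -ltNge => hj; lra.
  have h2 : \sum_(j in ~: S) (1 - w 0 j) <= \sum_j (1 - w 0 j).
    rewrite [leRHS](bigID (mem (~: S))) /= ler_wpDr // sumr_ge0 // => j _.
    by rewrite subr_ge0.
  move: h2; rewrite [leRHS]sumrB sumr_const card_ord => h2.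
  by move: (\sum_j w 0 j) wr h2 => x wr h2; lra.
move=> v; rewrite -!mulrA.
have := hspec v; rewrite dot_wcov => h.
apply: (@le_trans _ _ (2 * \sum_j w 0 j * (dot v (g j) * dot v (g j)))); last by lra.
rewrite mulr_sumr [leRHS](bigID (mem [set j | 2^-1 <= w 0 j]%SET)) /=.
rewrite ler_wpDr //.
  by apply: sumr_ge0 => j _; rewrite mulr_ge0 // mulr_ge0 // -expr2 sqr_ge0.
apply: ler_sum => j; rewrite inE => hj.
have := sqr_ge0 (dot v (g j)); rewrite -expr2 mulrA => hs; nra.
Qed.

(** * Random signs *)

Definition sgb (R : realType) (b : bool) : R := if b then 1 else -1.

(** The product law under which the i-th sign has mean [m i]; its values are nonnegative when every
    [m i] lies in [-1, 1]. *)
Definition sign_law (R : realType) (I : finType) (m : I -> R)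
    (e : {ffun I -> bool}) : R := \prod_i ((1 + m i * sgb R (e i)) / 2).

Definition sign_mean (R : realType) (I : finType) (m : I -> R)
    (f : {ffun I -> bool} -> R) : R := \sum_e sign_law m e * f e.

Lemma sgb_sqr (R : realType) b : sgb R b ^+ 2 = 1.
Proof. by case: b; rewrite /sgb ?sqrrN expr1n. Qed.

Section sign_mean_theory.
Context (R : realType) (I : finType).
Implicit Types (m c : I -> R) (f : {ffun I -> bool} -> R).

Lemma sign_law_ge0 m e : (forall i, `|m i| <= 1) -> 0 <= sign_law m e.
Proof.
move=> h; apply: prodr_ge0 => i _; have := h i; rewrite ler_norml => /andP[? ?].
by rewrite divr_ge0 // /sgb; case: (e i); lra.
Qed.

Lemma sign_mean_prod m (h : I -> bool -> R) :
  sign_mean m (fun e => \prod_i h i (e i)) =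
  \prod_i ((1 + m i) / 2 * h i true + (1 - m i) / 2 * h i false).
Proof.
transitivity (\prod_i \sum_b ((1 + m i * sgb R b) / 2 * h i b)); last first.
  by apply: eq_bigr => i _; rewrite big_bool /= mulr1 mulrN1.
rewrite bigA_distr_bigA; apply: eq_bigr => e _.
by rewrite /sign_law -big_split.
Qed.

Lemma sign_meanD m f g :
  sign_mean m (fun e => f e + g e) = sign_mean m f + sign_mean m g.
Proof. by rewrite /sign_mean -big_split; apply: eq_bigr => e _; rewrite mulrDr. Qed.

Lemma sign_meanZ m a f : sign_mean m (fun e => a * f e) = a * sign_mean m f.
Proof. by rewrite /sign_mean mulr_sumr; apply: eq_bigr => e _; rewrite mulrCA. Qed.

Lemma sign_mean_sum m J (r : seq J) (P : pred J) (F : J -> {ffun I -> bool} -> R) :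
  sign_mean m (fun e => \sum_(j <- r | P j) F j e) =
  \sum_(j <- r | P j) sign_mean m (F j).
Proof.
by rewrite /sign_mean exchange_big; apply: eq_bigr => e _; rewrite mulr_sumr.
Qed.

Lemma sign_mean_cst m a : sign_mean m (fun=> a) = a.
Proof.
rewrite (_ : (fun=> a) = fun e : {ffun I -> bool} => a * \prod_(i : I) 1).
  rewrite sign_meanZ (sign_mean_prod m (fun _ _ => 1)) big1 ?mulr1 // => i _; lra.
by apply/funext => e; rewrite big1 ?mulr1.
Qed.

Lemma ler_sign_mean m f g : (forall i, `|m i| <= 1) ->
  (forall e, f e <= g e) -> sign_mean m f <= sign_mean m g.
Proof. by move=> hm h; apply: ler_sum => e _; rewrite ler_wpM2l // sign_law_ge0. Qed.

Lemma sign_mean_sgb m i : sign_mean m (fun e => sgb R (e i)) = m i.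
Proof.
rewrite (_ : (fun e => _) = fun e : {ffun I -> bool} =>
    \prod_j if j == i then sgb R (e j) else 1); last first.
  by apply/funext => e; rewrite -big_mkcond big_pred1_eq.
rewrite (sign_mean_prod m (fun j b => if j == i then sgb R b else 1)).
rewrite (bigD1 i) //= eqxx big1 => [|j /negbTE ->]; last by lra.
by rewrite /sgb; lra.
Qed.

Lemma sign_mean_sgb2 m i j :
  sign_mean m (fun e => sgb R (e i) * sgb R (e j)) =
  if i == j then 1 else m i * m j.
Proof.
have [<-|ij] := eqVneq i j.
  rewrite -[RHS](sign_mean_cst m); congr sign_mean; apply/funext => e.
  by rewrite -expr2 sgb_sqr.
rewrite (_ : (fun e => _) = fun e : {ffun I -> bool} =>
    \prod_l if (l == i) || (l == j) then sgb R (e l) else 1); last first.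
  apply/funext => e; rewrite (bigD1 i) //= eqxx (bigD1 j) 1?eq_sym //= eqxx orbT.
  by rewrite big1 ?mulr1 // => l /andP[/negbTE -> /negbTE ->].
rewrite (sign_mean_prod m (fun l b => if (l == i) || (l == j) then sgb R b else 1)).
rewrite (bigD1 i) //= eqxx (bigD1 j) 1?eq_sym //= eqxx orbT.
rewrite big1 => [|l /andP[/negbTE -> /negbTE ->]]; last by rewrite /=; lra.
by rewrite /sgb; lra.
Qed.

Lemma sign_mean_var m c : (forall i, `|m i| <= 1) ->
  sign_mean m (fun e => (\sum_i c i * (sgb R (e i) - m i)) ^+ 2) <= \sum_i c i ^+ 2.
Proof.
move=> hm; rewrite (_ : (fun e => _) = fun e : {ffun I -> bool} =>
  \sum_i \sum_j c i * c j * ((sgb R (e i) - m i) * (sgb R (e j) - m j))); last first.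
  apply/funext => e; rewrite expr2 mulr_suml; apply: eq_bigr => i _.
  by rewrite mulr_sumr; apply: eq_bigr => j _; rewrite mulrACA.
rewrite sign_mean_sum ler_sum // => i _; rewrite sign_mean_sum.
have cov j : sign_mean m (fun e => c i * c j *
   ((sgb R (e i) - m i) * (sgb R (e j) - m j))) =
   if j == i then c i ^+ 2 * (1 - m i ^+ 2) else 0.
  rewrite sign_meanZ (_ : (fun e => _) = fun e : {ffun I -> bool} =>
     (sgb R (e i) * sgb R (e j)) + ((- m j) * sgb R (e i) +
     ((- m i) * sgb R (e j) + m i * m j))); last by apply/funext => e; ring.
  rewrite !sign_meanD !sign_meanZ sign_mean_cst !sign_mean_sgb sign_mean_sgb2 eq_sym.
  by have [->|_] := eqVneq j i; ring.
rewrite (eq_bigr _ (fun j _ => cov j)) -big_mkcond big_pred1_eq.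
by rewrite -[leRHS]mulr1 ler_wpM2l ?sqr_ge0 // gerBl sqr_ge0.
Qed.

Definition flip (i : I) (e : {ffun I -> bool}) : {ffun I -> bool} :=
  [ffun j => (j == i) (+) e j].

Lemma flipK i : involutive (flip i).
Proof. by move=> e; apply/ffunP => j; rewrite !ffunE; case: (j == i); case: (e j). Qed.

Lemma sign_mean_odd i f : (forall e, f (flip i e) = f e) ->
  sign_mean (fun=> 0) (fun e => f e * sgb R (e i)) = 0.
Proof.
move=> hf; set s := sign_mean _ _.
suff : s = - s by lra.
rewrite {1}/s /sign_mean (reindex_inj (inv_inj (flipK i))) /s /sign_mean -sumrN.
apply: eq_bigr => e _; rewrite hf ffunE eqxx.
have -> : sgb R (true (+) e i) = - sgb R (e i) by rewrite /sgb; case: (e i); rewrite //= opprK.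
rewrite !mulrN; congr (- (_ * _)); apply: eq_bigr => j _.
by rewrite !mul0r.
Qed.

(** Khintchine's inequality for the fourth moment. In the induction the odd powers of the new sign
    average to zero, and c^4 + 6 c^2 A + 3 A^2 <= 3 (c^2 + A)^2. *)
Lemma sign_mean_moments c (r : seq I) : uniq r ->
  let X := fun e : {ffun I -> bool} => \sum_(i <- r) c i * sgb R (e i) in
  sign_mean (fun=> 0) (fun e => X e ^+ 2) = \sum_(i <- r) c i ^+ 2 /\
  sign_mean (fun=> 0) (fun e => X e ^+ 4) <= 3 * (\sum_(i <- r) c i ^+ 2) ^+ 2.
Proof.
elim: r => [_ /=|i r ih /= /andP[ir ur]].
  have h n : sign_mean (fun=> 0) (fun e : {ffun I -> bool} =>
      (\sum_(i <- [::]) c i * sgb R (e i)) ^+ n.+1) = 0.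
    rewrite -[RHS](sign_mean_cst (fun=> 0)); congr sign_mean.
    by apply/funext => e; rewrite big_nil expr0n.
  by rewrite !h big_nil expr0n mulr0.
have [] := ih ur; set A := \sum_(i <- r) c i ^+ 2.
pose Y (e : {ffun I -> bool}) := \sum_(i <- r) c i * sgb R (e i).
rewrite -/(Y _) => h2 h4.
have Yflip e : Y (flip i e) = Y e.
  apply: eq_big_seq => j jr; rewrite ffunE; case: eqVneq => // ji.
  by move: ir; rewrite -ji jr.
have Yodd (d : R) n : sign_mean (fun=> 0) (fun e => d * (Y e ^+ n * sgb R (e i))) = 0.
  by rewrite sign_meanZ sign_mean_odd ?mulr0 // => e; rewrite Yflip.
rewrite big_cons -/A; split.
  rewrite (_ : (fun e => _) = fun e => c i ^+ 2 +
     (2 * c i * (Y e ^+ 1 * sgb R (e i)) + Y e ^+ 2)).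
    by rewrite !sign_meanD sign_mean_cst Yodd h2 add0r.
  apply/funext => e; rewrite big_cons -/(Y e).
  have := sgb_sqr R (e i); move: (sgb R (e i)) (Y e) => s y hs.
  transitivity (c i ^+ 2 * s ^+ 2 + (2 * c i * (y ^+ 1 * s) + y ^+ 2)); first by ring.
  by rewrite hs mulr1.
rewrite (_ : (fun e => _) = fun e => c i ^+ 4 + (6 * c i ^+ 2 * Y e ^+ 2 + (Y e ^+ 4 +
     (4 * c i ^+ 3 * (Y e ^+ 1 * sgb R (e i)) + 4 * c i * (Y e ^+ 3 * sgb R (e i)))))).
  rewrite !sign_meanD sign_mean_cst !Yodd sign_meanZ h2.
  have := sqr_ge0 (c i ^+ 2); rewrite -exprM /=; nra.
apply/funext => e; rewrite big_cons -/(Y e).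
have := sgb_sqr R (e i); move: (sgb R (e i)) (Y e) => s y hs.
transitivity (c i ^+ 4 * (s ^+ 2) ^+ 2 + (6 * c i ^+ 2 * s ^+ 2 * y ^+ 2 + (y ^+ 4 +
     (4 * c i ^+ 3 * (y ^+ 1 * s * s ^+ 2) + 4 * c i * (y ^+ 3 * s))))); first by ring.
by rewrite hs !expr1n !mulr1.
Qed.

(* Donsker-Varadhan with the uniform law of signs as prior; the relative
   entropy of the law with means m is at most the sum of the m_i^2. *)
Lemma sign_mean_le_log_mgf m (N : {ffun I -> bool} -> R) (K : R) :
  (forall i, `|m i| <= 1) ->
  sign_mean (fun=> 0) (fun e => expR (N e)) <= expR K ->
  sign_mean m N <= K + \sum_i m i ^+ 2.
Proof.
move=> hm hN.
(* The tilted law has density prod (1 + m_i e_i) with respect to the uniform one, at most the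
   exponential of the subtracted linear term. *)
pose X e := N e - \sum_i m i * sgb R (e i).
pose M := sign_mean m X.
have EX : M = sign_mean m N - \sum_i m i ^+ 2.
  rewrite /M (_ : X = fun e => N e + (-1) * \sum_i m i * sgb R (e i)); last first.
    by apply/funext => e; rewrite mulN1r.
  rewrite sign_meanD sign_meanZ mulN1r sign_mean_sum; congr (_ - _).
  by apply: eq_bigr => i _; rewrite sign_meanZ sign_mean_sgb.
suff : M <= K by rewrite EX lerBlDr addrC.
rewrite -ler_expR (le_trans _ hN) //.
(* Jensen's inequality for the exponential, through its tangent at the mean [M]. *)
have -> : expR M = sign_mean m (fun e => expR M * (1 + (X e + - M))).
  rewrite sign_meanZ (sign_meanD m (fun=> 1)) (sign_meanD m X (fun=> - M)).
  by rewrite !sign_mean_cst -/M subrr addr0 mulr1.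
apply: (@le_trans _ _ (sign_mean m (fun e => expR (X e)))).
  apply: ler_sign_mean => // e.
  have -> : expR (X e) = expR M * expR (X e - M) by rewrite -expRD addrC subrK.
  by rewrite ler_wpM2l ?expR_ge0 // expR_ge1Dx.
apply: ler_sum => e _; rewrite /X expRD mulrCA mulrC ler_wpM2r ?expR_ge0 //.
rewrite expRN ler_pdivrMr ?expR_gt0 // expR_sum /sign_law -big_split /=.
apply: ler_prod => i _; apply/andP; split.
  have := hm i; rewrite ler_norml => /andP[? ?].
  by rewrite divr_ge0 // /sgb; case: (e i); lra.
by rewrite mul0r addr0 mulrAC ler_wpM2r // mul1r expR_ge1Dx.
Qed.

End sign_mean_theory.

(* A finite substitute for a Gaussian vector of covariance k^-1 I: the law of
   signs with constant means v_a on the a-th group translates it by v. *)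
Definition sign_vec (R : realType) p k (e : {ffun 'I_p * 'I_k -> bool}) :
  'rV[R]_p := \row_a (k%:R^-1 * \sum_l sgb R (e (a, l))).

Definition tilt (R : realType) p k (v : 'rV[R]_p) (al : 'I_p * 'I_k) : R :=
  v 0 al.1.

Lemma sum_pair (R : realType) p k (F : 'I_p -> 'I_k -> R) :
  \sum_al F al.1 al.2 = \sum_a \sum_l F a l.
Proof. by rewrite pair_bigA. Qed.

Lemma sign_vec_var (R : realType) p k (v g : 'rV[R]_p) : (0 < k)%N ->
  (forall a, `|v 0 a| <= 1) ->
  sign_mean (tilt v) (fun e : {ffun 'I_p * 'I_k -> bool} =>
     (dot (sign_vec R e) g - dot v g) ^+ 2) <= dot g g / k%:R.
Proof.
move=> k0 hv; have k0' : k%:R != 0 :> R by rewrite pnatr_eq0 -lt0n.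
rewrite (_ : (fun e => _) = fun e : {ffun 'I_p * 'I_k -> bool} =>
   (\sum_al (g 0 al.1 / k%:R) * (sgb R (e al) - tilt v al)) ^+ 2).
  apply: (le_trans (sign_mean_var _ _)) => [al|]; first exact: hv.
  rewrite (sum_pair (fun a (_ : 'I_k) => (g 0 a / k%:R) ^+ 2)) /dot mulr_suml.
  apply: ler_sum => a _; rewrite sumr_const card_ord -[leLHS]mulr_natr.
  by rewrite le_eqVlt; apply/orP; left; apply/eqP; field.
apply/funext => e; congr (_ ^+ 2).
rewrite (eq_bigr (fun al => g 0 al.1 / k%:R * (sgb R (e (al.1, al.2)) - v 0 al.1))).
  rewrite (sum_pair (fun a l => g 0 a / k%:R * (sgb R (e (a, l)) - v 0 a))).
  rewrite /dot -sumrB; apply: eq_bigr => a _.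
  rewrite -mulr_sumr sumrB sumr_const card_ord mxE -[v 0 a *+ _]mulr_natr.
  by field.
by case.
Qed.

(* The last disjunct accounts for the g_j that are too long for the noise of
   sign_vec along g_j, of variance at most |g_j|^2 / k, to be below Q2. *)
Definition heavy (R : realType) p k (g : 'I_k -> 'rV[R]_p) (Q2 : R)
    (e : {ffun 'I_p * 'I_k -> bool}) (j : 'I_k) : bool :=
  (Q2 / 4 < dot (sign_vec R e) (g j) ^+ 2) &&
    (dot (sign_vec R e) (sign_vec R e) <= 8 * (1 + p%:R / k%:R)) ||
  (k%:R * Q2 / 16 < dot (g j) (g j)).

Lemma dot_delta (R : realType) p (v : 'rV[R]_p) a :
  dot v (delta_mx 0 a) = v 0 a.
Proof.
rewrite /dot (bigD1 a) //= mxE !eqxx mulr1 big1 ?addr0 // => b /negbTE hb.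
by rewrite mxE eqxx hb mulr0.
Qed.

Lemma sqr_coord_le (R : realType) p (v : 'rV[R]_p) a : v 0 a ^+ 2 <= dot v v.
Proof.
by rewrite /dot (bigD1 a) //= -expr2 lerDl sumr_ge0 // => b _; rewrite -expr2 sqr_ge0.
Qed.

(** If g_j is not too long, the noise along g_j has variance at most Q2/16 and the squared norm of
    the random vector has mean at most a quarter of its cap. Chebyshev and Markov each lose
    probability 1/4. The threshold Q2/4 in [heavy] leaves room for noise of size half of |v^T
    g_j|. *)
Lemma heavy_mean (R : realType) p k (g : 'I_k -> 'rV[R]_p) (Q2 : R) v j :
  (0 < k)%N -> 0 <= Q2 -> dot v v <= 4^-1 -> Q2 < dot v (g j) ^+ 2 ->
  2^-1 <= sign_mean (tilt v)
    (fun e : {ffun 'I_p * 'I_k -> bool} => (heavy g Q2 e j)%:R).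
Proof.
move=> k0 Q0 hv hj.
have hva a : `|v 0 a| <= 1.
  by rewrite -ler_sqr ?nnegrE // expr1n real_normK ?num_real // (le_trans (sqr_coord_le v a)) //; lra.
have [hbig|hsmall] := boolP (k%:R * Q2 / 16 < dot (g j) (g j)).
  rewrite (_ : (fun e => _) = fun=> 1) ?sign_mean_cst; first by lra.
  by apply/funext => e; rewrite /heavy hbig orbT.
have kR : 0 < k%:R :> R by rewrite ltr0n.
move: hsmall; rewrite -leNgt => hsmall.
have Q20 : 0 < Q2.
  rewrite lt_def Q0 andbT; apply/eqP => Qz.
  have := dot_CS v (g j); have := dot_ge0 v; have := dot_ge0 (g j).
  move: hsmall hj; rewrite Qz; nra.
pose D : R := 8 * (1 + p%:R / k%:R).
have pk0 : 0 <= p%:R / k%:R :> R by rewrite divr_ge0 // ltW.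
have D0 : 0 < D by rewrite /D; lra.
have hvar := sign_vec_var (g j) k0 hva.
have hnorm : sign_mean (tilt v) (fun e : {ffun 'I_p * 'I_k -> bool} =>
    dot (sign_vec R e) (sign_vec R e)) <= 2 * (p%:R / k%:R) + 2^-1.
  apply: (@le_trans _ _ (\sum_a sign_mean (tilt v) (fun e : {ffun 'I_p * 'I_k -> bool} =>
      2 * (dot (sign_vec R e) (delta_mx 0 a) - dot v (delta_mx 0 a)) ^+ 2
      + 2 * v 0 a ^+ 2))).
    rewrite -sign_mean_sum; apply: ler_sign_mean => [al|e]; first exact: hva.
    apply: ler_sum => a _; rewrite !dot_delta -expr2.
    by have := sqr_ge0 (sign_vec R e 0 a - 2 * v 0 a); lra.
  under eq_bigr do rewrite sign_meanD sign_meanZ sign_mean_cst.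
  rewrite big_split /= -!mulr_sumr.
  have -> : \sum_i v 0 i ^+ 2 = dot v v by apply: eq_bigr => a _; rewrite expr2.
  have : \sum_(a < p) sign_mean (tilt v) (fun e : {ffun 'I_p * 'I_k -> bool} =>
      (dot (sign_vec R e) (delta_mx 0 a) - dot v (delta_mx 0 a)) ^+ 2)
      <= \sum_(a < p) k%:R^-1.
    apply: ler_sum => a _; apply: (le_trans (sign_vec_var _ k0 hva)).
    by rewrite dot_delta mxE !eqxx mul1r.
  by rewrite sumr_const card_ord -mulr_natl; lra.
(* A pointwise minorant of the indicator that merges both tail bounds; each subtracted term has mean
   at most 1/4. *)
apply: (@le_trans _ _ (sign_mean (tilt v) (fun e : {ffun 'I_p * 'I_k -> bool} =>
   1 + ((- (4 / Q2)) * (dot (sign_vec R e) (g j) - dot v (g j)) ^+ 2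
        + (- D^-1) * dot (sign_vec R e) (sign_vec R e))))).
  rewrite !sign_meanD !sign_meanZ sign_mean_cst.
  have h1 : 4 / Q2 * sign_mean (tilt v) (fun e : {ffun 'I_p * 'I_k -> bool} =>
     (dot (sign_vec R e) (g j) - dot v (g j)) ^+ 2) <= 4^-1.
    rewrite mulrAC ler_pdivrMr //.
    have : dot (g j) (g j) / k%:R <= Q2 / 16 by rewrite ler_pdivrMr //; lra.
    lra.
  have h2 : D^-1 * sign_mean (tilt v) (fun e : {ffun 'I_p * 'I_k -> bool} =>
     dot (sign_vec R e) (sign_vec R e)) <= 4^-1.
    rewrite mulrC ler_pdivrMr //; rewrite /D; lra.
  lra.
apply: ler_sign_mean => [al|e]; first exact: hva.
rewrite /heavy -/D; set x := dot (sign_vec R e) (g j); set t := dot _ (sign_vec R e).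
have t0 : 0 <= t by exact: dot_ge0.
have hx := sqr_ge0 (x - dot v (g j)).
have A1 : 0 <= 4 / Q2 * (x - dot v (g j)) ^+ 2 by rewrite mulr_ge0 // divr_ge0.
have A2 : 0 <= D^-1 * t by rewrite mulr_ge0 // invr_ge0 ltW.
case: (ltP (Q2 / 4)) => /= hx1; last first.
  have : 1 <= 4 / Q2 * (x - dot v (g j)) ^+ 2.
    rewrite mulrAC ler_pdivlMr // mul1r.
    by have := sqr_ge0 (2 * x - dot v (g j)/2); move: hj hx1; set y := dot v (g j); nra.
  case: (_ < _) => /=; lra.
case: (leP t D) => /= ht; first by lra.
have : 1 <= D^-1 * t by rewrite mulrC ler_pdivlMr // mul1r ltW.
case: (_ < _) => /=; lra.
Qed.

(** The entropy inequality for lam times the number of heavy indices gives lam |J| / 2 <= k + k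
    |v|^2 <= 5k/4, which is stronger than the rounded bound. *)
Lemma heavy_direction (R : realType) p k (g : 'I_k -> 'rV[R]_p) (Q2 lam : R) v :
  (0 < k)%N -> 0 <= Q2 -> 0 < lam -> dot v v <= 4^-1 ->
  sign_mean (fun=> 0) (fun e : {ffun 'I_p * 'I_k -> bool} =>
     expR (lam * \sum_j (heavy g Q2 e j)%:R)) <= expR k%:R ->
  #|[set j | Q2 < dot v (g j) ^+ 2]%SET|%:R <= 4 * k%:R / lam.
Proof.
move=> k0 Q0 lam0 hv hZ.
have hva al : `|@tilt R p k v al| <= 1.
  by rewrite -ler_sqr ?nnegrE // expr1n real_normK ?num_real // (le_trans (sqr_coord_le v _)) //; lra.
have := sign_mean_le_log_mgf hva hZ.
rewrite sign_meanZ sign_mean_sum (sum_pair (fun a _ => v 0 a ^+ 2)).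
have -> : \sum_a \sum_(l < k) v 0 a ^+ 2 = k%:R * dot v v.
  rewrite /dot mulr_sumr; apply: eq_bigr => a _.
  by rewrite sumr_const card_ord -[LHS]mulr_natl expr2.
move=> h; rewrite ler_pdivlMr //.
set J := [set j | _]%SET.
have hJ : #|J|%:R * 2^-1 <=
    \sum_j sign_mean (tilt v) (fun e : {ffun 'I_p * 'I_k -> bool} => (heavy g Q2 e j)%:R).
  rewrite mulr_natl -sumr_const [leRHS](bigID (mem J)) /= ler_wpDr //.
    apply: sumr_ge0 => j _; apply: sumr_ge0 => e _.
    by rewrite mulr_ge0 // sign_law_ge0.
  by apply: ler_sum => j; rewrite inE => hj; exact: heavy_mean.
have : k%:R * dot v v <= k%:R * 4^-1 by rewrite ler_wpM2l.
move: (\sum_j _) h hJ => s h hJ; have : lam * (#|J|%:R * 2^-1) <= lam * s by rewrite ler_pM2l.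
have : 0 < k%:R :> R by rewrite ltr0n.
lra.
Qed.

(** * From directions to quadratic forms *)

Lemma mxtrace_gram (R : realType) p (B : 'M[R]_p) :
  \tr (B *m B^T) = \sum_a \sum_b B a b ^+ 2.
Proof.
by apply: eq_bigr => a _; rewrite mxE; apply: eq_bigr => b _; rewrite mxE expr2.
Qed.

Lemma sign_mean_dot (R : realType) p (u : 'rV[R]_p) :
  let X := fun e : {ffun 'I_p -> bool} => dot (\row_b sgb R (e b)) u in
  sign_mean (fun=> 0) (fun e => X e ^+ 2) = dot u u /\
  sign_mean (fun=> 0) (fun e => X e ^+ 4) <= 3 * dot u u ^+ 2.
Proof.
have := @sign_mean_moments R 'I_p (fun b => u 0 b) _ (index_enum_uniq _).
have -> : (fun e : {ffun 'I_p -> bool} => dot (\row_b sgb R (e b)) u) =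
    (fun e => \sum_i u 0 i * sgb R (e i)).
  by apply/funext => e; apply: eq_bigr => b _; rewrite mxE mulrC.
by have -> : \sum_i u 0 i ^+ 2 = dot u u by apply: eq_bigr => b _; rewrite expr2.
Qed.

(* Random signs xi turn the quadratic form B B^T into the directions xi B^T,
   whose squared correlation with g has mean |g B|^2; a Paley-Zygmund argument,
   with the polynomial (x - 1/2)(21/2 - x)/25 <= 1_{x > 1/2}, loses a constant
   factor. *)
Lemma direction_to_form (R : realType) p k (g : 'I_k -> 'rV[R]_p) (Q2 r : R) :
  0 <= Q2 ->
  (forall v, dot v v <= 4^-1 -> #|[set j | Q2 < dot v (g j) ^+ 2]%SET|%:R <= r) ->
  forall B : 'M[R]_p,
    #|[set j | 800 * Q2 * \tr (B *m B^T) < dot (g j *m B) (g j *m B)]%SET|%:R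
    <= 10 * r.
Proof.
move=> Q0 hdir B; set J := [set j | _]%SET.
have r0 : 0 <= r by have := hdir 0; rewrite dot0l => /(_ _)/(le_trans _) -> //; rewrite invr_ge0.
pose tau := \tr (B *m B^T).
have tau0 : 0 <= tau.
  by rewrite /tau mxtrace_gram sumr_ge0 // => a _; rewrite sumr_ge0 // => b _; rewrite sqr_ge0.
have [tauz|taun0] := eqVneq tau 0.
  have B0 : B = 0.
    apply/matrixP => a b; rewrite mxE; apply/eqP; rewrite -sqrf_eq0.
    have h a' : 0 <= \sum_b B a' b ^+ 2 by rewrite sumr_ge0 // => b' _; rewrite sqr_ge0.
    move: tauz; rewrite /tau mxtrace_gram => /eqP.
    rewrite psumr_eq0 // => /allP/(_ a (mem_index_enum _)) /=.
    rewrite psumr_eq0 => [/allP/(_ b (mem_index_enum _)) //|b' _].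
    exact: sqr_ge0.
  rewrite (_ : J = finset.set0) ?cards0 ?mulr_ge0 //.
  by apply/setP => j; rewrite !inE -/tau tauz mulr0 B0 mulmx0 dot0l ltxx.
have {taun0} tau_gt0 : 0 < tau by rewrite lt_def taun0.
(* With this scale |V e|^2 has mean 1/400, and 800 = 2 * 400 makes m_j exceed 2 Q2 on J. Outside the
   ball of radius 1/2 the term 4 |V e|^2 exceeds 1, so subtracting it makes the bound trivial there,
   at an average cost of 1/100. *)
pose s2 := (400 * tau)^-1; pose s := Num.sqrt s2.
have s2_gt0 : 0 < s2 by rewrite invr_gt0; lra.
have ss : s ^+ 2 = s2 by rewrite sqr_sqrtr // ltW.
pose V (e : {ffun 'I_p -> bool}) := s *: ((\row_b sgb R (e b)) *m B^T).
have VE e u : dot (V e) u = s * dot (\row_b sgb R (e b)) (u *m B).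
  by rewrite /V dotZl dot_mulmx trmxK.
pose m j := s2 * dot (g j *m B) (g j *m B).
have hJ j : j \in J -> 2 * Q2 < m j.
  rewrite inE => h; rewrite /m /s2 [ltRHS]mulrC ltr_pdivlMr; last by lra.
  by move: h; rewrite -/tau; lra.
have mpos j : j \in J -> 0 < m j by move=> /hJ; lra.
pose f (x : R) := (x - 2^-1) * (21 / 2 - x) / 25.
have pointwise e : \sum_(j in J) (f (dot (V e) (g j) ^+ 2 / m j) - 4 * dot (V e) (V e)) <= r.
  have f_le1 x : f x <= 1.
    by rewrite /f ler_pdivrMr //; have := sqr_ge0 (x - 11/2); lra.
  have [h|h] := leP (dot (V e) (V e)) 4^-1; last first.
    by apply: le_trans r0; apply: sumr_le0 => j _; have := f_le1 (dot (V e) (g j) ^+ 2 / m j); lra.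
  apply: le_trans (hdir _ h).
  rewrite -sum1_card natr_sum [leRHS]big_mkcond [leLHS]big_mkcond /=.
  apply: ler_sum => j _; case: ifPn => [jJ|_]; last by case: ifP.
  rewrite inE; have hV := dot_ge0 (V e).
  case: ltP => [_|hQ]; first by have := f_le1 (dot (V e) (g j) ^+ 2 / m j); lra.
  have x0 : 0 <= dot (V e) (g j) ^+ 2 / m j by rewrite divr_ge0 ?sqr_ge0 // ltW // mpos.
  have x1 : dot (V e) (g j) ^+ 2 / m j <= 2^-1.
    by rewrite ler_pdivrMr ?mpos //; have := hJ j jJ; lra.
  move: (dot (V e) (g j) ^+ 2 / m j) x0 x1 => x x0 x1.
  have : f x <= 0 by rewrite /f; nra.
  by lra.
(* The normalised square has mean 1 and second moment at most 3, so [f] has mean at least (11 - 3 -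
   21/4)/25 = 11/100. *)
have Emean j : j \in J -> 11 / 100 <=
   sign_mean (fun=> 0) (fun e => f (dot (V e) (g j) ^+ 2 / m j)).
  move=> jJ; have mj := mpos j jJ.
  have [h2 h4] := sign_mean_dot (g j *m B).
  rewrite (_ : (fun e => _) = fun e : {ffun 'I_p -> bool} => (11 / 25 * (s2 / m j)) *
       dot (\row_b sgb R (e b)) (g j *m B) ^+ 2 +
     ((- (s2 / m j) ^+ 2 / 25) * dot (\row_b sgb R (e b)) (g j *m B) ^+ 4
      + (- (21 / 100)))); last first.
    apply/funext => e; rewrite VE exprMn ss /f.
    by field; rewrite gt_eqF.
  rewrite !sign_meanD !sign_meanZ sign_mean_cst h2.
  have e1 : s2 / m j * dot (g j *m B) (g j *m B) = 1.
    by rewrite mulrAC mulfV // gt_eqF.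
  have h5 : (s2 / m j) ^+ 2 * sign_mean (fun=> 0) (fun e : {ffun 'I_p -> bool} =>
     dot (\row_b sgb R (e b)) (g j *m B) ^+ 4) <= 3.
    apply: (le_trans (ler_wpM2l (sqr_ge0 _) h4)).
    by rewrite mulrCA -exprMn e1 expr1n mulr1.
  lra.
have Enorm : sign_mean (fun=> 0) (fun e => dot (V e) (V e)) = 400^-1.
  rewrite (_ : (fun e => _) = fun e : {ffun 'I_p -> bool} => s2 * \sum_a dot (\row_b sgb R (e b)) (row a B) ^+ 2).
    rewrite sign_meanZ sign_mean_sum.
    rewrite (eq_bigr (fun a => dot (row a B) (row a B))) => [|a _]; last first.
      by have [] := sign_mean_dot (row a B).
    have -> : \sum_a dot (row a B) (row a B) = tau.
      rewrite /tau mxtrace_gram; apply: eq_bigr => a _; apply: eq_bigr => b _.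
      by rewrite !mxE expr2.
    by rewrite /s2 invfM mulrAC -mulrA mulfV ?mulr1 // gt_eqF.
  apply/funext => e; rewrite /V dotZl dotZr mulrA -expr2 ss; congr (_ * _).
  apply: eq_bigr => a _; rewrite -expr2 mxE; congr (_ ^+ 2).
  by apply: eq_bigr => b _; rewrite !mxE.
(* Each j in J contributes at least 11/100 - 1/100 = 1/10, the source of the factor 10. *)
have tot : \sum_(j in J) (11 / 100 - 4 * 400^-1) <= r.
  apply: (@le_trans _ _ (sign_mean (fun=> 0) (fun e : {ffun 'I_p -> bool} =>
     \sum_(j in J) (f (dot (V e) (g j) ^+ 2 / m j) + (- 4) * dot (V e) (V e))))).
    rewrite sign_mean_sum; apply: ler_sum => j jJ.
    rewrite sign_meanD sign_meanZ Enorm; have := Emean j jJ; lra.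
  rewrite -(sign_mean_cst (I := 'I_p) (fun=> 0) r); apply: ler_sign_mean => [a|e].
    by rewrite normr0.
  apply: le_trans (pointwise e).
  by apply: ler_sum => j _; lra.
move: tot; rewrite sumr_const -mulr_natr; have : 0 <= #|J|%:R :> R by [].
lra.
Qed.

(** The single property of the sample on which the removal argument rests; what is derived from it
    is deterministic until the filter draws its seed. *)
Definition light (R : realType) p k (Q2 lam : R) (g : 'I_k -> 'rV[R]_p) : Prop :=
  sign_mean (fun=> 0) (fun e : {ffun 'I_p * 'I_k -> bool} =>
     expR (lam * \sum_j (heavy g Q2 e j)%:R)) <= expR k%:R.

(** 80 = 2 * 10 * 4 collects the losses of rounding, of passing to quadratic forms and of the
    entropy bound; 3200 = 4 * 800 those of the minimax step and of the forms. *)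
Lemma light_removal (R : realType) p k (g : 'I_k -> 'rV[R]_p) (Q2 lam : R) :
  (0 < k)%N -> 0 <= Q2 -> 0 < lam -> light Q2 lam g ->
  exists2 S : {set 'I_k}, k%:R - #|S|%:R <= 80 * k%:R / lam &
    forall v, \sum_(j in S) dot v (g j) ^+ 2 <= 3200 * Q2 * k%:R * dot v v.
Proof.
move=> k0 Q0 lam0 hg.
have hr : 0 <= 4 * k%:R / lam :> R by rewrite divr_ge0 ?mulr_ge0 // ltW.
have hd v (hv : dot v v <= 4^-1) := heavy_direction k0 Q0 lam0 hv hg.
have hf := direction_to_form Q0 hd.
have L0 : 0 <= 800 * Q2 by lra.
have r0 : 0 <= 10 * (4 * k%:R / lam) :> R by lra.
have [S hS1 hS2] := removal_minimax L0 r0 hf.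
exists S; first by move: hS1; lra.
move=> v; apply: (le_trans (hS2 v)); rewrite le_eqVlt; apply/orP; left.
by apply/eqP; ring.
Qed.

(** * Independence *)

Section matrix_measurability.
Context d (T : measurableType d) (m n : nat).

Lemma measurable_entry (i : 'I_m) (j : 'I_n) :
  measurable_fun setT (fun M : 'M[T]_(m, n) => M i j).
Proof.
move=> _ B mB; rewrite setTI; apply: sub_sigma_algebra.
by exists i, j, B.
Qed.

Lemma measurable_fun_mx d' (S : measurableType d') (f : S -> 'M[T]_(m, n)) :
  (forall i j, measurable_fun setT (fun s => f s i j)) -> measurable_fun setT f.
Proof.
move=> mf; apply: (measurability (@mx_entries_preimages d T m n)) => //.
move=> _ [_ [i [j [B [mB ->]]]] <-].
exact: mf.
Qed.

End matrix_measurability.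

Section independent_pair.
Context d (Omega : measurableType d) (R : realType) (P : probability Omega R).
Context d1 (V : measurableType d1) d2 (W : measurableType d2).
Context (X : Omega -> V) (Y : Omega -> W).
Hypotheses (mX : measurable_fun setT X) (mY : measurable_fun setT Y).
Hypothesis XY : independent P X Y.
Local Open Scope ereal_scope.

Let mX_mixin := isMeasurableFun.Build _ _ _ _ _ mX.
Let X' : {mfun Omega >-> V} := HB.pack X mX_mixin.
Let mY_mixin := isMeasurableFun.Build _ _ _ _ _ mY.
Let Y' : {mfun Omega >-> W} := HB.pack Y mY_mixin.
Let mXY : measurable_fun setT (fun w => (X w, Y w)).
Proof. exact: measurable_fun_pair. Qed.
Let mXY_mixin := isMeasurableFun.Build _ _ _ _ _ mXY.
Let XY' : {mfun Omega >-> (V * W)%type} := HB.pack (fun w => (X w, Y w)) mXY_mixin.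

Lemma independent_law (F : set (V * W)) : measurable F ->
  (distribution P X' \x distribution P Y') F = distribution P XY' F.
Proof.
by move=> mF; apply: product_measure_unique => // A B mA mB; exact: XY.
Qed.

Lemma independent_section (F : set (V * W)) : measurable F ->
  P [set w | F (X w, Y w)] = \int[P]_w P [set w' | F (X w, Y w')].
Proof.
move=> mF; have := independent_law mF.
rewrite /product_measure1 /= => h.
transitivity (distribution P XY' F) => //; rewrite -h.
rewrite /product_measure1 ge0_integral_distribution //.
- apply: eq_integral => w _ /=; rewrite /distribution /pushforward /=.
  by congr (P _); apply/seteqP; split=> w' /=; rewrite /xsection /= inE.
- exact: measurable_fun_xsection.
Qed.

Lemma measurable_section_prob (F : set (V * W)) : measurable F ->
  measurable_fun setT (fun w => P [set w' | F (X w, Y w')]).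
Proof.
move=> mF; have := measurable_fun_xsection (distribution P Y') mF.
move/(fun h => measurableT_comp h mX); apply: eq_measurable_fun => w _ /=.
rewrite /distribution /pushforward /=.
by congr (P _); apply/seteqP; split=> w' /=; rewrite /xsection /= inE.
Qed.

(** Conditioning by Fubini: a bound for each frozen value in [N] passes to the pair. It lets a
    random estimator be treated as a constant near the true parameter. *)
Lemma independent_section_le (F : set (V * W)) (N : set V) (c : \bar R) :
  measurable F -> 0 <= c -> {ae P, forall w, N (X w)} ->
  (forall v, N v -> P [set w' | F (v, Y w')] <= c) ->
  P [set w | F (X w, Y w)] <= c.
Proof.
move=> mF c0 hN hc; rewrite independent_section //.
apply: (@le_trans _ _ (\int[P]_w cst c w)).
  apply: ae_ge0_le_integral => //.
  - exact: measurable_section_prob.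
  - by apply: filterS hN => w Nw _; exact: hc.
by rewrite integral_cst //= probability_setT mule1.
Qed.

End independent_pair.

Section independent_mean.
Context d (Omega : measurableType d) (R : realType) (P : probability Omega R).
Context (X Y : Omega -> R).
Hypotheses (iX : P.-integrable setT (EFin \o X)) (iY : P.-integrable setT (EFin \o Y)).
Hypothesis XY : independent P X Y.
Local Open Scope ereal_scope.

Let mX : measurable_fun setT X.
Proof. exact/measurable_EFinP/(measurable_int P). Qed.
Let mY : measurable_fun setT Y.
Proof. exact/measurable_EFinP/(measurable_int P). Qed.
Let mX_mixin := isMeasurableFun.Build _ _ _ _ _ mX.
Let X' : {mfun Omega >-> R} := HB.pack X mX_mixin.
Let mY_mixin := isMeasurableFun.Build _ _ _ _ _ mY.
Let Y' : {mfun Omega >-> R} := HB.pack Y mY_mixin.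
Let mXY : measurable_fun setT (fun w => (X w, Y w)).
Proof. exact: measurable_fun_pair. Qed.

Let f (u : R * R) : \bar R := (u.1 * u.2)%:E.

Let mf : measurable_fun setT f.
Proof. by apply/measurable_EFinP; exact: measurable_funM. Qed.

Let law_eq (g : R * R -> \bar R) :
  \int[distribution P X' \x distribution P Y']_u g u =
  \int[pushforward P (fun w => (X w, Y w))]_u g u.
Proof.
apply: eq_measure_integral => A mA _.
exact: (independent_law mX mY XY mA).
Qed.

Let int_f : (distribution P X' \x distribution P Y').-integrable setT f.
Proof.
apply/(@integrable12ltyP _ _ _ _ _ (distribution P X') (distribution P Y') f mf).
under eq_integral => x _.
  under eq_integral => y _ do rewrite /f /= normrM EFinM.
  rewrite ge0_integralZl //; last by apply/measurable_EFinP; exact: normr_measurable.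
  over.
rewrite /= ge0_integralZr //; last 2 first.
- by apply/measurable_EFinP; exact: normr_measurable.
- by apply: integral_ge0 => y _; rewrite lee_fin.
rewrite (ge0_integral_distribution X') /=; [|by apply/measurable_EFinP; exact: normr_measurable|by move=> y; rewrite lee_fin].
rewrite (ge0_integral_distribution Y') /=; [|by apply/measurable_EFinP; exact: normr_measurable|by move=> y; rewrite lee_fin].
move/integrableP: iX => [_ iX']; move/integrableP: iY => [_ iY'].
by rewrite lte_mul_pinfty //; [apply: integral_ge0|rewrite ge0_fin_numE //; apply: integral_ge0].
Qed.

Lemma independent_integrableM : P.-integrable setT (fun w => (X w * Y w)%:E).
Proof.
apply/integrableP; split.
  by apply/measurable_EFinP; exact: measurable_funM.
have := int_f => /integrableP[_].
rewrite law_eq ge0_integral_pushforward //=.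
by apply/measurable_EFinP; apply: measurableT_comp => //; exact: measurable_funM.
Qed.

Lemma independent_integralM :
  \int[P]_w (X w * Y w)%:E = (\int[P]_w (X w)%:E) * (\int[P]_w (Y w)%:E).
Proof.
transitivity (\int[distribution P X' \x distribution P Y']_u f u).
  rewrite law_eq integral_pushforward //.
  exact: independent_integrableM.
rewrite -(integral12_prod_meas1 int_f).
have iX' : (distribution P X').-integrable setT EFin.
  by apply: integrable_pushforward.
have iY' : (distribution P Y').-integrable setT EFin.
  by apply: integrable_pushforward.
rewrite -(integral_distribution (P := P) (X := X') (f := EFin)) //.
rewrite -(integral_distribution (P := P) (X := Y') (f := EFin)) //.
set m := \int[distribution P Y']_y _.
have mE : (fine m)%:E = m by rewrite fineK // integrable_fin_num.
rewrite -mE -integralZr //; apply: eq_integral => x _.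
by rewrite mE /m -integralZl.
Qed.

End independent_mean.

Section independent_extension.
Context d (Omega : measurableType d) (R : realType) (P : probability Omega R).
Context d1 (V : measurableType d1) (X : Omega -> V).
Hypothesis mX : measurable_fun setT X.
Context (G : set (set V)) (K : set Omega).
Hypotheses (mG : measurable = <<s G >>) (GI : setI_closed G) (GT : G setT).
Hypothesis mK : measurable K.
Hypothesis GK : forall E, G E -> P (X @^-1` E `&` K) = (P (X @^-1` E) * P K)%E.

Let r : {nonneg R} := NngNum (fine_ge0 (measure_ge0 P K)).

(** Both sides are finite measures in [E] that agree on a generating family closed under
    intersection, hence everywhere. *)
Lemma independent_extension E : measurable E ->
  P (X @^-1` E `&` K) = (P (X @^-1` E) * P K)%E.
Proof.
move=> mE.
have PK : (r%:num)%:E = P K by rewrite /= fineK // fin_num_measure.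
have := @measure_unique _ R V G (fun=> setT) mG GI (fun=> GT) _
  (pushforward (mrestr P mK) X) (mscale r (pushforward P X)) _ _ E mE.
rewrite /= /mscale PK muleC; apply.
- by apply/seteqP; split=> // v _; exists 0%N.
- exact: mX.
- by move=> A GA; rewrite /pushforward muleC; exact: GK.
- move=> _; rewrite /pushforward /mrestr preimage_setT setTI.
  by rewrite ltey_eq fin_num_measure.
Qed.

End independent_extension.

Section boxes.
Context d (V : measurableType d) (n : nat).

Definition box (C : 'I_n -> set V) : set (n.-tuple V) :=
  [set t | forall i, C i (tnth t i)].

Definition boxes : set (set (n.-tuple V)) :=
  [set E | exists2 C, (forall i, measurable (C i)) & E = box C].

Lemma measurable_box C : (forall i, measurable (C i)) -> measurable (box C).
Proof.
move=> mC; rewrite (_ : box C = \bigcap_(i in [set: 'I_n]) ((@tnth n V)^~ i @^-1` C i)).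
  apply: fin_bigcap_measurable => // i _.
  by rewrite -[X in measurable X]setTI; exact: measurable_tnth.
by apply/seteqP; split=> t h i; [move=> _; exact: h | exact: (h i)].
Qed.

Lemma boxes_generate : measurable = <<s boxes >>.
Proof.
apply/seteqP; split; last first.
  apply: smallest_sub; first exact: sigma_algebra_measurable.
  by move=> _ [C mC ->]; exact: measurable_box.
apply: smallest_sub; first exact: smallest_sigma_algebra.
rewrite -bigcup_seq => E [i _ [B mB <-]]; apply: sub_sigma_algebra.
exists (fun j => if j == i then B else setT); first by move=> j; case: ifP.
rewrite setTI; apply/seteqP; split=> t /=.
  by move=> h j; case: eqP => // ->.
by move/(_ i); rewrite eqxx.
Qed.

Lemma boxesI : setI_closed boxes.
Proof.
move=> _ _ [C mC ->] [D mD ->]; exists (fun i => C i `&` D i).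
  by move=> i; exact: measurableI.
by apply/seteqP; split=> t /=; [move=> [h1 h2] i | move=> h; split=> i; have [] := h i].
Qed.

Lemma boxesT : boxes setT.
Proof. by exists (fun=> setT) => //; apply/seteqP; split. Qed.

End boxes.

Section masked.
Context d (Omega : measurableType d) (R : realType) (P : probability Omega R).
Context d1 (V : measurableType d1) (n : nat) (X : 'I_n -> Omega -> V).
Hypothesis mX : forall i, measurable_fun setT (X i).

(* The subfamily of X indexed by A, padded with a constant so that all
   subfamilies take values in the same space of tuples. *)
Definition masked (A : {set 'I_n}) (w : Omega) : n.-tuple V :=
  [tuple if i \in A then X i w else point | i < n].

Lemma measurable_masked A : measurable_fun setT (masked A).
Proof.
apply/measurable_fun_tnthP => i.
rewrite (_ : _ \o _ = fun w => if i \in A then X i w else point).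
  by case: (i \in A).
by apply/funext => w /=; rewrite tnth_mktuple.
Qed.

Lemma masked_box (A : {set 'I_n}) (C : 'I_n -> set V) :
  (forall i, i \notin A -> C i point) ->
  masked A @^-1` box C = \bigcap_(i in [set` A]) (X i @^-1` C i).
Proof.
move=> hC; apply/seteqP; split=> w /= h i; have := h i.
  by rewrite tnth_mktuple => hi iA; move: hi; rewrite iA.
by rewrite tnth_mktuple; case: ifPn => [iA /(_ iA)|iA _] //; exact: hC.
Qed.

Lemma masked_box0 (A : {set 'I_n}) (C : 'I_n -> set V) :
  ~ (forall i, i \notin A -> C i point) -> masked A @^-1` box C = set0.
Proof.
move=> hC; apply/seteqP; split=> // w /= h; apply: hC => i iA.
by have := h i; rewrite tnth_mktuple (negbTE iA).
Qed.

Hypothesis indepX : mutually_independent P X.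

(** A box that excludes the padding value at a masked coordinate has empty preimage; otherwise the
    preimage constrains only the coordinates in the mask, and the product rule over the union of the
    two index sets applies. *)
Lemma masked_independent_box (A B : {set 'I_n}) (C D : 'I_n -> set V) :
  [disjoint A & B]%B -> (forall i, measurable (C i)) -> (forall i, measurable (D i)) ->
  P (masked A @^-1` box C `&` masked B @^-1` box D) =
  (P (masked A @^-1` box C) * P (masked B @^-1` box D))%E.
Proof.
move=> AB mC mD.
have [hC|hC] := pselect (forall i, i \notin A -> C i point); last first.
  by rewrite masked_box0 // set0I measure0 mul0e.
have [hD|hD] := pselect (forall i, i \notin B -> D i point); last first.
  by rewrite [masked B @^-1` _]masked_box0 // setI0 measure0 mule0.
rewrite !masked_box //.
pose F i := if i \in A then C i else D i.
have mF i : measurable (F i) by rewrite /F; case: ifP.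
have AE i : i \in A -> F i = C i by rewrite /F => ->.
have BE i : i \in B -> F i = D i.
  by rewrite /F => iB; rewrite (disjointFl AB iB).
have -> : \bigcap_(i in [set` A]) (X i @^-1` C i) `&` \bigcap_(i in [set` B]) (X i @^-1` D i)
    = \bigcap_(i in [set` A :|: B]) (X i @^-1` F i).
  apply/seteqP; split=> w /=.
    move=> [hA hB] i /=; rewrite inE => /orP[iA|iB].
      by rewrite AE //; exact: hA.
    by rewrite BE //; exact: hB.
  move=> h; split=> i /= iAB.
    by rewrite -AE //; apply: h; rewrite /= inE iAB.
  by rewrite -BE //; apply: h; rewrite /= inE iAB orbT.
rewrite !indepX // -EFinM (eq_bigl [predU A & B]) => [|i]; last by rewrite !inE.
rewrite bigU //=; congr (_ * _)%:E; apply: eq_bigr => i iAB.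
  by rewrite AE.
by rewrite BE.
Qed.

(** Boxes are replaced by arbitrary measurable sets one factor at a time. *)
Lemma masked_independent (A B : {set 'I_n}) : [disjoint A & B]%B ->
  independent P (masked A) (masked B).
Proof.
move=> AB E F mE mF.
apply: (independent_extension (measurable_masked A) (boxes_generate V n) (@boxesI _ V n)
  (@boxesT _ V n) _ _ mE).
  by rewrite -[X in measurable X]setTI; exact: measurable_masked.
move=> _ [C mC ->]; rewrite setIC muleC.
apply: (independent_extension (measurable_masked B) (boxes_generate V n) (@boxesI _ V n)
  (@boxesT _ V n) _ _ mF).
  by rewrite -[X in measurable X]setTI; apply: measurable_masked => //; exact: measurable_box.
by move=> _ [D mD ->]; rewrite setIC muleC; exact: masked_independent_box.
Qed.

End masked.

(** * Moments and tail bounds *)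

Section mean.
Context d (Omega : measurableType d) (R : realType) (P : probability Omega R).
Implicit Types f g : Omega -> R.

Definition rint f : Prop := P.-integrable setT (EFin \o f).

(** [fine] sends an infinite integral to 0, so an upper bound on [mean] is informative only together
    with [rint]. *)
Definition mean f : R := fine (\int[P]_w (f w)%:E)%E.

Lemma rint_measurable f : rint f -> measurable_fun setT f.
Proof. by move=> h; apply/measurable_EFinP; exact: (measurable_int P). Qed.

Lemma integral_mean f : rint f -> (\int[P]_w (f w)%:E)%E = (mean f)%:E.
Proof. by move=> hf; rewrite fineK // integrable_fin_num. Qed.

Lemma rint_cst c : rint (fun=> c).
Proof. exact: finite_measure_integrable_cst. Qed.

Lemma rintD f g : rint f -> rint g -> rint (fun w => f w + g w).
Proof. by move=> hf hg; exact: (integrableD measurableT hf hg). Qed.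

Lemma rintZ c f : rint f -> rint (fun w => c * f w).
Proof. by move=> hf; exact: (integrableZl measurableT c hf). Qed.

Lemma rint_sum I (r : seq I) (Q : pred I) (F : I -> Omega -> R) :
  (forall i, Q i -> rint (F i)) -> rint (fun w => \sum_(i <- r | Q i) F i w).
Proof.
move=> hF; have := @integrable_sum _ _ _ P _ measurableT I r Q (fun i => EFin \o F i) hF.
by apply: eq_integrable => // w _; rewrite /= sumEFin.
Qed.

Lemma rint_le f g : measurable_fun setT f -> (forall w, `|f w| <= g w) ->
  rint g -> rint f.
Proof.
move=> mf fg; apply: le_integrable => //; first exact/measurable_EFinP.
by move=> w _; rewrite /= lee_fin (le_trans (fg w)) // ler_norm.
Qed.

Lemma rint_ge0 f : measurable_fun setT f -> (forall w, 0 <= f w) ->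
  (\int[P]_w (f w)%:E < +oo)%E -> rint f.
Proof.
move=> mf f0 foo; apply/integrableP; split; first exact/measurable_EFinP.
by under eq_integral do rewrite /= ger0_norm //.
Qed.

Lemma mean_cst c : mean (fun=> c) = c.
Proof. by rewrite /mean integral_cst //= probability_setT mule1. Qed.

Lemma meanD f g : rint f -> rint g -> mean (fun w => f w + g w) = mean f + mean g.
Proof. by move=> hf hg; exact: RintegralD. Qed.

Lemma meanZ c f : rint f -> mean (fun w => c * f w) = c * mean f.
Proof. by move=> hf; exact: RintegralZl. Qed.

Lemma mean_sum I (r : seq I) (Q : pred I) (F : I -> Omega -> R) :
  (forall i, rint (F i)) ->
  mean (fun w => \sum_(i <- r | Q i) F i w) = \sum_(i <- r | Q i) mean (F i).
Proof.
move=> hF; elim: r => [|i r ih].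
  rewrite big_nil -[RHS]mean_cst; congr mean; apply/funext => w.
  by rewrite big_nil.
rewrite big_cons -ih; case: ifPn => Qi.
  rewrite -meanD //; last by apply: rint_sum.
  by congr mean; apply/funext => w; rewrite big_cons Qi.
by congr mean; apply/funext => w; rewrite big_cons (negbTE Qi).
Qed.

Lemma mean_le f g : rint f -> rint g -> (forall w, f w <= g w) -> mean f <= mean g.
Proof. by move=> hf hg fg; exact: le_Rintegral. Qed.

Lemma mean_ge0 f : (forall w, 0 <= f w) -> 0 <= mean f.
Proof. by move=> h; exact: Rintegral_ge0. Qed.

Lemma rint_sqrM f g : measurable_fun setT f -> measurable_fun setT g ->
  rint (fun w => f w ^+ 2) -> rint (fun w => g w ^+ 2) ->
  rint (fun w => f w * g w).
Proof.
move=> mf mg hf hg; apply: (rint_le (g := fun w => f w ^+ 2 + g w ^+ 2)).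
- exact: measurable_funM.
- move=> w; rewrite ler_norml; apply/andP.
  have := sqr_ge0 (f w + g w); have := sqr_ge0 (f w - g w).
  have := sqr_ge0 (f w); have := sqr_ge0 (g w).
  by split; lra.
- exact: rintD.
Qed.

Lemma rint_sqr f : measurable_fun setT f -> rint (fun w => f w ^+ 2) -> rint f.
Proof.
move=> mf hf; apply: (rint_le (g := fun w => 1 + f w ^+ 2)) => // [w|].
  rewrite ler_norml; have := sqr_ge0 (f w - 1); have := sqr_ge0 (f w + 1).
  by have := sqr_ge0 (f w) => ? ? ?; apply/andP; split; lra.
by apply: rintD => //; exact: rint_cst.
Qed.

Lemma independent_rintM f g : independent P f g -> rint f -> rint g ->
  rint (fun w => f w * g w).
Proof. by move=> hi hf hg; exact: independent_integrableM. Qed.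

Lemma independent_meanM f g : independent P f g -> rint f -> rint g ->
  mean (fun w => f w * g w) = mean f * mean g.
Proof.
move=> hi hf hg; rewrite {1}/mean (independent_integralM hf hg hi).
by rewrite !integral_mean.
Qed.

Lemma mean_indic (S : set Omega) : measurable S ->
  rint (\1_S) /\ P S = (mean (\1_S))%:E.
Proof.
move=> mS; have h : rint (\1_S).
  apply: rint_ge0 => //; rewrite integral_indic // setIT.
  by rewrite ltey_eq fin_num_measure.
by split=> //; rewrite -integral_mean // integral_indic // setIT.
Qed.

End mean.

Section second_moment.
Context d (Omega : measurableType d) (R : realType) (P : probability Omega R).

Lemma mean_sqr_sum n (A : {set 'I_n}) (U : 'I_n -> Omega -> R) (e : R) :
  (forall i, measurable_fun setT (U i)) ->
  (forall i, rint P (fun w => U i w ^+ 2)) ->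
  (forall i, mean P (U i) = 0) ->
  (forall i, mean P (fun w => U i w ^+ 2) <= e) ->
  (forall i j, i != j -> independent P (U i) (U j)) ->
  rint P (fun w => (\sum_(i in A) U i w) ^+ 2) /\
  mean P (fun w => (\sum_(i in A) U i w) ^+ 2) <= #|A|%:R * e.
Proof.
move=> mU U2 U0 Ue ind.
have iU i : rint P (U i) by exact: rint_sqr.
have eqS : (fun w => (\sum_(i in A) U i w) ^+ 2) =
    (fun w => \sum_(i in A) \sum_(j in A) U i w * U j w).
  apply/funext => w; rewrite expr2 mulr_suml; apply: eq_bigr => i _.
  by rewrite mulr_sumr.
have iUU i j : rint P (fun w => U i w * U j w) by exact: rint_sqrM.
have iS i : rint P (fun w => \sum_(j in A) U i w * U j w) by exact: rint_sum.
rewrite eqS; split; first exact: rint_sum.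
rewrite mean_sum // mulr_natl -sumr_const; apply: ler_sum => i iA.
rewrite mean_sum // (bigD1 i) //= big1 => [|j /andP[_ ji]]; last first.
  by rewrite independent_meanM ?U0 ?mul0r //; apply: ind; rewrite eq_sym.
by rewrite addr0; have := Ue i; under eq_fun do rewrite expr2.
Qed.

(** Markov's inequality for a strict excess. It includes e = 0, where f vanishes almost everywhere;
    this occurs for zero noise or a zero direction. *)
Lemma prob_gt (f : Omega -> R) (e C : R) : (forall w, 0 <= f w) ->
  rint P f -> mean P f <= e -> 0 <= e -> 0 < C ->
  (P [set w | (C * e < f w)%R] <= (C^-1)%:E)%E.
Proof.
move=> f0 iX hX; have mf := rint_measurable iX.
have mS : measurable [set w | C * e < f w].
  rewrite (_ : [set w | _] = f @^-1` `]C * e, +oo[%classic).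
    by rewrite -[X in measurable X]setTI; apply: mf => //; exact: measurable_itv.
  by apply/seteqP; split=> w /=; rewrite in_itv /= andbT.
rewrite le_eqVlt => /predU1P[e0|e0] C0.
  have X0 : mean P f = 0.
    apply/eqP; rewrite eq_le; apply/andP; split; first by rewrite e0.
    exact: mean_ge0.
  have := integral_mean iX; rewrite X0.
  have -> : (\int[P]_w (f w)%:E = \int[P]_w `|(f w)%:E|)%E.
    by apply: eq_integral => w _; rewrite gee0_abs // lee_fin.
  move/(ae_eq_integral_abs _ measurableT _).1 => -[|N [mN N0 hN]].
    exact/measurable_EFinP.
  move: mS; rewrite -e0 mulr0 => mS.
  apply: (@le_trans _ _ (P N)); last by rewrite N0 lee_fin invr_ge0 ltW.
  apply: le_measure; rewrite ?inE //.
  apply: subset_trans hN => w /= Xw h.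
  by have [hz] := h Logic.I; move: Xw; rewrite hz ltxx.
have Ce : 0 < C * e by rewrite mulr_gt0.
have [iS ->] := mean_indic P mS.
rewrite lee_fin -(ler_pM2l Ce) -meanZ // mulrAC mulfV ?gt_eqF // mul1r.
apply: le_trans hX; apply: mean_le => //; first exact: rintZ.
move=> w; rewrite indicE; case: (boolP (w \in _)) => [|_]; last by rewrite mulr0.
by rewrite inE mulr1 => /ltW.
Qed.

End second_moment.

Section masked_block.
Context d (Omega : measurableType d) (R : realType) (P : probability Omega R).
Context d1 (V : measurableType d1) (n : nat) (X : 'I_n -> Omega -> V).
Hypothesis mX : forall i, measurable_fun setT (X i).
Hypothesis indepX : mutually_independent P X.

Definition mask_tuple (A : {set 'I_n}) (t : n.-tuple V) : n.-tuple V :=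
  [tuple if i \in A then tnth t i else point | i < n].

Lemma measurable_mask_tuple A : measurable_fun setT (mask_tuple A).
Proof.
apply/measurable_fun_tnthP => i.
rewrite (_ : _ \o _ = fun t => if i \in A then tnth t i else point).
  by case: (i \in A) => //; exact: measurable_tnth.
by apply/funext => w /=; rewrite tnth_mktuple.
Qed.

Lemma mask_tuple_masked (A B : {set 'I_n}) w : A \subset B ->
  mask_tuple A (masked X B w) = masked X A w.
Proof.
move=> AB; apply/eq_from_tnth => i; rewrite !tnth_mktuple.
by case: ifPn => // iA; rewrite (fintype.subsetP AB _ iA).
Qed.

(** Peel off one block at a time: the events of the other blocks depend only on the coordinates in
    their union, which is disjoint from the peeled block. *)
Lemma masked_bigcap_le k (A : 'I_k -> {set 'I_n}) (E : 'I_k -> set (n.-tuple V))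
    (q : R) :
  (forall i j, i != j -> [disjoint A i & A j]%B) ->
  (forall j, measurable (E j)) -> 0 <= q ->
  (forall j, P (masked X (A j) @^-1` E j) <= q%:E)%E ->
  forall J : {set 'I_k},
  (P (\bigcap_(j in [set` J]) masked X (A j) @^-1` E j) <= (q ^+ #|J|)%:E)%E.
Proof.
move=> disA mE q0 hq J.
have [m] := ubnP #|J|; elim: m J => // m ih J hJ.
have [->|[j jJ]] := set_0Vmem J.
  rewrite cards0 expr0 (_ : \bigcap_(j in _) _ = setT) ?probability_setT //.
  by apply/seteqP; split=> // w _ j /=; rewrite inE.
pose J' := J :\ j.
pose B := (\bigcup_(i in J') A i)%SET.
pose F := \bigcap_(i in [set` J']) mask_tuple (A i) @^-1` E i.
have mF : measurable F.
  apply: fin_bigcap_measurable => // i _.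
  by rewrite -[X in measurable X]setTI; exact: measurable_mask_tuple.
have FE : masked X B @^-1` F = \bigcap_(i in [set` J']) masked X (A i) @^-1` E i.
  apply/seteqP; split=> w /= h i iJ; have := h i iJ; rewrite /= mask_tuple_masked //;
  exact: (finset.bigcup_sup i).
have AB : [disjoint A j & B]%B.
  apply/bigcup_disjointP => i; rewrite !inE => /andP[ij _].
  by apply: disA; rewrite eq_sym.
have -> : \bigcap_(i in [set` J]) masked X (A i) @^-1` E i =
    masked X (A j) @^-1` E j `&` masked X B @^-1` F.
  rewrite FE; apply/seteqP; split=> w /=.
    by move=> h; split; [exact: h|move=> i; rewrite /= !inE => /andP[_ iJ]; exact: h].
  move=> [hj h] i /= iJ; have [->|ij] := eqVneq i j; first exact: hj.
  by apply: h; rewrite /= !inE ij.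
rewrite (masked_independent mX indepX AB (mE j) mF) FE.
rewrite (cardsD1 j) jJ add1n exprS EFinM lee_pmul //.
by apply: ih; rewrite -ltnS (leq_trans _ hJ) // (cardsD1 j J) jJ.
Qed.

End masked_block.

(** * Moments of the covariates and of the regression residual *)

Section isotropic_moments.
Context d (Omega : measurableType d) (R : realType) (P : probability Omega R).
Context (p : nat) (X : Omega -> 'rV[R]_p) (s4 C : R).
Hypotheses (mX : measurable_fun setT X) (isoX : isotropic P X).
Hypotheses (hypX : hypercontractive42 P X s4) (s4C : s4 <= C).

Lemma measurable_coord a : measurable_fun setT (fun w => X w 0 a).
Proof. exact: (measurableT_comp (measurable_entry 0 a) mX). Qed.

Lemma measurable_dot v : measurable_fun setT (fun w => dot v (X w)).
Proof.
rewrite /dot; apply: measurable_sum => a.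
by apply: measurable_funM => //; exact: measurable_coord.
Qed.

Lemma rint_coordM a b : rint P (fun w => X w 0 a * X w 0 b) /\
  mean P (fun w => X w 0 a * X w 0 b) = (a == b)%:R.
Proof.
have [_ iso] := isoX; rewrite unlock in iso.
have sq c : rint P (fun w => X w 0 c ^+ 2).
  apply: rint_ge0 => [|w|]; last 2 first.
  - exact: sqr_ge0.
  - by under eq_integral do rewrite expr2; rewrite iso eqxx ltry.
  by apply: measurable_funX; exact: measurable_coord.
split; first by apply: rint_sqrM => //; exact: measurable_coord.
by rewrite /mean iso.
Qed.

Lemma dot_sqrE v w : dot v (X w) ^+ 2 =
  \sum_a \sum_b (v 0 a * v 0 b) * (X w 0 a * X w 0 b).
Proof.
rewrite expr2 /dot mulr_suml; apply: eq_bigr => a _.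
by rewrite mulr_sumr; apply: eq_bigr => b _; rewrite mulrACA.
Qed.

Lemma mean_dot_sqr v : rint P (fun w => dot v (X w) ^+ 2) /\
  mean P (fun w => dot v (X w) ^+ 2) = dot v v.
Proof.
have h1 a b : rint P (fun w => v 0 a * v 0 b * (X w 0 a * X w 0 b)).
  by apply: rintZ; have [] := rint_coordM a b.
have h2 a : rint P (fun w => \sum_b v 0 a * v 0 b * (X w 0 a * X w 0 b)).
  exact: rint_sum.
under eq_fun do rewrite dot_sqrE; split; first exact: rint_sum.
rewrite mean_sum //; apply: eq_bigr => a _; rewrite mean_sum //.
rewrite (bigD1 a) //= big1 => [|b ba].
  rewrite meanZ; last by have [] := rint_coordM a a.
  by have [_ ->] := rint_coordM a a; rewrite eqxx mulr1 addr0.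
rewrite meanZ; last by have [] := rint_coordM a b.
by have [_ ->] := rint_coordM a b; rewrite eq_sym (negbTE ba) mulr0.
Qed.

Lemma rint_dot v : rint P (fun w => dot v (X w)).
Proof. by apply: rint_sqr; [exact: measurable_dot | have [] := mean_dot_sqr v]. Qed.

Lemma mean_dotM u v : rint P (fun w => dot u (X w) * dot v (X w)) /\
  mean P (fun w => dot u (X w) * dot v (X w)) = dot u v.
Proof.
have hi x : rint P (fun w => dot x (X w) ^+ 2) by have [] := mean_dot_sqr x.
split; first by apply: rint_sqrM => //; exact: measurable_dot.
rewrite (_ : (fun w => _) = fun w => 2^-1 * dot (u + v) (X w) ^+ 2 +
   (- 2^-1 * dot u (X w) ^+ 2 + - 2^-1 * dot v (X w) ^+ 2)); last first.
  by apply/funext => w; rewrite dotDl; field.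
rewrite !meanD ?meanZ //; try by [exact: rintZ | apply: rintD; exact: rintZ].
have hm x : mean P (fun w => dot x (X w) ^+ 2) = dot x x by have [] := mean_dot_sqr x.
by rewrite !hm !(dotDl, dotDr) (dotC v u); field.
Qed.

Lemma mean_dot4_unit v : l2norm v = 1 ->
  rint P (fun w => dot v (X w) ^+ 4) /\ mean P (fun w => dot v (X w) ^+ 4) <= C ^+ 4.
Proof.
move=> v1; have := hypX v1; rewrite unlock.
have [i2 m2] := mean_dot_sqr v.
have vv : dot v v = 1.
  by rewrite -[LHS]sqr_sqrtr ?dot_ge0 // -l2normE v1 expr1n.
rewrite (integral_mean i2) m2 vv poweR_EFin powR1 mule1.
have m4 : measurable_fun setT (fun w => dot v (X w) ^+ 4).
  by apply: measurable_funX; exact: measurable_dot.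
have eq4 w : `|dot v (X w)| ^+ 4 = dot v (X w) ^+ 4.
  by rewrite -normrX ger0_norm // (exprM _ 2 2) sqr_ge0.
under eq_integral do rewrite eq4.
have i0 : (0 <= \int[P]_w (dot v (X w) ^+ 4)%:E)%E.
  by apply: integral_ge0 => w _; rewrite lee_fin (exprM _ 2 2) sqr_ge0.
(* An infinite fourth moment would make the left side of the hypercontractive inequality infinite,
   while its right side is finite. *)
case E : (\int[P]_w (dot v (X w) ^+ 4)%:E)%E i0 => [r| |] // r0; last first.
  by rewrite poweRyr ?invr_eq0 ?pnatr_eq0 // leye_eq.
rewrite poweR_EFin !lee_fin in r0 * => hr.
have h4 : rint P (fun w => dot v (X w) ^+ 4).
  by apply: rint_ge0 => // [w|]; [rewrite (exprM _ 2 2) sqr_ge0 | rewrite E ltry].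
split=> //; have -> : mean P (fun w => dot v (X w) ^+ 4) = r by rewrite /mean E.
have -> : r = (r `^ 4^-1) ^+ 4.
  by rewrite -powR_mulrn ?powR_ge0 // -powRrM mulVf ?powRr1 // pnatr_eq0.
by rewrite ler_pXn2r ?nnegrE ?powR_ge0 // ?(le_trans hr) // (le_trans _ s4C) // (le_trans _ hr) // powR_ge0.
Qed.

Lemma mean_dot4 v :
  rint P (fun w => dot v (X w) ^+ 4) /\
  mean P (fun w => dot v (X w) ^+ 4) <= C ^+ 4 * dot v v ^+ 2.
Proof.
have := dot_ge0 v; rewrite le_eqVlt => /predU1P[v0|v0].
  have h w : dot v (X w) ^+ 4 = 0.
    apply/eqP; rewrite expf_eq0 /= -sqrf_eq0 eq_le sqr_ge0 andbT.
    by rewrite (le_trans (dot_CS _ _)) // -v0 mul0r.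
  under eq_fun do rewrite h; rewrite mean_cst -v0 expr0n mulr0.
  by split=> //; exact: rint_cst.
pose s := Num.sqrt (dot v v).
have s0 : 0 < s by rewrite sqrtr_gt0.
have ss : s ^+ 2 = dot v v by rewrite sqr_sqrtr // ltW.
pose u := s^-1 *: v.
have u1 : l2norm u = 1.
  rewrite l2normE dotZl dotZr -ss (_ : _ * _ = 1) ?sqrtr1 //.
  by field; rewrite gt_eqF.
have vE w : dot v (X w) ^+ 4 = s ^+ 4 * dot u (X w) ^+ 4.
  by rewrite dotZl -exprMn mulVKf // gt_eqF.
under eq_fun do rewrite vE; have [i4 m4] := mean_dot4_unit u1.
split; first exact: rintZ.
by rewrite meanZ // mulrC -ss -exprM ler_wpM2r // exprn_ge0 // ltW.
Qed.

Lemma mean_dot22 u v :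
  rint P (fun w => (dot u (X w) * dot v (X w)) ^+ 2) /\
  mean P (fun w => (dot u (X w) * dot v (X w)) ^+ 2) <= C ^+ 4 * dot u u * dot v v.
Proof.
have [iu mu] := mean_dot4 u; have [iv mv] := mean_dot4 v.
have ir : rint P (fun w => (dot u (X w) * dot v (X w)) ^+ 2).
  apply: (rint_le (g := fun w => dot u (X w) ^+ 4 + dot v (X w) ^+ 4)).
  - by apply: measurable_funX; apply: measurable_funM; exact: measurable_dot.
  - move=> w; rewrite ger0_norm ?sqr_ge0 // exprMn.
    rewrite (exprM (dot u _) 2 2) (exprM (dot v _) 2 2).
    have := sqr_ge0 (dot u (X w)); have := sqr_ge0 (dot v (X w)).
    move: (_ ^+ 2) (_ ^+ 2) => x y; nra.
  - exact: rintD.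
split=> //.
have deg (x y : 'rV[R]_p) : dot x x = 0 -> dot x y = 0.
  move=> x0; apply/eqP; rewrite -sqrf_eq0 eq_le sqr_ge0 andbT.
  by rewrite (le_trans (dot_CS _ _)) // x0 mul0r.
have [u0|un0] := eqVneq (dot u u) 0.
  by under eq_fun do rewrite (deg u) // mul0r expr0n; rewrite mean_cst u0 mulr0 mul0r.
have [v0|vn0] := eqVneq (dot v v) 0.
  by under eq_fun do rewrite (deg v) // mulr0 expr0n; rewrite mean_cst v0 mulr0.
have up : 0 < dot u u by rewrite lt_def un0 dot_ge0.
have vp : 0 < dot v v by rewrite lt_def vn0 dot_ge0.
(* This weight balances the two terms of the arithmetic-geometric inequality, so that two
   fourth-moment bounds combine into the product |u|^2 |v|^2. *)
pose t := dot v v / dot u u; have t0 : 0 < t by rewrite divr_gt0.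
apply: (@le_trans _ _ (mean P (fun w => t / 2 * dot u (X w) ^+ 4
    + t^-1 / 2 * dot v (X w) ^+ 4))).
  apply: mean_le => // [|w]; first by apply: rintD; exact: rintZ.
  rewrite exprMn (exprM (dot u _) 2 2) (exprM (dot v _) 2 2).
  move: (dot u (X w) ^+ 2) (dot v (X w) ^+ 2) => x y.
  have : 0 <= t^-1 / 2 * (t * x - y) ^+ 2 by rewrite mulr_ge0 ?sqr_ge0 // divr_ge0 // invr_ge0 ltW.
  suff -> : t^-1 / 2 * (t * x - y) ^+ 2 = t / 2 * x ^+ 2 + t^-1 / 2 * y ^+ 2 - x * y.
    by rewrite subr_ge0.
  by field; rewrite gt_eqF.
rewrite meanD ?meanZ //; try exact: rintZ.
apply: (@le_trans _ _ (t / 2 * (C ^+ 4 * dot u u ^+ 2) + t^-1 / 2 * (C ^+ 4 * dot v v ^+ 2))).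
  by apply: lerD; rewrite ler_wpM2l // divr_ge0 // ?invr_ge0 ltW.
rewrite le_eqVlt; apply/orP; left; apply/eqP; rewrite /t; field.
by rewrite un0 vn0.
Qed.

End isotropic_moments.

Lemma independent_comp d (Omega : measurableType d) (R : realType)
    (P : probability Omega R) d1 (V : measurableType d1) d2 (W : measurableType d2)
    d3 (V' : measurableType d3) d4 (W' : measurableType d4)
    (X : Omega -> V) (Y : Omega -> W) (f : V -> V') (g : W -> W') :
  measurable_fun setT f -> measurable_fun setT g ->
  independent P X Y -> independent P (f \o X) (g \o Y).
Proof.
move=> mf mg XY A B mA mB.
by apply: (XY (f @^-1` A) (g @^-1` B)); rewrite -[X in measurable X]setTI; [exact: mf | exact: mg].
Qed.

Lemma measurable_fun_dot d (S : measurableType d) (R : realType) p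
    (f g : S -> 'rV[R]_p) :
  measurable_fun setT f -> measurable_fun setT g ->
  measurable_fun setT (fun s => dot (f s) (g s)).
Proof.
move=> mf mg; rewrite /dot; apply: measurable_sum => a.
apply: measurable_funM.
  exact: (measurableT_comp (measurable_entry 0 a) mf).
exact: (measurableT_comp (measurable_entry 0 a) mg).
Qed.

Section residual_moments.
Context d (Omega : measurableType d) (R : realType) (P : probability Omega R).
Context (p : nat) (X : Omega -> 'rV[R]_p) (Z : Omega -> R) (s4 C sigma : R).
Hypotheses (mX : measurable_fun setT X) (mZ : measurable_fun setT Z).
Hypotheses (XZ : independent P X Z) (isoX : isotropic P X).
Hypotheses (hypX : hypercontractive42 P X s4) (s4C : s4 <= C).
Hypotheses (Z1 : ('E_P[Z] = 0)%E)
  (Z2 : ('E_P[fun w => (Z w ^+ 2)%R] = (sigma ^+ 2)%:E)%E).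

(** With D = mu - b this is the component along th of a debiased point minus mu, because the
    response minus its prediction by b is x^T D + z. *)
Definition residual (D th : 'rV[R]_p) (w : Omega) : R :=
  (dot D (X w) + Z w) * dot th (X w) - dot D th.

Lemma measurable_residual D th : measurable_fun setT (residual D th).
Proof.
apply: measurable_funB => //; apply: measurable_funM.
  by apply: measurable_funD => //; exact: measurable_dot.
exact: measurable_dot.
Qed.

Lemma noise_sqr : rint P (fun w => Z w ^+ 2) /\ mean P (fun w => Z w ^+ 2) = sigma ^+ 2.
Proof.
move: Z2; rewrite unlock => h; split; last by rewrite /mean h.
apply: rint_ge0 => [|w|]; [exact: measurable_funX | exact: sqr_ge0 | by rewrite h ltry].
Qed.

Lemma noise_mean : rint P Z /\ mean P Z = 0.
Proof.
split; first by apply: rint_sqr => //; have [] := noise_sqr.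
by move: Z1; rewrite unlock /mean => ->.
Qed.

Lemma noise_mul (f : 'rV[R]_p -> R) : measurable_fun setT f ->
  rint P (fun w => f (X w)) ->
  rint P (fun w => Z w * f (X w)) /\ mean P (fun w => Z w * f (X w)) = 0.
Proof.
move=> mf hf; have [iZ mZ0] := noise_mean.
have ind : independent P (fun w => f (X w)) Z by exact: (independent_comp mf (@measurable_id _ R setT) XZ).
rewrite (_ : (fun w => _) = fun w => f (X w) * Z w); last by apply/funext => w; rewrite mulrC.
split; first exact: independent_rintM.
by rewrite independent_meanM // mZ0 mulr0.
Qed.

Lemma noise_sqr_mul th :
  rint P (fun w => (Z w * dot th (X w)) ^+ 2) /\
  mean P (fun w => (Z w * dot th (X w)) ^+ 2) = sigma ^+ 2 * dot th th.
Proof.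
have [iZ mZ2] := noise_sqr; have [id md] := mean_dot_sqr mX isoX th.
have ind : independent P (fun w => dot th (X w) ^+ 2) (fun w => Z w ^+ 2).
  apply: (independent_comp (f := fun x => dot th x ^+ 2) (g := fun z : R => z ^+ 2) _ _ XZ).
    apply: measurable_funX; apply: measurable_fun_dot => //.
  exact: measurable_funX.
rewrite (_ : (fun w => _) = fun w => dot th (X w) ^+ 2 * Z w ^+ 2); last first.
  by apply/funext => w; rewrite exprMn mulrC.
split; first exact: independent_rintM.
by rewrite independent_meanM // md mZ2 mulrC.
Qed.

Lemma mean_residual D th : rint P (residual D th) /\ mean P (residual D th) = 0.
Proof.
have [i1 m1] := mean_dotM mX isoX D th.
have [i2 m2] : rint P (fun w => Z w * dot th (X w)) /\ mean P (fun w => Z w * dot th (X w)) = 0.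
  apply: (noise_mul (f := fun x => dot th x)); first exact: measurable_fun_dot.
  exact: rint_dot.
have i3 := rint_cst P (- dot D th).
rewrite (_ : residual D th = fun w => dot D (X w) * dot th (X w) +
   (Z w * dot th (X w) + - dot D th)); last first.
  by apply/funext => w; rewrite /residual mulrDl addrA.
split; first by do 2![apply: rintD => //].
rewrite !meanD //; last exact: rintD.
by rewrite m1 m2 mean_cst add0r subrr.
Qed.

Lemma mean_residual_sqr D th :
  rint P (fun w => residual D th w ^+ 2) /\
  mean P (fun w => residual D th w ^+ 2)
    <= (C ^+ 4 * dot D D + sigma ^+ 2) * dot th th.
Proof.
pose A w := dot D (X w) * dot th (X w).
have [i1 m1] := mean_dotM mX isoX D th; rewrite -/(A _) in i1 m1.
have [i2 m2] := mean_dot22 mX isoX hypX s4C D th.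
have [i3 m3] := noise_sqr_mul th.
pose c := dot D th.
have iAc : rint P (fun w => (A w - c) ^+ 2) /\ mean P (fun w => (A w - c) ^+ 2) <=
    C ^+ 4 * dot D D * dot th th.
  rewrite (_ : (fun w => _) = fun w => A w ^+ 2 + ((- 2 * c) * A w + c ^+ 2)); last first.
    by apply/funext => w; ring.
  have h1 := rint_cst P (c ^+ 2).
  have h2 : rint P (fun w => (- 2 * c) * A w) by exact: rintZ.
  split; first by apply: rintD => //; exact: rintD.
  rewrite !meanD //; last exact: rintD.
  rewrite meanZ // mean_cst (_ : mean P A = c) //.
  by have := sqr_ge0 c; move: m2; rewrite -/(A _); lra.
have [i4 m4] := iAc.
have [i5 m5] : rint P (fun w => Z w * (dot th (X w) * (A w - c))) /\
    mean P (fun w => Z w * (dot th (X w) * (A w - c))) = 0.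
  apply: (noise_mul (f := fun x => dot th x * (dot D x * dot th x - c))).
    apply: measurable_funM; first exact: measurable_fun_dot.
    apply: measurable_funB => //; apply: measurable_funM; exact: measurable_fun_dot.
  apply: rint_sqrM => //.
  - exact: measurable_dot.
  - apply: measurable_funB => //; apply: measurable_funM; exact: measurable_dot.
  - by have [] := mean_dot_sqr mX isoX th.
(* The cross term is linear in the independent centred noise and averages to zero, leaving the
   variance of A and the pure noise term. *)
rewrite (_ : (fun w => _) = fun w => (A w - c) ^+ 2 +
   (2 * (Z w * (dot th (X w) * (A w - c))) + (Z w * dot th (X w)) ^+ 2)); last first.
  by apply/funext => w; rewrite /residual /A /c; ring.
have i6 : rint P (fun w => 2 * (Z w * (dot th (X w) * (A w - c)))) by exact: rintZ.
split; first by apply: rintD => //; exact: rintD.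
rewrite !meanD //; last exact: rintD.
by rewrite meanZ // m5 m3; lra.
Qed.

End residual_moments.

(** * Bucket means of the debiased sample *)

Section sample_measurability.
Context (R : realType) (p n k : nat).

Definition debias_point (b : 'rV[R]_p) (xy : 'rV[R]_p * R) : 'rV[R]_p :=
  b + (xy.2 - dot xy.1 b) *: xy.1.

Lemma tnth_debias b (t : n.-tuple ('rV[R]_p * R)) i :
  tnth (debias b t) i = debias_point b (tnth t i).
Proof. by rewrite tnth_map. Qed.

Lemma measurable_debias_point d (S : measurableType d) (b : S -> 'rV[R]_p)
    (xy : S -> 'rV[R]_p * R) :
  measurable_fun setT b -> measurable_fun setT xy ->
  measurable_fun setT (fun s => debias_point (b s) (xy s)).
Proof.
move=> mb mxy.
have mx : measurable_fun setT (fun s => (xy s).1) by exact: measurableT_comp.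
have my : measurable_fun setT (fun s => (xy s).2) by exact: measurableT_comp.
have me (f : S -> 'rV[R]_p) (mf : measurable_fun setT f) i j :
    measurable_fun setT (fun s => f s i j).
  exact: (measurableT_comp (measurable_entry i j) mf).
apply: measurable_fun_mx => i j.
rewrite (_ : (fun s => _) = fun s => b s i j +
  ((xy s).2 - dot (xy s).1 (b s)) * (xy s).1 i j); last first.
  by apply/funext => s; rewrite !mxE.
apply: measurable_funD; first exact: me.
apply: measurable_funM; last exact: me.
by apply: measurable_funB => //; exact: measurable_fun_dot.
Qed.

Lemma measurable_bucket_means d (S : measurableType d) (s : 'S_n)
    (b : S -> 'rV[R]_p) (t : S -> n.-tuple ('rV[R]_p * R)) :
  measurable_fun setT b -> measurable_fun setT t ->
  measurable_fun setT (fun w => bucket_means k s (debias (b w) (t w))).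
Proof.
move=> mb mt; apply/measurable_fun_tnthP => j.
apply: measurable_fun_mx => i a.
rewrite (_ : (fun w => _) = fun w => (n %/ k)%:R^-1 *
   \sum_(l < n | (l %/ (n %/ k) == j)%N) debias_point (b w) (tnth (t w) (s l)) i a).
  apply: measurable_funM => //.
  rewrite (_ : (fun w => _) = fun w => \sum_(l < n)
     if (l %/ (n %/ k) == j)%N then debias_point (b w) (tnth (t w) (s l)) i a else 0).
    apply: measurable_sum => l; case: (l %/ (n %/ k) == j)%N => //.
    have ml : measurable_fun setT (fun w => tnth (t w) (s l)).
      by move/measurable_fun_tnthP : mt => /(_ (s l)).
    exact: (measurableT_comp (measurable_entry i a) (measurable_debias_point mb ml)).
  by apply/funext => w; rewrite big_mkcond.
apply/funext => w; rewrite /= tnth_mktuple mxE summxE; congr (_ * _).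
by apply: eq_bigr => l _; rewrite tnth_debias.
Qed.

End sample_measurability.

Lemma mutually_independent_comp d (Omega : measurableType d) (R : realType)
    (P : probability Omega R) d1 (V : measurableType d1) d2 (W : measurableType d2)
    n (X : 'I_n -> Omega -> V) (f : V -> W) :
  measurable_fun setT f -> mutually_independent P X ->
  mutually_independent P (fun i => f \o X i).
Proof.
move=> mf hX J B mB; apply: (hX J (fun i => f @^-1` B i)) => i.
by rewrite -[X in measurable X]setTI; exact: mf.
Qed.

Lemma mutually_independent_pair d (Omega : measurableType d) (R : realType)
    (P : probability Omega R) d1 (V : measurableType d1) n
    (X : 'I_n -> Omega -> V) i j :
  mutually_independent P X -> (forall i, measurable_fun setT (X i)) -> i != j ->
  independent P (X i) (X j).
Proof.
move=> hX mX ij A B mA mB.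
have mp l (E : set V) : measurable E -> measurable (X l @^-1` E).
  by move=> mE; rewrite -[Y in measurable Y]setTI; exact: mX.
have mAB l : measurable (if l == i then A else B) by case: ifP.
have := hX [set i; j]%SET _ mAB.
have ji : (j == i) = false by rewrite eq_sym (negbTE ij).
rewrite big_setU1 ?inE //= big_set1 eqxx ji EFinM.
rewrite !fineK; [|exact: fin_num_measure (mp j B mB)|exact: fin_num_measure (mp i A mA)].
move=> <-.
congr (P _); apply/seteqP; split=> w /=.
  by move=> [hA hB] l; rewrite /= !inE => /orP[]/eqP ->; rewrite ?eqxx ?ji.
move=> h; split; first by have := h i; rewrite /= eqxx; apply; rewrite !inE eqxx.
by have := h j; rewrite /= ji; apply; rewrite !inE eqxx orbT.
Qed.

Lemma card_block n m k j : (0 < m)%N -> (k * m <= n)%N -> (j < k)%N ->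
  #|[set i : 'I_n | (i %/ m == j)%N]%SET| = m.
Proof.
move=> m0 kmn jk.
have lt (r : 'I_m) : (j * m + r < n)%N.
  apply: leq_trans kmn; apply: (@leq_trans (j.+1 * m)%N); last by rewrite leq_pmul2r.
  by rewrite mulSn addnC ltn_add2r.
have finj : injective (fun r : 'I_m => Ordinal (lt r)).
  by move=> r r' /(congr1 val) /= /addnI /val_inj.
rewrite -[RHS](card_ord m) -(card_imset _ finj); apply: eq_card => i; rewrite inE.
apply/eqP/imsetP => [ij|[r _ ->]] /=.
  by exists (Ordinal (ltn_pmod i m0)) => //; apply/val_inj; rewrite /= -ij -divn_eq.
by rewrite divnMDl // divn_small // addn0.
Qed.

Lemma card_bucket n k (j : 'I_k) : (0 < n %/ k)%N ->
  #|[set i : 'I_n | (i %/ (n %/ k) == j)%N]%SET| = (n %/ k)%N.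
Proof. by move=> m0; apply: (card_block m0 _ (ltn_ord j)); rewrite mulnC leq_divM. Qed.

Definition bucket_dev (R : realType) p n k (s : 'S_n) (mu b : 'rV[R]_p)
    (t : n.-tuple ('rV[R]_p * R)) (j : 'I_k) : 'rV[R]_p :=
  tnth (bucket_means k s (debias b t)) j - mu.

Lemma bucket_devE (R : realType) p n k (s : 'S_n) (mu b : 'rV[R]_p) t (j : 'I_k) :
  (0 < n %/ k)%N ->
  bucket_dev s mu b t j = (n %/ k)%:R^-1 *:
    \sum_(i in [set i : 'I_n | (i %/ (n %/ k) == j)%N]%SET)
      (debias_point b (tnth t (s i)) - mu).
Proof.
move=> m0; rewrite /bucket_dev tnth_mktuple sumrB scalerBr sumr_const.
rewrite card_bucket //.
rewrite -[mu *+ _]scaler_nat scalerA mulVf ?pnatr_eq0 -?lt0n // scale1r.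
congr (_ *: _ - _); apply: eq_big => [i|i _]; first by rewrite inE.
by rewrite tnth_debias.
Qed.

Definition block (n k : nat) (s : 'S_n) (j : 'I_k) : {set 'I_n} :=
  s @: [set i : 'I_n | (i %/ (n %/ k) == j)%N]%SET.

Lemma disjoint_block n k (s : 'S_n) (i j : 'I_k) : i != j ->
  [disjoint block s i & block s j]%B.
Proof.
move=> ij; rewrite -setI_eq0 -imsetI; last by move=> ? ? _ _; exact: perm_inj.
rewrite (_ : _ :&: _ = finset.set0) ?imset0 //; apply/setP => l; rewrite !inE.
apply/negbTE; apply: contra ij => /andP[/eqP h1 /eqP h2].
by apply/eqP/val_inj; rewrite /= -h1 -h2.
Qed.

(** A bucket sees only the points of its block, so distinct buckets are functions of disjoint masked
    subfamilies. *)
Lemma bucket_dev_mask (R : realType) p n k (s : 'S_n) (mu b : 'rV[R]_p) t (j : 'I_k) :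
  (0 < n %/ k)%N ->
  bucket_dev s mu b (mask_tuple (block s j) t) j = bucket_dev s mu b t j.
Proof.
move=> m0; rewrite !bucket_devE //; congr (_ *: _); apply: eq_bigr => i.
by move=> hi; rewrite tnth_mktuple imset_f.
Qed.

(** * Exponential moment of the number of heavy buckets *)

Section linear_model.
Context (R : realType) (n p k : nat) (C K sigma s4 : R).
Context d (Omega : measurableType d) (P : probability Omega R).
Context (mu : 'rV[R]_p) (x : 'I_n -> Omega -> 'rV[R]_p) (z : 'I_n -> Omega -> R).
Hypotheses (mx : forall i, measurable_fun setT (x i))
  (mz : forall i, measurable_fun setT (z i))
  (indep : mutually_independent P (fun i w => (x i w, z i w)))
  (xz : forall i, independent P (x i) (z i))
  (iso : forall i, isotropic P (x i))
  (hyp : forall i, hypercontractive42 P (x i) s4) (s4C : s4 <= C)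
  (z1 : forall i, ('E_P[z i] = 0)%E)
  (z2 : forall i, ('E_P[fun w => (z i w ^+ 2)%R] = (sigma ^+ 2)%:E)%E).
Hypothesis m_gt0 : (0 < n %/ k)%N.

Let S := linear_sample mu x z.
Let W i w := (x i w, dot (x i w) mu + z i w).

Lemma measurable_sample_point i : measurable_fun setT (W i).
Proof.
apply: measurable_fun_pair => //; apply: measurable_funD => //.
exact: measurable_fun_dot.
Qed.

Lemma sample_independent : mutually_independent P W.
Proof.
apply: (mutually_independent_comp (f := fun xz : 'rV[R]_p * R => (xz.1, dot xz.1 mu + xz.2)) _ indep).
apply: measurable_fun_pair => //; apply: measurable_funD => //.
exact: measurable_fun_dot.
Qed.

Lemma dot_bucket_dev s b th (j : 'I_k) w :
  dot th (bucket_dev s mu b (S w) j) = (n %/ k)%:R^-1 *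
    \sum_(i in [set i : 'I_n | (i %/ (n %/ k) == j)%N]%SET)
      residual (x (s i)) (z (s i)) (mu - b) th w.
Proof.
rewrite bucket_devE // dotZr dot_sumr; congr (_ * _); apply: eq_bigr => i _.
rewrite tnth_mktuple /debias_point /residual /=.
rewrite !(dotDr, dotDl, dotZr, dotNr, dotNl) (dotC (x _ w) mu) (dotC (x _ w) b).
by rewrite (dotC mu th) (dotC b th); ring.
Qed.

(** The first summand pays, through fourth moments of the covariates, for an estimator at distance K
    sigma; the second pays for the noise. *)
Definition bucket_var : R := (C ^+ 4 * K ^+ 2 + 1) * sigma ^+ 2 / (n %/ k)%:R.

Section fixed_estimator.
Context (s : 'S_n) (b : 'rV[R]_p).
Hypothesis b_near : dot (mu - b) (mu - b) <= K ^+ 2 * sigma ^+ 2.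

Lemma mean_dot_bucket_dev th (j : 'I_k) :
  rint P (fun w => dot th (bucket_dev s mu b (S w) j) ^+ 2) /\
  mean P (fun w => dot th (bucket_dev s mu b (S w) j) ^+ 2) <= bucket_var * dot th th.
Proof.
pose U i := residual (x (s i)) (z (s i)) (mu - b) th.
pose e := (C ^+ 4 * dot (mu - b) (mu - b) + sigma ^+ 2) * dot th th.
have [|||||iU mU] := @mean_sqr_sum _ _ _ P n
  [set i : 'I_n | (i %/ (n %/ k) == j)%N]%SET U e.
- by move=> i; exact: measurable_residual.
- move=> i.
  by have [] := mean_residual_sqr (mx (s i)) (mz (s i)) (xz (s i)) (iso (s i))
     (hyp (s i)) s4C (z1 (s i)) (z2 (s i)) (mu - b) th.
- move=> i; by have [] := mean_residual (mx (s i)) (mz (s i)) (xz (s i)) (iso (s i))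
     (z1 (s i)) (z2 (s i)) (mu - b) th.
- move=> i.
  by have [] := mean_residual_sqr (mx (s i)) (mz (s i)) (xz (s i)) (iso (s i))
     (hyp (s i)) s4C (z1 (s i)) (z2 (s i)) (mu - b) th.
- move=> i l il.
  have sil : s i != s l by rewrite (inj_eq perm_inj).
  have mphi : measurable_fun setT (fun xz : 'rV[R]_p * R =>
      (dot (mu - b) xz.1 + xz.2) * dot th xz.1 - dot (mu - b) th).
    apply: measurable_funB => //; apply: measurable_funM; last exact: measurable_fun_dot.
    by apply: measurable_funD => //; exact: measurable_fun_dot.
  have mxz l' : measurable_fun setT (fun w => (x l' w, z l' w)) by exact: measurable_fun_pair.
  exact: (independent_comp mphi mphi (mutually_independent_pair indep mxz sil)).
rewrite card_bucket // in mU.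
have mR : 0 < (n %/ k)%:R :> R by rewrite ltr0n.
under eq_fun do rewrite dot_bucket_dev exprMn.
split; first exact: rintZ.
rewrite meanZ //.
apply: (@le_trans _ _ ((n %/ k)%:R^-1 ^+ 2 * ((n %/ k)%:R * e))).
  by rewrite ler_wpM2l // sqr_ge0.
rewrite (_ : _ * (_ * e) = e / (n %/ k)%:R); last by field; rewrite gt_eqF.
have -> : bucket_var * dot th th =
    (C ^+ 4 * K ^+ 2 + 1) * sigma ^+ 2 * dot th th / (n %/ k)%:R.
  by rewrite /bucket_var mulrAC.
rewrite ler_pM2r ?invr_gt0 // /e ler_wpM2r ?dot_ge0 //.
rewrite mulrDl mul1r lerD2r -mulrA ler_wpM2l //.
by rewrite (exprM C 2 2) sqr_ge0.
Qed.

Lemma mean_norm_bucket_dev (j : 'I_k) :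
  rint P (fun w => dot (bucket_dev s mu b (S w) j) (bucket_dev s mu b (S w) j)) /\
  mean P (fun w => dot (bucket_dev s mu b (S w) j) (bucket_dev s mu b (S w) j))
    <= p%:R * bucket_var.
Proof.
have E w : dot (bucket_dev s mu b (S w) j) (bucket_dev s mu b (S w) j) =
  \sum_a dot (delta_mx 0 a) (bucket_dev s mu b (S w) j) ^+ 2.
  by apply: eq_bigr => a _; rewrite dotC dot_delta expr2.
under eq_fun do rewrite E.
have h a := mean_dot_bucket_dev (delta_mx 0 a) j.
split; first by apply: rint_sum => a _; have [] := h a.
rewrite mean_sum => [|a]; last by have [] := h a.
rewrite mulr_natl -[X in _ *+ X](card_ord p) -sumr_const; apply: ler_sum => a _.
by have [_] := h a; rewrite dot_delta mxE !eqxx mulr1.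
Qed.

Lemma measurable_set_lt d' (T : measurableType d') (f : T -> R) (c : R) :
  measurable_fun setT f -> measurable [set w | c < f w].
Proof.
move=> mf; rewrite (_ : [set w | _] = f @^-1` `]c, +oo[%classic).
  by rewrite -[X in measurable X]setTI; apply: mf => //; exact: measurable_itv.
by apply/seteqP; split=> w /=; rewrite in_itv /= andbT.
Qed.

Lemma measurable_heavy d' (T : measurableType d') (f : T -> 'I_k -> 'rV[R]_p) Q2 e (j : 'I_k) :
  measurable_fun setT (fun w => f w j) -> measurable [set w | heavy (f w) Q2 e j].
Proof.
move=> mf; set D := dot (sign_vec R e) (sign_vec R e) <= 8 * (1 + p%:R / k%:R).
rewrite (_ : [set w | _] =
  ([set w | Q2 / 4 < dot (sign_vec R e) (f w j) ^+ 2] `&` [set w | D])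
  `|` [set w | k%:R * Q2 / 16 < dot (f w j) (f w j)]).
  apply: measurableU.
    apply: measurableI.
      by apply: measurable_set_lt; apply: measurable_funX; exact: measurable_fun_dot.
    by case: D; [rewrite (_ : [set w | _] = setT) | rewrite (_ : [set w | _] = set0)] => //; apply/seteqP; split.
  by apply: measurable_set_lt; exact: measurable_fun_dot.
apply/seteqP; split=> w /=; rewrite /heavy -/D.
  by case/orP => [/andP[h1 h2]|h]; [left|right].
by case=> [[h1 h2]|h]; apply/orP; [left; apply/andP|right].
Qed.

Lemma measurable_sample : measurable_fun setT S.
Proof.
apply/measurable_fun_tnthP => i; have := measurable_sample_point i.
by apply: eq_measurable_fun => w _; rewrite /= tnth_mktuple.
Qed.

Lemma measurable_bucket_dev d' (T : measurableType d') (f : T -> 'rV[R]_p)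
    (t : T -> n.-tuple ('rV[R]_p * R)) (j : 'I_k) :
  measurable_fun setT f -> measurable_fun setT t ->
  measurable_fun setT (fun w => bucket_dev s mu (f w) (t w) j).
Proof.
move=> mf mt; apply: measurable_fun_mx => i a.
have /measurable_fun_tnthP/(_ j) mb := @measurable_bucket_means R p n k _ T s f t mf mt.
rewrite (_ : (fun w => _) = fun w => tnth (bucket_means k s (debias (f w) (t w))) j i a - mu i a).
  by apply: measurable_funB => //; exact: (measurableT_comp (measurable_entry i a) mb).
by apply/funext => w; rewrite /bucket_dev !mxE.
Qed.

Lemma bucket_var_ge0 : 0 <= bucket_var.
Proof.
rewrite /bucket_var divr_ge0 // mulr_ge0 ?sqr_ge0 //.
by rewrite addr_ge0 // mulr_ge0 ?sqr_ge0 // (exprM C 2 2) sqr_ge0.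
Qed.

Section threshold.
Context (c : R).
Hypotheses (c_gt0 : 0 < c) (k_gt0 : (0 < k)%N).

(** The 32 is 4 * 8: a quarter of the threshold equals [c * bucket_var] times the cap on the squared
    norm in [heavy]. Since k/16 times the threshold is at least [c * p * bucket_var], each of the
    two ways of being heavy has probability at most 1/c by Markov's inequality. *)
Definition threshold : R := 32 * c * bucket_var * (1 + p%:R / k%:R).

Lemma prob_heavy e (j : 'I_k) :
  (P [set w | heavy (bucket_dev s mu b (S w)) threshold e j] <= (2 / c)%:E)%E.
Proof.
have kR : 0 < k%:R :> R by rewrite ltr0n.
have v0 := bucket_var_ge0.
have pR : 0 <= p%:R :> R by [].
have [i1 m1] := mean_dot_bucket_dev (sign_vec R e) j.
have [i2 m2] := mean_norm_bucket_dev j.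
pose th := sign_vec R e.
pose B1 := [set w | c * (bucket_var * dot th th) < dot th (bucket_dev s mu b (S w) j) ^+ 2].
pose B2 := [set w | c * (p%:R * bucket_var) <
   dot (bucket_dev s mu b (S w) j) (bucket_dev s mu b (S w) j)].
have mB1 : measurable B1 by apply: measurable_set_lt; exact: rint_measurable i1.
have mB2 : measurable B2 by apply: measurable_set_lt; exact: rint_measurable i2.
apply: (@le_trans _ _ (P (B1 `|` B2))).
  apply: le_measure; rewrite ?inE //.
  - by apply: measurable_heavy; apply: measurable_bucket_dev => //; exact: measurable_sample.
  - exact: measurableU.
  move=> w /= /orP[/andP[h1 h2]|h]; [left|right]; rewrite /B1 /B2 /=.
    apply: le_lt_trans h1; rewrite /threshold -/th in h2 *.
    have : c * bucket_var * dot th th <= c * bucket_var * (8 * (1 + p%:R / k%:R)).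
      by rewrite ler_wpM2l // mulr_ge0 // ltW.
    lra.
  apply: le_lt_trans h; rewrite /threshold.
  rewrite (_ : k%:R * _ / 16 = 2 * (c * bucket_var) * (k%:R + p%:R)); last by field; rewrite gt_eqF.
  have : 0 <= c * bucket_var by rewrite mulr_ge0 // ltW.
  nra.
apply: le_trans; first exact: measureU2.
rewrite mulr_natl mulr2n EFinD leeD //; apply: prob_gt => //.
- by move=> w; exact: sqr_ge0.
- by rewrite mulr_ge0 // dot_ge0.
- by move=> w; exact: dot_ge0.
- by rewrite mulr_ge0.
Qed.

Lemma prob_heavy_bigcap e (J : {set 'I_k}) :
  (P [set w | forall j, j \in J -> heavy (bucket_dev s mu b (S w)) threshold e j]
   <= ((2 / c) ^+ #|J|)%:E)%E.
Proof.
pose E (j : 'I_k) := [set t | heavy (bucket_dev s mu b t) threshold e j].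
have EE (j : 'I_k) : masked W (block s j) @^-1` E j =
    [set w | heavy (bucket_dev s mu b (S w)) threshold e j].
  apply/seteqP; split=> w; rewrite /= /heavy -(bucket_dev_mask s mu b (S w)) //;
  rewrite (_ : mask_tuple _ _ = masked W (block s j) w) //;
  by apply/eq_from_tnth => i; rewrite !tnth_mktuple.
have := @masked_bigcap_le _ _ _ P _ _ _ W measurable_sample_point sample_independent
  k (fun j => block s j) E (2 / c) _ _ _ _ J.
rewrite (_ : \bigcap_(j in _) _ =
    [set w | forall j, j \in J -> heavy (bucket_dev s mu b (S w)) threshold e j]); last first.
  apply/seteqP; split=> w h j jJ; have := h j jJ; first by rewrite EE.
  by rewrite -[X in X -> _]/([set w | heavy (bucket_dev s mu b (S w)) threshold e j] w) -EE.
apply.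
- by move=> i j ij; exact: disjoint_block.
- move=> j; apply: measurable_heavy; apply: measurable_bucket_dev => //.
- by rewrite divr_ge0 // ltW.
- by move=> j; rewrite EE; exact: prob_heavy.
Qed.

End threshold.
End fixed_estimator.

Section random_estimator.
Context (s : 'S_n) (beta1 : Omega -> 'rV[R]_p) (lam : R).
Hypotheses (mbeta1 : measurable_fun setT beta1) (indb : independent P beta1 S).
Hypothesis b_near : {ae P, forall w, l2norm (beta1 w - mu) <= K * sigma}.
Hypotheses (lam_gt0 : 0 < lam) (k_gt0 : (0 < k)%N).

Let c := 4 * expR lam.
Let dev w := bucket_dev (k := k) s mu (beta1 w) (S w).

Let heavy_event e (J : {set 'I_k}) :=
  [set w | forall j, j \in J -> heavy (dev w) (threshold c) e j].

Lemma measurable_heavy_event e (J : {set 'I_k}) : measurable (heavy_event e J).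
Proof.
rewrite (_ : heavy_event e J = \bigcap_(j in [set` J]) [set w | heavy (dev w) (threshold c) e j]) //.
apply: fin_bigcap_measurable => // j _.
by apply: measurable_heavy; apply: measurable_bucket_dev => //; exact: measurable_sample.
Qed.

Lemma prob_heavy_event e (J : {set 'I_k}) : (P (heavy_event e J) <= ((2 / c) ^+ #|J|)%:E)%E.
Proof.
have c0 : 0 < c by rewrite mulr_gt0 // expR_gt0.
pose F := [set u : 'rV[R]_p * n.-tuple ('rV[R]_p * R) |
  forall j, j \in J -> heavy (bucket_dev (k := k) s mu u.1 u.2) (threshold c) e j].
apply: (@independent_section_le _ _ _ P _ _ _ _ beta1 S mbeta1 measurable_sample indb F
  [set b | l2norm (b - mu) <= K * sigma]) => //.
- rewrite (_ : F = \bigcap_(j in [set` J]) [set u | heavy (bucket_dev s mu u.1 u.2) (threshold c) e j]) //.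
  apply: fin_bigcap_measurable => // j _.
  by apply: measurable_heavy; apply: measurable_bucket_dev.
- by rewrite lee_fin exprn_ge0 // divr_ge0 // ltW.
- move=> v /= hv; apply: prob_heavy_bigcap => //.
  have := hv; rewrite l2normE => hv'.
  have Ks : 0 <= K * sigma by apply: le_trans hv'; exact: sqrtr_ge0.
  rewrite -exprMn (_ : dot (mu - v) (mu - v) = dot (v - mu) (v - mu)).
    by rewrite -[leLHS]sqr_sqrtr ?dot_ge0 // ler_pXn2r // nnegrE // sqrtr_ge0.
  by rewrite -(opprB v mu) dotNl dotNr opprK.
Qed.

Let t := expR lam - 1.

(** Since exp(lam h) = 1 + t h for h in {0, 1}, the exponential is a product that expands over sets
    J of jointly heavy buckets; the product rule for events bounds each term. *)
Lemma light_expansion w :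
  sign_mean (fun=> 0) (fun e : {ffun 'I_p * 'I_k -> bool} =>
     expR (lam * \sum_j (heavy (dev w) (threshold c) e j)%:R)) =
  \sum_e \sum_(J : {set 'I_k}) sign_law (fun=> 0) e * t ^+ #|J| * \1_(heavy_event e J) w.
Proof.
apply: eq_bigr => e _; rewrite mulr_sumr expR_sum.
rewrite (eq_bigr (fun j => t * (heavy (dev w) (threshold c) e j)%:R + 1)); last first.
  by move=> j _; rewrite /t; case: heavy; rewrite ?mulr1 ?mulr0 ?expR0; ring.
rewrite bigA_distr mulr_sumr; apply: eq_bigr => J _.
rewrite -mulrA; congr (_ * _); rewrite -big_mkcond /= big_split /= prodr_const.
congr (_ * _); rewrite indicE; case: (boolP (w \in _)) => [|hw].
  by rewrite inE => hw; rewrite big1 // => j jJ; rewrite hw.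
apply/eqP; rewrite prodf_seq_eq0; apply/hasP.
have [j jJ hj] : exists2 j, j \in J & ~~ heavy (dev w) (threshold c) e j.
  apply: contrapT => h; move/negP: hw; apply; rewrite inE => j jJ.
  by apply: contrapT => hj; apply: h; exists j => //; apply/negP.
by exists j; rewrite ?mem_index_enum // jJ (negbTE hj) eqxx.
Qed.

Lemma prob_not_light :
  measurable [set w | light (threshold c) lam (dev w)] /\
  (P (~` [set w | light (threshold c) lam (dev w)]) <= (expR (- (k%:R / 2)))%:E)%E.
Proof.
pose Z w := \sum_e \sum_(J : {set 'I_k})
  sign_law (fun=> 0) e * t ^+ #|J| * \1_(heavy_event e J) w : R.
have t0 : 0 <= t by rewrite /t subr_ge0 -expR0 ler_expR ltW.
have law0 (e : {ffun 'I_p * 'I_k -> bool}) : 0 <= sign_law (fun=> 0 : R) e.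
  by apply: sign_law_ge0 => i; rewrite normr0.
have i1 e (J : {set 'I_k}) : rint P (fun w => sign_law (fun=> 0) e * t ^+ #|J| * \1_(heavy_event e J) w).
  by apply: rintZ; have [] := mean_indic P (measurable_heavy_event e J).
have i2 e : rint P (fun w => \sum_(J : {set 'I_k})
    sign_law (fun=> 0) e * t ^+ #|J| * \1_(heavy_event e J) w) by exact: rint_sum.
have iZ : rint P Z by exact: rint_sum.
have mZ : mean P Z <= expR (k%:R / 2).
  apply: (@le_trans _ _ ((1 + t * (2 / c)) ^+ k)); last first.
    (* The choice c = 4 e^lam makes t * (2 / c) at most 1/2. The mean is then at most e^(k/2), and
       Markov's inequality at level e^k leaves probability e^(-k/2). *)
    have h : 1 + t * (2 / c) <= expR (2^-1).
      apply: le_trans (expR_ge1Dx _); rewrite lerD2l /t /c.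
      have e0 := expR_gt0 lam.
      rewrite mulrA ler_pdivrMr ?mulr_gt0 //; lra.
    rewrite expRM_natl lerXn2r // nnegrE ?expR_ge0 //.
    by rewrite addr_ge0 // mulr_ge0 // divr_ge0 // /c mulr_ge0 // expR_ge0.
  rewrite mean_sum // -[leRHS](sign_mean_cst (I := {: 'I_p * 'I_k}) (fun=> 0)).
  have -> : (1 + t * (2 / c)) ^+ k = \prod_(j < k) (t * (2 / c) + 1).
    by rewrite prodr_const card_ord addrC.
  apply: ler_sum => e _; rewrite mean_sum //.
  rewrite bigA_distr mulr_sumr; apply: ler_sum => J _.
  have [hi hP] := mean_indic P (measurable_heavy_event e J).
  rewrite meanZ // -mulrA ler_wpM2l // -big_mkcond /= prodr_const exprMn ler_wpM2l ?exprn_ge0 //.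
  by rewrite -lee_fin -hP; exact: prob_heavy_event.
have E : [set w | light (threshold c) lam (dev w)] = ~` [set w | expR k%:R < Z w].
  by apply/seteqP; split=> w /=; rewrite /light light_expansion -/(Z w) leNgt => /negP.
have mS : measurable [set w | expR k%:R < Z w].
  exact: measurable_set_lt (rint_measurable iZ).
rewrite E setCK; split; first exact: measurableC.
have Z0 w : 0 <= Z w.
  by apply: sumr_ge0 => e _; apply: sumr_ge0 => J _; rewrite !mulr_ge0 // exprn_ge0.
have := prob_gt Z0 iZ mZ (ltW (expR_gt0 _)) (expR_gt0 (k%:R / 2)).
by rewrite -expRD -expRN -splitr.
Qed.

End random_estimator.
End linear_model.

(** * Stability *)

Lemma sum_CS (R : realType) (I : finType) (A : {set I}) (f g : I -> R) :
  (\sum_(i in A) f i * g i) ^+ 2 <=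
  (\sum_(i in A) f i ^+ 2) * (\sum_(i in A) g i ^+ 2).
Proof.
apply: ge0_discr => [x|]; last by apply: sumr_ge0 => i _; exact: sqr_ge0.
rewrite !mulr_sumr -sumrB -big_split /=; apply: sumr_ge0 => i _.
by have := sqr_ge0 (g i - x * f i); lra.
Qed.

Section stability.
Context (R : realType) (p k : nat) (w : k.-tuple 'rV[R]_p) (mu : 'rV[R]_p).
Context (B : {set 'I_k}) (V : R).
Hypotheses (B_gt0 : (0 < #|B|)%N) (V_ge0 : 0 <= V).
Hypothesis BV : forall v,
  \sum_(j in B) dot v (tnth w j - mu) ^+ 2 <= V * #|B|%:R * dot v v.

Let BR : 0 < #|B|%:R :> R. Proof. by rewrite ltr0n. Qed.

(** The hypothesis [BV] is tested in the direction of the deviation itself, and Cauchy-Schwarz over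
    the buckets does the rest. *)
Lemma emp_mean_dev : l2norm (emp_mean w B - mu) <= Num.sqrt V.
Proof.
set h := emp_mean w B - mu.
have hE : h = #|B|%:R^-1 *: \sum_(j in B) (tnth w j - mu).
  rewrite /h /emp_mean sumrB scalerBr sumr_const -[mu *+ _]scaler_nat scalerA.
  by rewrite mulVf ?scale1r // gt_eqF.
rewrite l2normE ler_wsqrtr //.
have [->|h0] := eqVneq (dot h h) 0; first by [].
have hp : 0 < dot h h by rewrite lt_def h0 dot_ge0.
have E : #|B|%:R * dot h h = \sum_(j in B) 1 * dot h (tnth w j - mu).
  under eq_bigr do rewrite mul1r.
  by rewrite -dot_sumr {2}hE dotZr mulVKf // gt_eqF.
have := sum_CS B (fun=> 1) (fun j => dot h (tnth w j - mu)).
rewrite -E; under eq_bigr do rewrite expr1n.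
rewrite sumr_const => /le_trans/(_ (ler_wpM2l (ltW BR) (BV h))).
rewrite exprMn (_ : #|B|%:R * _ = #|B|%:R ^+ 2 * (V * dot h h)); last by ring.
by rewrite ler_pM2l ?exprn_gt0 // expr2 ler_pM2r.
Qed.

Lemma emp_cov_dot u v : dot (u *m emp_cov w B mu) v = #|B|%:R^-1 *
  \sum_(j in B) dot u (tnth w j - mu) * dot v (tnth w j - mu).
Proof.
rewrite /emp_cov -scalemxAr dotZl mulmx_sumr dotC dot_sumr; congr (_ * _).
apply: eq_bigr => j _; rewrite mulmxA.
rewrite (_ : u *m (tnth w j - mu)^T = (dot u (tnth w j - mu))%:M).
  by rewrite mul_scalar_mx dotZr.
by apply/rowP => a; rewrite !mxE !ord1 eqxx mulr1n; apply: eq_bigr => b _; rewrite !mxE.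
Qed.

Lemma emp_cov_norm v : dot (v *m emp_cov w B mu) (v *m emp_cov w B mu) <= V ^+ 2 * dot v v.
Proof.
set u := v *m emp_cov w B mu.
have [->|u0] := eqVneq (dot u u) 0; first by rewrite mulr_ge0 ?sqr_ge0 // dot_ge0.
have up : 0 < dot u u by rewrite lt_def u0 dot_ge0.
have := sum_CS B (fun j => dot v (tnth w j - mu)) (fun j => dot u (tnth w j - mu)).
have -> : \sum_(j in B) dot v (tnth w j - mu) * dot u (tnth w j - mu) = #|B|%:R * dot u u.
  by rewrite {2}/u emp_cov_dot mulVKf // gt_eqF.
move=> h; have := le_trans h (ler_pM _ _ (BV v) (BV u)).
move=> /(_ (sumr_ge0 _ _)) /(_ (sumr_ge0 _ _)) h'.
have {h'} : (#|B|%:R * dot u u) ^+ 2 <= V * #|B|%:R * dot v v * (V * #|B|%:R * dot u u).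
  by apply: h' => j _; exact: sqr_ge0.
rewrite exprMn (_ : V * _ * _ * _ = #|B|%:R ^+ 2 * (V ^+ 2 * dot v v * dot u u)); last by ring.
by rewrite ler_pM2l ?exprn_gt0 // expr2 ler_pM2r.
Qed.

(** Each of the two matrices has norm at most V, so no closeness between them is claimed: the factor
    2 is the triangle inequality. *)
Lemma emp_cov_opnorm : opnorm (emp_cov w B mu - V%:M) <= 2 * V.
Proof.
apply: ge_sup.
  by exists (l2norm (0 *m (emp_cov w B mu - V%:M))), 0 => //=; rewrite l2normE dot0l sqrtr0.
move=> _ [v /= hv <-].
have vv : dot v v <= 1.
  by rewrite -[leLHS]sqr_sqrtr ?dot_ge0 // -l2normE expr_le1 // l2normE sqrtr_ge0.
have V20 : 0 <= 2 * V by rewrite mulr_ge0.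
rewrite l2normE -[leRHS]ger0_norm // -sqrtr_sqr ler_wsqrtr //.
have hu := emp_cov_norm v.
rewrite mulmxBr mul_mx_scalar; set u := v *m _ in hu *.
have hV : V ^+ 2 * dot v v <= V ^+ 2 by rewrite ler_piMr ?sqr_ge0.
have := dot_ge0 (u + V *: v).
rewrite !(dotDl, dotDr, dotNl, dotNr, dotZl, dotZr) (dotC v u); lra.
Qed.

End stability.

(** An admissible subset keeps at least 3/4 of A and so 9/16 of all k points. More than half remain,
    which turns the bound per k into one per |B| with 2 L; the bound on the covariance is then
    weaker than sigma^2 / eps because eps <= 1/4. *)
Lemma removal_stable (R : realType) p k (w : k.-tuple 'rV[R]_p) (mu : 'rV[R]_p)
    (A : {set 'I_k}) (L eps : R) :
  (0 < k)%N -> 0 <= L -> 0 < eps -> eps <= 4^-1 -> k%:R - #|A|%:R <= 4^-1 * k%:R :> R ->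
  (forall v, \sum_(j in A) dot v (tnth w j - mu) ^+ 2 <= L * k%:R * dot v v) ->
  stable w A eps 1 mu (Num.sqrt (2 * L)).
Proof.
move=> k0 L0 e0 e4 hA hL; have kR : 0 < k%:R :> R by rewrite ltr0n.
split=> //; [by lra | by lra |] => B BA hB.
have BR : k%:R <= 2 * #|B|%:R :> R.
  have : (1 - 4^-1) * #|A|%:R <= (1 - eps) * #|A|%:R :> R by rewrite ler_wpM2r //; lra.
  lra.
have B0 : (0 < #|B|)%N by rewrite -(ltr0n R); lra.
have hBV v : \sum_(j in B) dot v (tnth w j - mu) ^+ 2 <= (2 * L) * #|B|%:R * dot v v.
  apply: (@le_trans _ _ (\sum_(j in A) dot v (tnth w j - mu) ^+ 2)).
    rewrite [leRHS](bigID (mem B)) /= ler_wpDr //.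
      by apply: sumr_ge0 => j _; exact: sqr_ge0.
    rewrite le_eqVlt; apply/orP; left; apply/eqP; apply: eq_bigl => j.
    by case: (boolP (j \in B)) => jB; rewrite ?andbF // andbT (fintype.subsetP BA _ jB).
  apply: le_trans (hL v) _; rewrite ler_wpM2r ?dot_ge0 //.
  by have := ler_wpM2l L0 BR; lra.
have V0 : 0 <= 2 * L by rewrite mulr_ge0.
rewrite mulr1 expr1n mulr1 sqr_sqrtr //; split; first exact: emp_mean_dev.
apply: le_trans (emp_cov_opnorm B0 V0 hBV) _.
by rewrite mulrC ler_wpM2l // -[2](invrK) lef_pV2 ?posrE //; lra.
Qed.

Lemma stable_mean (R : realType) p k (w : k.-tuple 'rV[R]_p) (A : {set 'I_k})
    (eps delta : R) mu sigma :
  stable w A eps delta mu sigma -> l2norm (emp_mean w A - mu) <= sigma * delta.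
Proof.
case=> e0 _ _ /(_ A (subxx _)) [] // ; rewrite ler_piMl //; lra.
Qed.

(** * Multisets and corruption *)

Section multisets.
Context (V : eqType) (n : nat).
Implicit Types S T : n.-tuple V.

Lemma count_mem_tuple S v : count_mem v S = #|[set i | tnth S i == v]%SET|.
Proof. by rewrite -sum1_count big_tuple -sum1_card; apply: eq_bigl => i; rewrite inE. Qed.

Lemma agree_le_cap S T :
  (#|[set i | tnth S i == tnth T i]%SET| <= mset_cap_size S T)%N.
Proof.
rewrite /mset_cap_size -sum1_card.
have one i : (1 = \sum_(v <- undup S) (tnth S i == v))%N.
  have <- : count_mem (tnth S i) (undup S) = 1%N.
    by rewrite count_uniq_mem ?undup_uniq // mem_undup mem_tnth.
  rewrite -sum1_count big_mkcond; apply: eq_bigr => v _ /=.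
  by rewrite eq_sym; case: (_ == _).
rewrite (eq_bigr _ (fun i _ => one i)) exchange_big /=; apply: leq_sum => v _.
rewrite -big_mkcondr /= sum1_card leq_min !count_mem_tuple; apply/andP; split.
  by apply: subset_leq_card; apply/fintype.subsetP => i /andP[_]; rewrite inE.
apply: subset_leq_card; apply/fintype.subsetP => i /andP[].
by rewrite !inE => /eqP <-.
Qed.

Lemma common_part S T : exists u s1 s2,
  [/\ size u = mset_cap_size S T, perm_eq S (u ++ s1) & perm_eq T (u ++ s2)].
Proof.
pose c v := minn (count_mem v S) (count_mem v T).
pose u := flatten [seq nseq (c v) v | v <- undup S].
have su : size u = mset_cap_size S T.
  rewrite /u size_flatten /shape -map_comp sumnE big_map /mset_cap_size.
  by apply: eq_bigr => v _; rewrite /= size_nseq.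
have cu v : (count_mem v u <= c v)%N.
  rewrite /u count_flatten -map_comp sumnE big_map.
  have E a : (count_mem v (nseq (c a) a) = if a == v then c v else 0)%N.
    by rewrite count_nseq /=; case: eqP => [->|_]; rewrite ?mul1n ?mul0n.
  rewrite (eq_bigr _ (fun a _ => E a)) -big_mkcond /= big_const_seq iter_addn_0.
  have : (count (fun a => a == v) (undup S) <= 1)%N.
    by rewrite count_uniq_mem ?undup_uniq // leq_b1.
  by case: (count _ _) => [|[]] // _; rewrite ?muln0 ?muln1.
have [|s1' sub1 p1] := (count_subseqP u S).1.
  by move=> v; apply: leq_trans (cu v) (geq_minl _ _).
have [|s2' sub2 p2] := (count_subseqP u T).1.
  by move=> v; apply: leq_trans (cu v) (geq_minr _ _).
have [s1 h1] := perm_to_subseq sub1; have [s2 h2] := perm_to_subseq sub2.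
exists u, s1, s2; split=> //.
  by rewrite (perm_trans h1) // perm_cat2r perm_sym.
by rewrite (perm_trans h2) // perm_cat2r perm_sym.
Qed.

(** Both tuples rearrange a common part followed by a rest; aligning the positions of the common
    part gives the permutation. *)
Lemma cap_permutation S T : exists pi : 'S_n,
  (mset_cap_size S T <= #|[set i | tnth T (pi i) == tnth S i]%SET|)%N.
Proof.
have [u [s1 [s2 [su p1 p2]]]] := common_part S T.
have z1 : size (u ++ s1) == n by rewrite -(perm_size p1) size_tuple.
have z2 : size (u ++ s2) == n by rewrite -(perm_size p2) size_tuple.
have /tuple_permP[sg hS] : perm_eq S (Tuple z1) by [].
have /tuple_permP[ta hT] : perm_eq T (Tuple z2) by [].
have tS i : tnth S i = tnth (Tuple z1) (sg i).
  by rewrite (_ : S = [tuple tnth (Tuple z1) (sg i) | i < n]) ?tnth_mktuple //; exact/val_inj.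
have tT i : tnth T i = tnth (Tuple z2) (ta i).
  by rewrite (_ : T = [tuple tnth (Tuple z2) (ta i) | i < n]) ?tnth_mktuple //; exact/val_inj.
exists (sg * ta^-1)%g.
have un : (size u <= n)%N by rewrite -(eqP z1) size_cat leq_addr.
have -> : mset_cap_size S T = #|[set i : 'I_n | (sg i < size u)%N]%SET|.
  rewrite -su (_ : [set i : 'I_n | _]%SET = sg @^-1: [set l : 'I_n | (l < size u)%N]%SET).
    rewrite card_preimset; last exact: perm_inj.
    rewrite -sum1_card (eq_bigl (fun l : 'I_n => (l < size u)%N)) => [|l]; last by rewrite inE.
    by rewrite -(big_ord_widen n (fun=> 1)%N un) sum1_card card_ord.
  by apply/setP => i; rewrite !inE.
apply: subset_leq_card; apply/fintype.subsetP => i; rewrite !inE => hi.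
have x0 := tnth S i.
by rewrite tS tT permM permKV !(tnth_nth x0) /= !nth_cat hi.
Qed.

End multisets.

(** The product [s * pi] applies [s] first, so position i reads entry s i of S and entry pi (s i) of
    T. Every disagreement lies in at most one bucket and spoils at most that one. *)
Lemma corrupted_buckets (R : realType) p n k (b : 'rV[R]_p)
    (S T : n.-tuple ('rV[R]_p * R)) (pi s : 'S_n) (eps eps0 : R) :
  (1 - eps) * n%:R <= #|[set i | tnth T (pi i) == tnth S i]%SET|%:R ->
  eps * n%:R <= eps0 * k%:R ->
  corrupted eps0 (bucket_means k s (debias b S))
    (bucket_means k (s * pi)%g (debias b T)).
Proof.
move=> hG hk; set G := [set i | _]%SET in hG.
set w := bucket_means k s _; set w' := bucket_means k _ _.
rewrite /corrupted; apply: (@le_trans _ _ #|[set j | tnth w j == tnth w' j]%SET|%:R); last first.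
  by rewrite ler_nat agree_le_cap.
have bad : (#|[set j | tnth w j != tnth w' j]%SET| <= #|~: G|)%N.
  have step j : ((tnth w j != tnth w' j) <=
      \sum_(i < n | (i %/ (n %/ k) == j)%N) (s i \notin G))%N.
    case: (boolP (tnth w j == tnth w' j)) => //= wj.
    rewrite lt0n; apply: contraNneq wj => /eqP; rewrite sum_nat_eq0 => /forallP hs.
    rewrite !tnth_mktuple; apply/eqP; congr (_ *: _); apply: eq_bigr => i ij.
    have := hs i; rewrite ij /= eqb0 negbK inE => /eqP h.
    by rewrite !tnth_debias permM h.
  rewrite -sum1_card big_mkcond /=.
  apply: (@leq_trans (\sum_(j < k) \sum_(i < n | (i %/ (n %/ k) == j)%N) (s i \notin G))).
    by apply: leq_sum => j _; apply: leq_trans (step j); rewrite inE; case: (_ != _).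
  rewrite (exchange_big_dep predT) //=.
  have -> : #|~: G| = (\sum_(i < n) (s i \notin G))%N.
    rewrite -(card_preimset _ (@perm_inj _ s)) -sum1_card big_mkcond.
    by apply: eq_bigr => i _; rewrite !inE; case: (_ == _).
  apply: leq_sum => i _; rewrite sum_nat_const -[leqRHS]mul1n leq_mul2r; apply/orP; right.
  rewrite (leq_trans _ (_ : #|[pred j : 'I_k | (i %/ (n %/ k) == j)%N]| <= 1)%N) //.
  apply/card_le1_eqP => j j'; rewrite !inE => /eqP h1 /eqP h2.
  by apply/val_inj; rewrite /= -h1 -h2.
have h1 := cardsC G; rewrite card_ord in h1; have h1R := congr1 (fun l => l%:R : R) h1.
have h2 := cardsC [set j | tnth w j == tnth w' j]%SET; rewrite card_ord in h2.
have h2R := congr1 (fun l => l%:R : R) h2.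
have E : ~: [set j | tnth w j == tnth w' j]%SET = [set j | tnth w j != tnth w' j]%SET.
  by apply/setP => j; rewrite !inE.
rewrite E in h2R; rewrite !natrD in h1R h2R.
have badR : #|[set j | tnth w j != tnth w' j]%SET|%:R <= #|~: G|%:R :> R by rewrite ler_nat.
by move: hG hk; lra.
Qed.

Section filter_success.
Context (R : realType) (c1 c2 c3 a beta Cmin : R).
Context dT (Theta : measurableType dT) (Q : probability Theta R) (filter : rfilter R Theta).
Hypotheses (mfilter : rfilter_measurable filter)
  (gfilter : rfilter_guarantee Q filter c1 c2 c3 a beta Cmin).
Hypothesis Cmin_gt1 : 1 < Cmin.

(** The filter has finitely many possible outputs, so any property of the output is a finite union
    of measurable events. *)
Lemma measurable_filter_event p k (w : k.-tuple 'rV[R]_p) (eps0 : R)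
    (G : {set 'I_k} -> Prop) :
  measurable [set theta | G (filter w eps0 theta)].
Proof.
rewrite (_ : [set theta | _] =
    \bigcup_(A in [set A | G A]) [set theta | filter w eps0 theta = A]).
  apply: fin_bigcup_measurable => [|A _]; first exact: finite_finset.
  have := measurable_xsection w (@mfilter p k eps0 A).
  rewrite (_ : xsection _ _ = [set theta | filter w eps0 theta = A]) //.
  by apply/seteqP; split=> theta /=; rewrite /xsection /= inE.
apply/seteqP; split=> [theta h|theta [A hA hf]]; first by exists (filter w eps0 theta).
by rewrite /= in hf *; rewrite hf.
Qed.

Lemma filter_success p n k (mu b : 'rV[R]_p) (S T : n.-tuple ('rV[R]_p * R))
    (pi s : 'S_n) (eps Q2 : R) :
  let eps0 := (4 * Cmin)^-1 in
  (0 < k)%N -> 0 <= Q2 ->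
  (1 - eps) * n%:R <= #|[set i | tnth T (pi i) == tnth S i]%SET|%:R ->
  eps * n%:R <= eps0 * k%:R ->
  light Q2 (80 / eps0) (bucket_dev (k := k) s mu b S) ->
  ((1 - a * expR (- (beta * (k%:R * eps0))))%:E <=
   Q [set theta | (l2norm (emp_mean (bucket_means k (s * pi)%g (debias b T))
       (filter (bucket_means k (s * pi)%g (debias b T)) eps0 theta) - mu)
     <= c3 * Num.sqrt (6400 * Q2))%R])%E.
Proof.
move=> eps0 k0 Q20 hG hk hl.
have C0 : 0 < 4 * Cmin by have := Cmin_gt1; lra.
have e0 : 0 < eps0 by rewrite invr_gt0.
(* The guarantee is used at C0 = Cmin, where the stability parameter is exactly the 1/4 that
   [removal_stable] admits. *)
have Ce : Cmin * eps0 = 4^-1 by rewrite /eps0; field; have := Cmin_gt1; lra.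
have e4 : eps0 <= 4^-1 by rewrite -Ce ler_peMl // ltW.
have kR : 0 < k%:R :> R by rewrite ltr0n.
have lam0 : 0 < 80 / eps0 by apply: divr_gt0; [lra | exact: e0].
have [A hA1 hA2] := light_removal k0 Q20 lam0 hl.
have hA : k%:R - #|A|%:R <= eps0 * k%:R.
  rewrite (le_trans hA1) // le_eqVlt; apply/orP; left; apply/eqP; field.
  by rewrite gt_eqF.
have hcor := corrupted_buckets b s hG hk.
have hA4 : k%:R - #|A|%:R <= 4^-1 * k%:R :> R.
  by rewrite (le_trans hA) // ler_wpM2r // ltW.
have hstab := removal_stable (w := bucket_means k s (debias b S)) k0
  (_ : 0 <= 3200 * Q2) (_ : 0 < Cmin * eps0) (_ : Cmin * eps0 <= 4^-1) hA4 hA2.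
have {}hstab : stable (bucket_means k s (debias b S)) A (Cmin * eps0) 1 mu
    (Num.sqrt (2 * (3200 * Q2))).
  by apply: hstab; rewrite ?Ce; lra.
have e1 : 0 < eps0 < 2^-1 by rewrite e0 /=; lra.
have hAe : (1 - eps0) * k%:R <= #|A|%:R by lra.
have := gfilter e1 (lexx _) (sqrtr_ge0 _) hcor hAe hstab.
move=> /le_trans; apply; apply: le_measure; rewrite ?inE.
- exact: (measurable_filter_event _ _ (fun A => (1 - c1 * eps0) * k%:R <= #|A|%:R /\
    stable _ A (c2 * Cmin * eps0) (c3 * 1) mu (Num.sqrt (2 * (3200 * Q2))))).
- exact: (measurable_filter_event _ _ (fun A => l2norm (emp_mean _ A - mu) <= c3 * Num.sqrt (6400 * Q2))).
move=> theta /= [_ /stable_mean h].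
have E : 2 * (3200 * Q2) = 6400 * Q2 by ring.
by move: h; rewrite mulr1 mulrC E.
Qed.

End filter_success.

(** * Constants *)

(** Write t for the minimum. From ln t <= t - 1 and t <= 1/2 one gets l >= 1/2, and exp(-2l) = t^2
    <= tau/2. The cap costs at most an additive 1 in the logarithm. *)
Lemma log_min_bounds (R : realType) (tau : R) : 0 < tau -> tau < 1 ->
  let l := ln (Num.min tau 2^-1)^-1 in
  [/\ 2^-1 <= l, l <= ln tau^-1 + 1, 0 <= ln tau^-1 & expR (- (2 * l)) <= tau / 2].
Proof.
move=> t0 t1 l; pose t := Num.min tau 2^-1.
have tpos : 0 < t by rewrite lt_min t0 invr_gt0 ltr0n.
have t2 : t <= 2^-1 by rewrite ge_min lexx orbT.
have tt : t <= tau by rewrite ge_min lexx.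
have lE : l = - ln t by rewrite /l lnV // posrE.
have ln_le y : 0 < y -> ln y <= y - 1 :> R.
  by move=> y0; have := @le_ln1Dx R (y - 1); rewrite (_ : 1 + (y - 1) = y); [apply; lra | ring].
have l0 : 0 <= ln tau^-1 by rewrite lnV ?posrE // oppr_ge0 ln_le0 // ltW.
split=> //.
- by rewrite lE; have := ln_le t tpos; lra.
- have [h|h] := leP tau 2^-1; first by rewrite /l min_l //; lra.
  rewrite /l min_r ?(ltW h) // invrK; have := ln_le 2; lra.
- have E : expR (- (2 * l)) = t ^+ 2.
    by rewrite lE mulrN opprK expRM_natl lnK ?posrE.
  rewrite E expr2; apply: ler_pM => //; exact: ltW.
Qed.

(** As kappa >= 2 and l >= 1/2, the number under the ceiling is at least 1, so rounding up at most
    doubles it; being at most n/2, it gives k <= n, and then n/k loses at most a factor 2 when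
    rounded down. *)
Lemma bucket_count_bounds (R : realType) (kappa eps tau : R) (n : nat) :
  2 <= kappa -> (0 < n)%N -> 0 <= eps -> 0 < tau -> tau < 1 ->
  eps_prime kappa eps tau n <= 2^-1 ->
  let l := ln (Num.min tau 2^-1)^-1 in
  let k := `|Num.ceil (eps_prime kappa eps tau n * n%:R)|%N in
  [/\ (0 < k)%N, (0 < n %/ k)%N, kappa * (eps * n%:R + l) <= k%:R,
      k%:R <= 2 * (kappa * (eps * n%:R + l)) &
      (n %/ k)%:R^-1 <= 2 * k%:R / n%:R :> R].
Proof.
move=> kap n0 e0 t0 t1 hle l k.
have [l2 _ _ _] := log_min_bounds t0 t1; rewrite -/l in l2.
have nR : 0 < n%:R :> R by rewrite ltr0n.
have E : eps_prime kappa eps tau n * n%:R = kappa * (eps * n%:R + l).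
  by rewrite /eps_prime -/l; field; rewrite gt_eqF.
have en : 0 <= eps * n%:R by rewrite mulr_ge0 // ltW.
have x1 : 1 <= kappa * (eps * n%:R + l) by nra.
set y := kappa * _ in E x1 *.
have c0 : 0 <= Num.ceil y by rewrite ceil_ge0; lra.
have kE : k%:R = (Num.ceil y)%:~R :> R.
  by rewrite /k E -[in RHS](gez0_abs c0).
have h1 : y <= k%:R by rewrite kE ceil_ge.
have h2 : k%:R < y + 1 by rewrite kE -ltrBlDr; have := ceilB1_lt y; rewrite intrB.
have k0 : (0 < k)%N by rewrite -(ltr0n R); lra.
have kn : (k <= n)%N.
  rewrite -(ler_nat R); have : y <= 2^-1 * n%:R by rewrite -E ler_wpM2r // ltW.
  lra.
have m0 : (0 < n %/ k)%N by rewrite divn_gt0.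
split=> //; first by lra.
have hn : (n < (2 * k * (n %/ k)).+1)%N.
  rewrite ltnS {1}(divn_eq n k); have := ltn_pmod n k0.
  have := m0; move: (n %/ k)%N (n %% k)%N => m r m1 rk.
  rewrite -mulnA mulnC mul2n -addnn leq_add2l (leq_trans (ltnW rk)) //.
  by rewrite leq_pmulr.
rewrite ler_pdivlMr // mulrC ler_pdivrMr ?ltr0n //.
by rewrite -!natrM ler_nat.
Qed.

Lemma sqrt_add3 (R : realType) (x y z : R) : 0 <= x -> 0 <= y -> 0 <= z ->
  Num.sqrt (x + y + z) <= Num.sqrt x + Num.sqrt y + Num.sqrt z.
Proof.
move=> x0 y0 z0.
have h : 0 <= Num.sqrt x + Num.sqrt y + Num.sqrt z by rewrite !addr_ge0 ?sqrtr_ge0.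
rewrite -[leRHS]ger0_norm // -sqrtr_sqr ler_wsqrtr //.
have := sqrtr_ge0 x; have := sqrtr_ge0 y; have := sqrtr_ge0 z.
have := sqr_sqrtr x0; have := sqr_sqrtr y0; have := sqr_sqrtr z0.
move: (Num.sqrt x) (Num.sqrt y) (Num.sqrt z) => a b c <- <- <- c0 b0 a0.
nra.
Qed.

(** The product (1 + p/k)(k/n) is (p + k)/n, and k is at most a multiple of eps n + lt + 1. The
    extra 1 is absorbed by p >= 1. *)
Lemma error_bound (R : realType) (n p k : nat) (C K sigma c c3 kappa eps l lt : R) :
  (0 < n)%N -> (0 < p)%N -> (0 < k)%N -> 0 < c -> 0 < c3 -> 0 <= kappa -> 0 <= eps ->
  0 <= lt -> 0 <= sigma -> l <= lt + 1 ->
  k%:R <= 2 * (kappa * (eps * n%:R + l)) ->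
  (n %/ k)%:R^-1 <= 2 * k%:R / n%:R :> R ->
  c3 * Num.sqrt (6400 * threshold n p k C K sigma c) <=
  c3 * Num.sqrt (6400 * (64 * c * (C ^+ 4 * K ^+ 2 + 1) * (2 * kappa + 1))) *
   (sigma * (Num.sqrt (p%:R / n%:R) + Num.sqrt eps + Num.sqrt (lt / n%:R))).
Proof.
move=> n0 p0 k0 c0 c30 kap0 e0 lt0 s0 hl hk hm.
have nR : 0 < n%:R :> R by rewrite ltr0n.
have kR : 0 < k%:R :> R by rewrite ltr0n.
have pR : 1 <= p%:R :> R by rewrite ler1n.
pose A := C ^+ 4 * K ^+ 2 + 1.
have A0 : 0 <= A by rewrite /A addr_ge0 // mulr_ge0 ?sqr_ge0 // (exprM C 2 2) sqr_ge0.
pose W := p%:R / n%:R + eps + lt / n%:R.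
have hT : threshold n p k C K sigma c <= 64 * c * A * (2 * kappa + 1) * sigma ^+ 2 * W.
  have -> : threshold n p k C K sigma c =
      32 * c * A * sigma ^+ 2 * (1 + p%:R / k%:R) * (n %/ k)%:R^-1.
    by rewrite /threshold /bucket_var -/A; ring.
  have cA : 0 <= c * A * sigma ^+ 2 by rewrite !mulr_ge0 ?sqr_ge0 // ltW.
  have q0 : 0 <= 32 * c * A * sigma ^+ 2 * (1 + p%:R / k%:R).
    have h : 0 <= p%:R / k%:R :> R by rewrite divr_ge0.
    by have := mulr_ge0 cA h; lra.
  apply: (le_trans (ler_wpM2l q0 hm)).
  have -> : 32 * c * A * sigma ^+ 2 * (1 + p%:R / k%:R) * (2 * k%:R / n%:R) =
     64 * (c * A * sigma ^+ 2) * ((k%:R + p%:R) / n%:R).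
    by field; rewrite !gt_eqF.
  have -> : 64 * c * A * (2 * kappa + 1) * sigma ^+ 2 * W =
     64 * (c * A * sigma ^+ 2) * ((2 * kappa + 1) * W) by ring.
  apply: ler_wpM2l; first by lra.
  rewrite ler_pdivrMr //.
  have -> : (2 * kappa + 1) * W * n%:R = (2 * kappa + 1) * (p%:R + eps * n%:R + lt).
    by rewrite /W; field; rewrite gt_eqF.
  have en : 0 <= eps * n%:R by rewrite mulr_ge0 // ltW.
  nra.
have hW : Num.sqrt W <= Num.sqrt (p%:R / n%:R) + Num.sqrt eps + Num.sqrt (lt / n%:R).
  by apply: sqrt_add3 => //; rewrite divr_ge0 // ltW.
rewrite -mulrA; apply: ler_wpM2l; first exact: ltW.
set M := 6400 * (64 * c * A * (2 * kappa + 1)).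
have M0 : 0 <= M.
  have : 0 <= c * A * (2 * kappa + 1) by rewrite !mulr_ge0 ?(ltW c0) //; lra.
  by rewrite /M; lra.
apply: (@le_trans _ _ (Num.sqrt (M * (sigma ^+ 2 * W)))).
  by rewrite ler_wsqrtr // /M; lra.
rewrite sqrtrM // ler_wpM2l ?sqrtr_ge0 // sqrtrM ?sqr_ge0 // sqrtr_sqr ger0_norm //.
by rewrite ler_wpM2l.
Qed.

(** From a <= e^a and (2 + 2a) l >= 2l + a, valid for l >= 1/2, the prefactor a of the filter's
    failure probability is absorbed; kappa >= 4 gives k/2 >= 2l. Each failure probability is then at
    most tau/2. *)
Lemma failure_bound (R : realType) (a b eps0 kappa l tau : R) (k : nat) :
  0 < a -> 0 < b -> 0 < eps0 -> 2^-1 <= l -> 4 <= kappa ->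
  2 + 2 * a <= kappa * (b * eps0) -> kappa * l <= k%:R ->
  expR (- (2 * l)) <= tau / 2 ->
  1 - tau <= (1 - a * expR (- (b * (k%:R * eps0)))) * (1 - expR (- (k%:R / 2))) /\
  a * expR (- (b * (k%:R * eps0))) <= 1.
Proof.
move=> a0 b0 e0 l2 kap4 hkap hk ht.
have h1 : expR (- (k%:R / 2)) <= expR (- (2 * l)).
  by rewrite ler_expR; nra.
have h2 : a * expR (- (b * (k%:R * eps0))) <= expR (- (2 * l)).
  have : a <= expR a by have := expR_ge1Dx a; lra.
  move=> /(ler_wpM2r (expR_ge0 (- (b * (k%:R * eps0)))))/le_trans; apply.
  rewrite -expRD ler_expR.
  have : kappa * (b * eps0) * l <= b * (k%:R * eps0).
    have -> : kappa * (b * eps0) * l = (b * eps0) * (kappa * l) by ring.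
    have -> : b * (k%:R * eps0) = (b * eps0) * k%:R by ring.
    by rewrite ler_wpM2l // mulr_ge0 // ltW.
  nra.
have h3 : expR (- (2 * l)) <= 1 by rewrite -[leRHS]expR0 ler_expR; lra.
split; last by lra.
have := mulr_ge0 (mulr_ge0 (ltW a0) (expR_ge0 (- (b * (k%:R * eps0))))) (expR_ge0 (- (k%:R / 2))).
by lra.
Qed.

Lemma corruption_budget (R : realType) (eps eps0 kappa l : R) (n k : nat) :
  0 <= eps -> 0 < eps0 -> 0 <= kappa -> 0 <= l -> 1 <= kappa * eps0 ->
  kappa * (eps * n%:R + l) <= k%:R -> eps * n%:R <= eps0 * k%:R.
Proof.
move=> e0 e00 kap0 l0 kapE; rewrite mulrDr => hk.
have en0 : 0 <= eps * n%:R by rewrite mulr_ge0.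
have kl : 0 <= kappa * l by rewrite mulr_ge0.
have h : kappa * (eps * n%:R) <= k%:R by lra.
apply: (le_trans (ler_peMl en0 kapE)); rewrite (mulrC kappa) -mulrA.
by apply: ler_wpM2l; [exact: ltW | exact: h].
Qed.

Lemma threshold_ge0 (R : realType) (n p k : nat) (C K sigma c : R) :
  0 <= c -> 0 <= threshold n p k C K sigma c.
Proof.
move=> c0; have v0 := bucket_var_ge0 n k C K sigma.
have p0 : 0 <= p%:R / k%:R :> R by rewrite divr_ge0.
have cv : 0 <= c * bucket_var n k C K sigma by rewrite mulr_ge0.
by rewrite /threshold; have := mulr_ge0 cv p0; lra.
Qed.

(** * Averaging over the random partition, and the error bound *)

Lemma average_product_ge (R : realType) n d (Omega : measurableType d)
    dT (Theta : measurableType dT) (P : probability Omega R) (Q : probability Theta R)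
    (E : 'S_n -> set (Omega * Theta)) (G : 'S_n -> set Omega) (pi : Omega -> 'S_n)
    (q alpha : R) :
  (forall s, measurable (E s)) -> (forall s, measurable (G s)) -> 0 <= q ->
  (forall s w, G s w -> (q%:E <= Q [set theta | E (s * pi w)%g (w, theta)])%E) ->
  (forall s, P (~` G s) <= alpha%:E)%E ->
  ((q * (1 - alpha))%:E <= (n`!%:R^-1)%:E * \sum_(s : 'S_n) (P \x Q) (E s))%E.
Proof.
move=> mE mG q0 hq ha.
pose phi s w := Q (xsection (E s) w).
have phiE s w : phi s w = Q [set theta | E s (w, theta)].
  by congr (Q _); apply/seteqP; split=> theta /=; rewrite /xsection /= inE.
have mphi s : measurable_fun setT (phi s) := measurable_fun_xsection Q (mE s).
have f0 : (0 < n`!%:R :> R) by rewrite ltr0n fact_gt0.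
have sumE : (\sum_(s : 'S_n) (P \x Q) (E s) = \int[P]_w \sum_(s : 'S_n) phi s w)%E.
  by rewrite ge0_integral_sum.
have PG s : P (G s) = (fine (P (G s)))%:E by rewrite fineK // fin_num_measure.
have hG s : 1 - alpha <= fine (P (G s)).
  have := ha s; rewrite probability_setC // PG -EFinB lee_fin; lra.
have mg s : measurable_fun setT (fun w => (q * \1_(G s) w)%:E).
  by apply/measurable_EFinP; apply: measurable_funM => //; exact: measurable_indic.
have g0 s w : (0 <= (q * \1_(G s) w)%:E :> \bar R)%E by rewrite lee_fin mulr_ge0.
have low : ((n`!%:R * (q * (1 - alpha)))%:E <= \sum_(s : 'S_n) (P \x Q) (E s))%E.
  rewrite sumE; apply: (@le_trans _ _ (\int[P]_w \sum_(s : 'S_n) (q * \1_(G s) w)%:E)%E).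
    rewrite ge0_integral_sum //.
    apply: (@le_trans _ _ (\sum_(s : 'S_n) (q * (1 - alpha))%:E)%E).
      by rewrite sumEFin sumr_const card_Sn lee_fin -[leRHS]mulr_natl.
    apply: lee_sum => s _; under eq_integral do rewrite EFinM.
    rewrite ge0_integralZl_EFin //; last by exact/measurable_EFinP.
    rewrite integral_indic // setIT -[X in (_ <= _ * X)%E]fineK ?fin_num_measure //.
    by rewrite -EFinM lee_fin ler_wpM2l //; exact: hG.
  apply: ge0_le_integral => //.
  - by move=> w _; apply: sume_ge0 => s _.
  - by apply: emeasurable_sum.
  - by apply: emeasurable_sum.
  (* For fixed w, right translation by pi w permutes the symmetric group, so an alignment that
     depends on the whole sample does not change the uniform average. *)
  move=> w _; rewrite [leRHS](reindex_inj (mulIg (pi w))).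
  apply: lee_sum => s _; rewrite phiE indicE; case: (boolP (w \in G s)) => [|_].
    by rewrite inE mulr1; exact: hq.
  by rewrite mulr0.
have f1 : (0 <= (n`!%:R^-1)%:E :> \bar R)%E by rewrite lee_fin invr_ge0 ltW.
apply: le_trans (lee_wpmul2l f1 low).
by rewrite -EFinM mulKf // gt_eqF.
Qed.

Lemma measurable_l2norm d (S : measurableType d) (R : realType) p
    (f : S -> 'rV[R]_p) :
  measurable_fun setT f -> measurable_fun setT (fun s => l2norm (f s)).
Proof.
move=> mf; under eq_fun do rewrite l2normE.
apply: measurableT_comp; last exact: measurable_fun_dot.
by apply: continuous_measurable_fun; exact: sqrt_continuous.
Qed.

Lemma measurable_filtered_error (R : realType) p k d (Omega : measurableType d)
    dT (Theta : measurableType dT) (filter : rfilter R Theta) (eps0 rhs : R)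
    (mu : 'rV[R]_p) (W : Omega -> k.-tuple 'rV[R]_p) :
  rfilter_measurable filter -> measurable_fun setT W ->
  measurable [set u : Omega * Theta |
    l2norm (emp_mean (W u.1) (filter p k (W u.1) eps0 u.2) - mu) <= rhs].
Proof.
move=> mfilter mW.
rewrite (_ : [set u | _] = \bigcup_(A in [set: {set 'I_k}])
  ([set u | filter p k (W u.1) eps0 u.2 = A] `&`
   ~` [set u | rhs < l2norm (emp_mean (W u.1) A - mu)])).
  apply: fin_bigcup_measurable => [|A _]; first exact: finite_finset.
  have mW1 : measurable_fun [set: Omega * Theta] (fun u => W u.1) by exact: measurableT_comp.
  apply: measurableI.
    have mpair : measurable_fun [set: Omega * Theta] (fun u => (W u.1, u.2)).
      exact: measurable_fun_pair.
    have := mpair measurableT _ (@mfilter p k eps0 A).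
    by rewrite setTI.
  apply: measurableC; apply: measurable_set_lt; apply: measurable_l2norm.
  apply: measurable_fun_mx => i a.
  rewrite (_ : (fun u => _) = fun u : Omega * Theta => #|A|%:R^-1 *
     \sum_(j < k) (if j \in A then tnth (W u.1) j i a else 0) - mu i a).
    apply: measurable_funB => //; apply: measurable_funM => //.
    apply: measurable_sum => j; case: (j \in A) => //.
    have mj : measurable_fun [set: Omega * Theta] (fun u => tnth (W u.1) j).
      by move/measurable_fun_tnthP : mW1 => /(_ j).
    exact: (measurableT_comp (measurable_entry i a) mj).
  by apply/funext => u; rewrite /emp_mean !mxE summxE big_mkcond.
apply/seteqP; split=> u /=.
  by move=> h; exists (filter p k (W u.1) eps0 u.2) => //; split=> //; apply/negP; rewrite -leNgt.
by move=> [A _ [<- /negP]]; rewrite -leNgt.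
Qed.

Theorem theorem6p2 (R : realType)
    (c1 c2 c3 a b Cmin : R) (hc1 : 0 < c1) (hc2 : 0 < c2) (hc3 : 0 < c3)
    (ha : 0 < a) (hb : 0 < b) (hCmin : 1 < Cmin)
    (C K : R) (hC : 0 < C) (hK : 0 < K) :
  exists eps0 kappa0 : R, [/\ 0 < eps0, eps0 < 2^-1, 0 < kappa0 &
  forall kappa : R, kappa0 <= kappa ->
  exists c0 L : R, [/\ 0 < c0, 0 < L &
  forall (dT : measure_display) (Theta : measurableType dT)
    (Q : probability Theta R) (filter : rfilter R Theta),
    rfilter_measurable filter ->
    rfilter_guarantee Q filter c1 c2 c3 a b Cmin ->
  forall (n p : nat) (eps tau sigma : R),
    (0 < n)%N -> 0 <= eps -> 0 < tau -> tau < 1 -> 0 <= sigma ->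
    eps_prime kappa eps tau n <= c0 ->
  forall (d : measure_display) (Omega : measurableType d)
    (P : probability Omega R) (betastar : 'rV[R]_p)
    (x : 'I_n -> Omega -> 'rV[R]_p) (z : 'I_n -> Omega -> R) (s4 : R),
    (forall i, measurable_fun setT (x i)) ->
    (forall i, measurable_fun setT (z i)) ->
    mutually_independent P (fun i w => (x i w, z i w)) ->
    identically_distributed P (fun i w => (x i w, z i w)) ->
    (forall i, independent P (x i) (z i)) ->
    (forall i, isotropic P (x i)) ->
    (forall i, hypercontractive42 P (x i) s4) -> s4 <= C ->
    (forall i, 'E_P[z i] = 0)%E ->
    (forall i, 'E_P[fun w => (z i w ^+ 2)%R] = (sigma ^+ 2)%:E)%E ->
  forall (beta1 : Omega -> 'rV[R]_p) (T : Omega -> n.-tuple ('rV[R]_p * R)),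
    measurable_fun setT beta1 ->
    independent P beta1 (linear_sample betastar x z) ->
    {ae P, forall w, l2norm (beta1 w - betastar) <= K * sigma} ->
    measurable_fun setT T ->
    (forall w, corrupted eps (linear_sample betastar x z w) (T w)) ->
    ((1 - tau)%:E <=
     (n`!%:R^-1)%:E * \sum_(s : 'S_n)
       (P \x Q) [set u : Omega * Theta |
         (l2norm (filtered_mom filter eps0 (eps_prime kappa eps tau n)
                   (debias (beta1 u.1) (T u.1)) s u.2 - betastar)
          <= L * (sigma * (Num.sqrt (p%:R / n%:R) + Num.sqrt eps
                           + Num.sqrt (ln tau^-1 / n%:R))))%R])%E]].
Proof.
pose eps0 := (4 * Cmin)^-1; pose lam := 80 / eps0; pose c := 4 * expR lam.
have C40 : 0 < 4 * Cmin by lra.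
have eps0_gt0 : 0 < eps0 by rewrite invr_gt0.
have eps0_lt : eps0 < 2^-1 by rewrite /eps0 ltf_pV2 ?posrE //; lra.
have lam0 : 0 < lam by apply: divr_gt0; [lra | exact: eps0_gt0].
have c0 : 0 < c by rewrite /c; have := expR_gt0 lam; lra.
have be0 : 0 < b * eps0 by rewrite mulr_gt0.
have frac0 : 0 < (2 + 2 * a) / (b * eps0) by apply: divr_gt0; [lra | exact: be0].
have inv0 : 0 < eps0^-1 by rewrite invr_gt0.
(* The summands ensure in turn that e^(-k/2) is at most tau/2, that eps n <= eps0 k, and that the
   filter fails with probability at most tau/2. *)
exists eps0, (4 + eps0^-1 + (2 + 2 * a) / (b * eps0)); split=> //; first by lra.
move=> kappa hkappa.
have kap4 : 4 <= kappa by lra.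
have kap0 : 0 <= kappa by lra.
have kap2 : 2 <= kappa by lra.
have kapE : 1 <= kappa * eps0 by rewrite -ler_pdivrMr // div1r; lra.
have kapb : 2 + 2 * a <= kappa * (b * eps0) by rewrite -ler_pdivrMr //; lra.
pose A := C ^+ 4 * K ^+ 2 + 1.
have A0 : 0 < A by rewrite ltr_pwDr // mulr_ge0 ?sqr_ge0 // (exprM C 2 2) sqr_ge0.
have M0 : 0 < 6400 * (64 * c * A * (2 * kappa + 1)).
  have : 0 < c * A * (2 * kappa + 1) by apply: mulr_gt0; [exact: mulr_gt0 | lra].
  lra.
(* The bound 1/2 on the bucket fraction guarantees nonempty buckets, even after rounding k up. *)
exists 2^-1, (c3 * Num.sqrt (6400 * (64 * c * A * (2 * kappa + 1)))); split.
- by rewrite invr_gt0.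
- by apply: mulr_gt0; [exact: hc3 | rewrite sqrtr_gt0; exact: M0].
move=> dT Theta Q filter mfilter gfilter n p eps tau sigma n0 e0 t0 t1 s0 hle
  d Omega P betastar x z s4 mx mz ind _ xz iso hyp s4C z1 z2 beta1 T mb indb hnear mT hcor.
have [l2 hl lt0 hexp] := log_min_bounds t0 t1.
have l0 : 0 <= ln (Num.min tau 2^-1)^-1 by apply: le_trans l2; rewrite invr_ge0.
have [k0 m0 hk1 hk2 hm] := bucket_count_bounds kap2 n0 e0 t0 t1 hle.
set l := ln (Num.min tau 2^-1)^-1 in l0 l2 hl hexp hk1 hk2.
set k := `|Num.ceil _|%N in k0 m0 hk1 hk2 hm.
set rhs := _ * (sigma * _).
have rhs0 : 0 <= rhs.
  apply: mulr_ge0; first by apply: mulr_ge0; [exact: ltW | exact: sqrtr_ge0].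
  apply: mulr_ge0; first exact: s0.
  by apply: addr_ge0; [apply: addr_ge0|]; exact: sqrtr_ge0.
pose bm (s : 'S_n) w := bucket_means k s (debias (beta1 w) (T w)).
have mbm s : measurable_fun setT (bm s) by exact: measurable_bucket_means.
pose E (s : 'S_n) := [set u : Omega * Theta |
  l2norm (emp_mean (bm s u.1) (filter p k (bm s u.1) eps0 u.2) - betastar) <= rhs].
have mE s : measurable (E s) by exact: measurable_filtered_error.
pose S := linear_sample betastar x z.
have en : eps * n%:R <= eps0 * k%:R by exact: corruption_budget kap0 l0 kapE hk1.
have hkl : kappa * l <= k%:R.
  apply: le_trans hk1; apply: ler_wpM2l kap0 _ _ _.
  by rewrite lerDr; apply: mulr_ge0.
(* In dimension 0 the error is zero; this case is separate because [error_bound] absorbs a constant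
   into p. *)
have [pz|p_gt0] := posnP p.
  apply: le_trans (average_product_ge (E := E) (G := fun=> setT) (pi := fun=> 1%g)
    (q := 1) (alpha := 0) mE _ _ _ _) => //.
  - by rewrite lee_fin subr0 mulr1 gerBl ltW.
  - move=> s w _; rewrite (_ : [set theta | _] = setT) ?probability_setT //.
    apply/seteqP; split=> // theta _; rewrite /E /= /l2norm big1.
      by rewrite sqrtr0; exact: rhs0.
    by move=> i _; have := leq_ltn_trans (leq0n i) (ltn_ord i) => h; exfalso; move: h; rewrite pz.
  - by move=> s; rewrite setCT measure0.
have Q20 : 0 <= threshold n p k C K sigma c by exact/threshold_ge0/ltW.
pose good (s : 'S_n) := [set w | light (threshold n p k C K sigma c) lam
  (bucket_dev (k := k) s betastar (beta1 w) (S w))].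
have hgood s := prob_not_light mx mz ind xz iso hyp s4C z1 z2 m0 s mb indb hnear lam0 k0.
pose pi w : 'S_n := projT1 (cid (cap_permutation (S w) (T w))).
have hpi w : (1 - eps) * n%:R <= #|[set i | tnth (T w) (pi w i) == tnth (S w) i]%SET|%:R.
  apply: (le_trans (hcor w)); rewrite ler_nat /pi; case: cid => /= pi' hpi'.
  exact: hpi'.
have [hfail ha1] := failure_bound ha hb eps0_gt0 l2 kap4 kapb hkl hexp.
apply: le_trans (average_product_ge (E := E) (G := good) (pi := pi)
  (q := 1 - a * expR (- (b * (k%:R * eps0)))) (alpha := expR (- (k%:R / 2))) mE _ _ _ _).
- by rewrite lee_fin.
- by move=> s; have [] := hgood s.
- by rewrite subr_ge0.
- move=> s w /= hw.
  have := filter_success mfilter gfilter hCmin k0 Q20 (hpi w) en hw.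
  move/le_trans; apply; apply: le_measure; rewrite ?inE.
  + exact: (measurable_filter_event mfilter _ _ (fun A => l2norm (emp_mean _ A - betastar) <= _)).
  + exact: (measurable_filter_event mfilter (bm (s * pi w)%g w) eps0
      (fun A => l2norm (emp_mean (bm (s * pi w)%g w) A - betastar) <= rhs)).
  move=> theta /= h; rewrite /E /=; apply: (le_trans h).
  exact: (error_bound C K n0 p_gt0 k0 c0 hc3 kap0 e0 lt0 s0 hl hk2 hm).
- by move=> s; have [] := hgood s.
Qed.
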